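(* Let $\Omega$ be a regular domain with $N(\Omega)<+\infty$ (that is, the family of holes in $\Omega$ is uniformly locally finite). If $\Omega$ has the interpolation property, then there exist $S<+\infty$ and $M\in\mathbb N$ such that the graph $G(\Omega,S)$ is connected and for any hole $B_j$ the distance from $B_j$ to $\mathbb D^{(c)}$ in the graph $G(\Omega,S)$ is no more than $M$. The numbers $S$ and $M$ can be estimated from above only through $C_I(\Omega)$ and $N(\Omega)$.
   Context: $\mathbb D=\{z\in\mathbb C:|z|<1\}$, $E^{(c)}=\mathbb C\setminus E$; $\mathrm{dist}$ and $\mathrm{diam}$ are Euclidean. Regular domain: $\Omega=\mathbb D\setminus\bigcup_j B_j$, where $\{B_j\}$ is a countable (infinite or finite) family of pairwise disjoint compact subsets of $\mathbb D$, called holes, such that each $B_j$ is connected, does not separate the plane, and is the closure of a domain with smooth boundary, and the $B_j$ accumulate only to $\partial\mathbb D$ (every compact subset of $\mathbb D$ meets only finitely many $B_j$). $L^{2,1}_c(\Omega)$ is the Hilbert space of real differential $1$-forms $\omega=\omega_x dx+\omega_y dy$ on $\Omega$ with $\omega_x,\omega_y\in L^2(\Omega)$ that are closed, $d\omega=0$ in the sense of distributions; $\|\omega\|^2=\int_\Omega(\omega_x^2+\omega_y^2)\,d\lambda_2$. For each $j$ let $\gamma_j\subset\Omega$ be a smooth closed curve winding once in the positive direction around $B_j$ and not winding around the other holes; $\mathrm{Per}_j(\omega)=\int_{\gamma_j}\omega$ for smooth closed $L^2$-forms, extended by continuity to $L^{2,1}_c(\Omega)$. $\mathrm{Per}\,\omega=\{\mathrm{Per}_j\omega\}_j$.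 Interpolation property: there is $C<+\infty$ such that for every real $a\in\ell^2$ there is $\omega\in L^{2,1}_c(\Omega)$ with $\mathrm{Per}\,\omega=a$, $\|\omega\|\le C\|a\|_{\ell^2}$; $C_I(\Omega)$ is the least such $C$. Hyperbolic distance in $\mathbb D$: $\mathrm{dist}_H(z_1,z_2)=\operatorname{arctanh}\left|\frac{z_1-z_2}{1-z_1\bar z_2}\right|$. $N(\Omega)$ is the least $N$ such that every disk of radius $1$ in the hyperbolic metric intersects no more than $N$ of the holes ($+\infty$ if there is none). Graph $G(\Omega,S)$, $S\in(0,+\infty)$: non-oriented graph whose vertices are all the holes $B_j$ and the set $\mathbb D^{(c)}$. Two distinct holes $B_j,B_k$ are joined by an edge iff $\mathrm{dist}(B_j,B_k)\le S\min\{\mathrm{diam}\,B_j,\mathrm{diam}\,B_k\}$; $B_j$ and $\mathbb D^{(c)}$ are joined by an edge iff $\mathrm{dist}(B_j,\mathbb D^{(c)})\le S\,\mathrm{diam}\,B_j$. The distance between two vertices is the number of edges of a shortest path (infinity if there is none). *)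

(* Defs.v *)
From HB Require Import structures.
From mathcomp Require Import all_boot all_order all_algebra.
From mathcomp Require Import all_classical all_reals all_analysis.
From mathcomp Require Import complex.

Set Implicit Arguments.
Unset Strict Implicit.
Unset Printing Implicit Defensive.

Import Order.TTheory GRing.Theory Num.Theory.
Import numFieldNormedType.Exports.
Local Open Scope classical_set_scope.
Local Open Scope ring_scope.

(* The complex plane is [R * R], which carries the product topology and the
   product measure. The library norm of [R * R] is the sup norm, so Euclidean
   and hyperbolic distances go through the complex modulus. *)
Notation plane R := (R * R)%type.

Definition cpx (R : realType) (z : plane R) : R[i] := Complex z.1 z.2.

Definition modulus (R : realType) (z : R[i]) : R := ComplexField.Normc.normc z.

Definition disk (R : realType) : set (plane R) := [set z | modulus (cpx z) < 1].
Arguments disk R : clear implicits.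

Definition edist (R : realType) (z w : plane R) : R := modulus (cpx z - cpx w).

Definition set_dist (R : realType) (A B : set (plane R)) : R :=
  inf [set r | exists z w, [/\ A z, B w & r = edist z w]].

Definition diam (R : realType) (A : set (plane R)) : R :=
  sup [set r | exists z w, [/\ A z, A w & r = edist z w]].

Definition arctanh (R : realType) (t : R) : R := ln ((1 + t) / (1 - t)) / 2.

Definition hdist (R : realType) (z w : plane R) : R :=
  arctanh (modulus ((cpx z - cpx w) / (1 - cpx z * conjc (cpx w)))).

Definition lebesgue2 (R : realType) :=
  (@lebesgue_measure R \x @lebesgue_measure R)%E.
Arguments lebesgue2 R : clear implicits.

(* The measurable space underlying [lebesgue2]. *)
Notation mplane R := (measurableTypeR R * measurableTypeR R)%type.

(* [f] is of class C^oo on the open set [U]: all iterated directional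
   derivatives exist and are continuous at the points of [U]. *)
Definition smooth_on (R : realType) (U : set (plane R)) (f : plane R -> R) :=
  forall (vs : seq (plane R)) (z : plane R), U z ->
    let g := foldr (fun (v : plane R) (h : plane R -> R) => 'D_v h) f vs in
    {for z, continuous g} /\ forall v, derivable g z v.

Definition smooth_closed_curve (R : realType) (c : R -> plane R) :=
  (forall n t, derivable (derive1n n c) t 1) /\ (forall t, c (t + 1) = c t).

(* [G] lies, near each boundary point, on one side of the regular zero set of
   a C^oo function. As [G] is meant to be open, its boundary is
   [closure G `\` G]. *)
Definition smooth_boundary (R : realType) (G : set (plane R)) :=
  forall p, (closure G `\` G) p ->
    exists (U : set (plane R)) (rho : plane R -> R),
      [/\ open U, U p, smooth_on U rho, exists v, 'D_v rho p != 0 &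
          G `&` U = [set z | U z /\ rho z < 0]].

Definition is_hole (R : realType) (B : set (plane R)) :=
  [/\ compact B, B `<=` disk R, connected B, connected (~` B) &
      exists G : set (plane R),
        [/\ open G, G !=set0, connected G, smooth_boundary G & B = closure G]].

Definition meets (R : realType) (I : Type) (B : I -> set (plane R))
    (A : set (plane R)) : set I :=
  [set i | B i `&` A !=set0].

Definition regular_holes (R : realType) (I : countType)
    (B : I -> set (plane R)) :=
  [/\ forall i, is_hole (B i),
      forall i j, i != j -> B i `&` B j = set0 &
      forall K, compact K -> K `<=` disk R -> finite_set (meets B K)].

Definition domain_of (R : realType) (I : countType) (B : I -> set (plane R)) :
    set (plane R) :=
  disk R `\` \bigcup_i B i.

(* A 1-form [w.1 dx + w.2 dy]; elements of L^2 spaces of forms are represented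
   by Borel functions. Values outside of the domain considered are junk. *)
Notation form R := (plane R -> plane R).

Definition test_function (R : realType) (Om : set (plane R))
    (phi : plane R -> R) :=
  smooth_on setT phi /\
  exists K, [/\ compact K, K `<=` Om & forall z, ~ K z -> phi z = 0].

Definition sqnorm_integral (R : realType) (Om : set (plane R)) (w : form R) :
    \bar R :=
  (\int[lebesgue2 R]_(z in Om) ((w z).1 ^+ 2 + (w z).2 ^+ 2)%:E)%E.

Definition form_norm (R : realType) (Om : set (plane R)) (w : form R) : R :=
  Num.sqrt (fine (sqnorm_integral Om w)).

(* Closedness against a test function [phi] reads
   [\int (w.1 * d_y phi - w.2 * d_x phi) = 0]. *)
Definition closed_L2_form (R : realType) (Om : set (plane R)) (w : form R) :=
  [/\ measurable_fun (Om : set (mplane R)) (fun z => (w z).1),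
      measurable_fun (Om : set (mplane R)) (fun z => (w z).2),
      (sqnorm_integral Om w < +oo)%E &
      forall phi, test_function Om phi ->
        (\int[lebesgue2 R]_(z in Om)
           ((w z).1 * 'D_((0, 1) : plane R) phi z
            - (w z).2 * 'D_((1, 0) : plane R) phi z)%:E)%E = 0%E].

Definition smooth_closed_L2_form (R : realType) (Om : set (plane R))
    (w : form R) :=
  [/\ closed_L2_form Om w, smooth_on Om (fun z => (w z).1) &
      smooth_on Om (fun z => (w z).2)].

Definition line_integral (R : realType) (c : R -> plane R) (w : form R) : R :=
  Rintegral (@lebesgue_measure R) `[0, 1]
    (fun t => (w (c t)).1 * (derive1 c t).1 + (w (c t)).2 * (derive1 c t).2).

(* The differential of the polar angle around [p]. *)
Definition angle_form (R : realType) (p : plane R) : form R :=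
  fun z => (- (z.2 - p.2) / edist z p ^+ 2, (z.1 - p.1) / edist z p ^+ 2).

Definition winding (R : realType) (c : R -> plane R) (p : plane R) : R :=
  line_integral c (angle_form p) / (2 * pi).

Definition period_curves (R : realType) (I : countType)
    (B : I -> set (plane R)) (gamma : I -> R -> plane R) :=
  forall i,
    [/\ smooth_closed_curve (gamma i),
        forall t, domain_of B (gamma i t),
        forall p, B i p -> winding (gamma i) p = 1 &
        forall j p, j != i -> B j p -> winding (gamma i) p = 0].

(* [p] is the period of [w] along [c]: the continuous extension to closed L^2
   forms of [line_integral c], defined on the smooth ones. *)
Definition is_period (R : realType) (Om : set (plane R)) (c : R -> plane R)
    (w : form R) (p : R) :=
  exists u : nat -> form R,
    [/\ forall n, smooth_closed_L2_form Om (u n),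
        (form_norm Om (fun z => u n z - w z) @[n --> \oo] --> (0 : R)) &
        (line_integral c (u n) @[n --> \oo] --> p)].

Definition sqsum (R : realType) (I : choiceType) (a : I -> R) : \bar R :=
  esum [set: I] (fun i => (a i ^+ 2)%:E).

Definition l2norm (R : realType) (I : choiceType) (a : I -> R) : R :=
  Num.sqrt (fine (sqsum a)).

Definition interpolation_with (R : realType) (I : countType)
    (B : I -> set (plane R)) (gamma : I -> R -> plane R) (C : R) :=
  forall a : I -> R, (sqsum a < +oo)%E ->
    exists w : form R,
      [/\ closed_L2_form (domain_of B) w,
          forall i, is_period (domain_of B) (gamma i) w (a i) &
          form_norm (domain_of B) w <= C * l2norm a].

Definition interpolation_property (R : realType) (I : countType)
    (B : I -> set (plane R)) (gamma : I -> R -> plane R) :=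
  exists C : R, 0 <= C /\ interpolation_with B gamma C.

Definition interpolation_constant (R : realType) (I : countType)
    (B : I -> set (plane R)) (gamma : I -> R -> plane R) : \bar R :=
  ereal_inf [set C%:E | C in
    [set C : R | 0 <= C /\ interpolation_with B gamma C]].

Definition hdisk (R : realType) (c : plane R) : set (plane R) :=
  [set z | disk R z /\ hdist z c < 1].

Definition local_multiplicity (R : realType) (I : countType)
    (B : I -> set (plane R)) : \bar R :=
  ereal_inf [set n%:R%:E | n in
    [set n : nat | forall c, disk R c -> (meets B (hdisk c) #<= `I_n)%card]].

Definition graph_connected (V : eqType) (e : rel V) :=
  forall x y, exists p : seq V, path e x p /\ last x p = y.

Definition graph_dist (R : realType) (V : eqType) (e : rel V) (x y : V) :
    \bar R :=
  ereal_inf [set (size p)%:R%:E | p in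
    [set p : seq V | path e x p /\ last x p = y]].

(* [Some i] is the hole [B i] and [None] is the complement of the disk. *)
Definition hole_graph (R : realType) (I : countType) (B : I -> set (plane R))
    (S : R) : rel (option I) :=
  fun x y => match x, y with
  | Some i, Some j => (i != j) &&
      (set_dist (B i) (B j) <= S * Num.min (diam (B i)) (diam (B j)))
  | Some i, None | None, Some i =>
      set_dist (B i) (~` disk R) <= S * diam (B i)
  | None, None => false
  end.

(* Main.v *)
Require Import Defs.
From HB Require Import structures.
From mathcomp Require Import all_boot all_order all_algebra.
From mathcomp Require Import all_classical all_reals all_analysis.
From mathcomp Require Import complex ring lra measurable_realfun.

Set Implicit Arguments.
Unset Strict Implicit.
Unset Printing Implicit Defensive.

Import Order.TTheory GRing.Theory Num.Theory.
Import numFieldNormedType.Exports.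
Local Open Scope classical_set_scope.
Local Open Scope ring_scope.

(* Suppose that in [G(Omega, S)] no path with at most [N] edges joins [B_j0] to
   the complement of the disk. Then the holes reachable from [B_j0] form a cluster
   of at most [N] holes in a small hyperbolic disk, far from the unit circle and
   from all the other holes relative to diameters. Logarithmic cutoffs around the
   holes that meet this disk, multiplied in order of decreasing diameter, give a
   function [u] of Dirichlet energy [O(N^2 / n)] equal to 1 near the cluster and to
   0 near the other holes; here [n] grows with [S].

   Mollifying the winding number of [gamma_j] gives a function [psi_j], locally
   constant near the complement of [Omega], with [\int w /\ d psi_j = - Per_j w]
   for all closed forms [w]. As [u + \sum_j psi_j] over the cluster has compact
   support in [Omega], [\int w /\ du] is the sum of the periods of [w] around the
   cluster. It is 1 for an interpolating form of the sequence concentrated at [j0],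
   whose norm is at most [C_I]; the Cauchy-Schwarz inequality then bounds [n]. *)

(** Dirichlet energy is scale invariant in the plane: a cutoff between two comparable radii costs a
    fixed amount, however small the hole. Only a ratio of radii exponential in [n] brings the energy
    down to [O(1 / n)], hence the power [2 ^+ n.+3] inside [S]. An edge compares a distance with the
    smaller of two diameters, so the cutoff around a large hole may cover small holes that should
    receive the other value. The order of treatment repairs this: a small hole comes after the large
    one and resets the value near itself, while its own cutoff, by separation, ends before it
    reaches a large hole of the other kind. A closed form is known only through test functions and a
    period only as a limit, so Stokes' theorem on a region bounded by [gamma_j] is not at hand. The
    potential [psi_j] takes its place: its gradient is the mollified tangent of [gamma_j] turned by
    a right angle, so that pairing with it is a mollified line integral and is continuous in [L^2].
    All auxiliary functions must be smooth in the sense of iterated directional derivatives; they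
    are drawn from classes closed under derivation. *)

Section Pointwise_derivatives.
Context {R : realType} {V : normedModType R}.
Implicit Types (f g : V -> R) (x v : V).

Lemma is_derive_add f g x v (df dg : R) :
  is_derive x v f df -> is_derive x v g dg ->
  is_derive x v (fun y => f y + g y) (df + dg).
Proof. exact: is_deriveD. Qed.

Lemma is_derive_mul f g x v (df dg : R) :
  is_derive x v f df -> is_derive x v g dg ->
  is_derive x v (fun y => f y * g y) (f x * dg + g x * df).
Proof. exact: is_deriveM. Qed.

Lemma is_derive_inv f x v (df : R) : f x != 0 ->
  is_derive x v f df -> is_derive x v (fun y => (f y)^-1) (- (f x) ^- 2 * df).
Proof.
move=> f0 Df; apply: DeriveDef; first exact: derivableV.
by rewrite deriveV // derive_val.
Qed.

End Pointwise_derivatives.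

(** * A smooth step function on the line and its derivative, a bump *)

Section Bump.
Context {R : realType}.
Implicit Types (f g : R -> R) (x : R).

Definition smooth1 f := forall n x, derivable (derive1n n f) x 1.

(** Smoothness is obtained for a whole class at once: iterated derivatives never leave a class
    stable under derivation, so no formula for them is required. *)
Lemma smooth1_ind (P : (R -> R) -> Prop) :
  (forall f, P f -> (forall x, derivable f x 1) /\ P (derive1 f)) ->
  forall f, P f -> smooth1 f.
Proof.
move=> PP f Pf n; suff [] : (forall x, derivable (derive1n n f) x 1) /\ P (derive1n n f) by [].
elim: n => [|n [_ IH]].
  by rewrite derive1n0; split=> //; exact: (PP f Pf).1.
rewrite derive1nS; have [_ H] := PP _ IH; split=> //.
exact: (PP _ H).1.
Qed.

Lemma smooth1_derivable f x : smooth1 f -> derivable f x 1.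
Proof. by move=> /(_ 0%N x); rewrite derive1n0. Qed.

Lemma smooth1_derive f : smooth1 f -> smooth1 (derive1 f).
Proof. by move=> sf n x; rewrite -derive1Sn; exact: sf. Qed.

Lemma smooth1_continuous f : smooth1 f -> continuous f.
Proof.
move=> sf x; apply: differentiable_continuous.
exact/derivable1_diffP/smooth1_derivable.
Qed.

Lemma is_derive_affine f (c d : R) x df :
  is_derive (c * x + d) 1 f df ->
  is_derive x 1 (fun y => f (c * y + d)) (c * df).
Proof.
move=> Hf; have Hg : is_derive x 1 (fun y : R => c * y + d) c.
  by apply: is_derive_eq; rewrite addr0 [_ *: _]mulr1.
have := @is_derive1_comp R f (fun y : R => c * y + d) x _ _ Hf Hg.
by rewrite mulrC.
Qed.

Lemma smooth1_affine f (k c d : R) : smooth1 f ->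
  smooth1 (fun x => k * f (c * x + d)).
Proof.
move=> sf; apply: (@smooth1_ind (fun g => exists f k c d,
  smooth1 f /\ g = fun x => k * f (c * x + d))); last by exists f, k, c, d.
move=> _ {f k c d sf}[f [k [c [d [sf ->]]]]].
have H x : is_derive x 1 (fun x => k * f (c * x + d))
    ((k * c) * (derive1 f) (c * x + d)).
  have Hf : is_derive (c * x + d) 1 f ((derive1 f) (c * x + d)).
    by rewrite derive1E; apply: DeriveDef => //; exact: smooth1_derivable.
  have := @is_deriveZ _ _ _ _ k _ _ _ (is_derive_affine Hf).
  by rewrite -mulrA.
split=> [x|]; first exact: ex_derive.
exists (derive1 f), (k * c), c, d; split; first exact: smooth1_derive.
by apply/funext => x; rewrite derive1E derive_val.
Qed.

(* The functions [flat n] span a space closed under derivation. *)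
Definition flat (n : nat) x : R := if 0 < x then x^-1 ^+ n * expR (- x^-1) else 0.

(** Comes from [expR y >= (y / n.+1) ^+ n.+1] at [y = x^-1]. The exponent [n.+1] leaves one spare
    factor [x], which forces the limit 0 at the origin. *)
Lemma flat_le n x : 0 < x -> flat n x <= n.+1%:R ^+ n.+1 * x.
Proof.
move=> x0; rewrite /flat x0.
have m0 : (0 : R) < n.+1%:R by rewrite ltr0n.
have H : (x^-1 / n.+1%:R) ^+ n.+1 <= expR x^-1.
  have -> : expR x^-1 = expR (x^-1 / n.+1%:R) ^+ n.+1.
    by rewrite -expRM_natl -mulr_natl mulrC divfK // gt_eqF.
  have y0 : 0 <= x^-1 / n.+1%:R by rewrite divr_ge0 // ?invr_ge0 ltW.
  apply: lerXn2r; rewrite ?nnegrE ?expR_ge0//.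
  by apply: le_trans (expR_ge1Dx _); rewrite lerDr.
rewrite expRN ler_pdivrMr ?expR_gt0//.
have -> : x^-1 ^+ n = n.+1%:R ^+ n.+1 * x * (x^-1 / n.+1%:R) ^+ n.+1.
  rewrite expr_div_n [_ * (_ / _)]mulrC mulrA divfK; last first.
    by rewrite expf_neq0 // gt_eqF.
  by rewrite exprSr -mulrA mulVf ?mulr1// gt_eqF.
by rewrite ler_wpM2l// mulr_ge0// ?exprn_ge0// ltW.
Qed.

Lemma flat_ge0 n x : 0 <= flat n x.
Proof.
rewrite /flat; case: ifP => // x0.
by rewrite mulr_ge0 ?expR_ge0 // exprn_ge0 // invr_ge0 ltW.
Qed.

Lemma flat_cvg0 n : flat n x @[x --> (0 : R)] --> (0 : R).
Proof.
apply/cvgr0Pnorm_le => e e0.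
have K0 : (0 : R) < n.+1%:R ^+ n.+1 by rewrite exprn_gt0.
near=> x; rewrite ger0_norm ?flat_ge0//.
have [x0|x0] := ltP 0 x; last by rewrite /flat ltNge x0 ltW.
apply: (le_trans (flat_le n x0)); rewrite mulrC -ler_pdivlMr//.

near: x; apply: nbhs0_ltW; exact: divr_gt0.
Unshelve. all: by end_near. Qed.

Lemma is_derive_flat n x :
  is_derive x 1 (flat n) (flat n.+2 x - n%:R * flat n.+1 x).
Proof.
have [x0|x0|<-] := ltgtP 0 x.
- have E : \near x, x^-1 ^+ n * expR (- x^-1) = flat n x.
    near=> y; rewrite /flat ifT//; near: y; exact: lt_nbhsr.
  apply: near_eq_is_derive E _.
  have xn0 : x != 0 by rewrite gt_eqF.
  have Hi : is_derive x 1 (fun y : R => y^-1) (- x ^- 2).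
    apply: DeriveDef; first exact: derivableV.
    by rewrite (@deriveV _ _ (@id R)) // derive_id [_ *: _]mulr1.
  have He : is_derive x 1 (fun y : R => expR (- y^-1)) (expR (- x^-1) * x ^- 2).
    have Hn : is_derive x 1 (fun y : R => - y^-1) (x ^- 2).
      by rewrite -[x ^- 2]opprK; exact: is_deriveN.
    exact: (@is_derive1_comp R expR (fun y : R => - y^-1) x _ _ _ Hn).
  have Hp : is_derive x 1 (fun y : R => y^-1 ^+ n) (- (n%:R * x^-1 ^+ n.+1)).
    elim: (n) => [|m IH].
      rewrite mul0r oppr0.
      by have := @is_derive_cst _ _ _ (1 : R) x 1.
    rewrite (_ : (fun y => _) = (fun y : R => y^-1 * y^-1 ^+ m)); last first.
      by apply/funext => y; rewrite exprS.
    apply: (is_derive_eq (is_derive_mul Hi IH)).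
    rewrite -exprVn -(natr1 m) !exprS; ring.
  apply: (is_derive_eq (is_derive_mul Hp He)).
  rewrite /flat x0 /=.
  rewrite -exprVn !exprS; ring.
- have E : \near x, cst 0 x = flat n x.
    near=> y; rewrite /flat ifF//; apply/negbTE; rewrite -leNgt ltW//.
    near: y; exact: lt_nbhsl.
  apply: near_eq_is_derive E _.
  rewrite /flat !ifF ?mulr0 ?subr0; last 2 first.
    by apply/negbTE; rewrite -leNgt ltW.
    by apply/negbTE; rewrite -leNgt ltW.
  exact: is_derive_cst.
- rewrite /flat ltxx mulr0 subr0.
  (* The difference quotient of [flat n] at 0 is [flat n.+1], also on the negative side, where both
     vanish. *)
  have H : (fun h : R => h^-1 *: ((flat n \o shift 0) (h *: (1 : R)) - flat n 0))
      @ 0^' --> (0 : R).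
    have : flat n.+1 x @[x --> 0^'] --> (0 : R).
      by apply: cvg_trans (flat_cvg0 n.+1); apply: cvg_app; exact: nbhs_dnbhs.
    apply: cvg_trans; apply: near_eq_cvg; near=> h => /=.
    rewrite /flat ltxx subr0 addr0 [h *: 1]mulr1; case: ifP => h0; last first.
      by rewrite scaler0.
    by rewrite exprS [_ *: _]mulrA.
  apply: DeriveDef; first by apply/cvg_ex; exists 0.
  exact: cvg_lim H.
Unshelve. all: by end_near. Qed.

Inductive flat_alg : (R -> R) -> Prop :=
| flat_algF n c d : flat_alg (fun x => flat n (c * x + d))
| flat_algC c : flat_alg (fun=> c)
| flat_algD f g : flat_alg f -> flat_alg g -> flat_alg (fun x => f x + g x)
| flat_algM f g : flat_alg f -> flat_alg g -> flat_alg (fun x => f x * g x)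
| flat_algV f : flat_alg f -> (forall x, f x != 0) -> flat_alg (fun x => (f x)^-1).

Lemma flat_alg_derive f : flat_alg f ->
  exists2 df, flat_alg df & forall x, is_derive x 1 f (df x).
Proof.
elim=> {f}[n c d|c|f g _ [df sf Df] _ [dg sg Dg]|f g sf [df sdf Df] sg [dg sdg Dg]
  |f sf [df sdf Df] f0].
- exists (fun x => c * (flat n.+2 (c * x + d) + (- n%:R) * flat n.+1 (c * x + d))).
    by do !constructor.
  by move=> x; rewrite mulNr; apply: is_derive_affine; exact: is_derive_flat.
- by exists (fun=> 0); [constructor|move=> x; exact: is_derive_cst].
- by exists (fun x => df x + dg x); [constructor|move=> x; exact: is_derive_add].
- exists (fun x => f x * dg x + g x * df x); first by do !constructor.
  by move=> x; exact: is_derive_mul.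
- exists (fun x => (-1) * (f x)^-1 * (f x)^-1 * df x); first by do !constructor.
  move=> x; apply: (is_derive_eq (is_derive_inv (f0 x) (Df x))).
  by rewrite -exprVn; ring.
Qed.

Lemma flat_alg_smooth1 f : flat_alg f -> smooth1 f.
Proof.
move=> sf; apply: (@smooth1_ind flat_alg) sf => {}f /flat_alg_derive[df sdf Df].
split=> [x|]; first exact: ex_derive.
rewrite (_ : (derive1 f) = df)//; apply/funext => x.
by rewrite derive1E derive_val.
Qed.

(** [A] is the quotient [p / (p + q)], where [p] vanishes to the left of -1, [q] to the right of 1,
    and one of the two is positive at each point. *)
Lemma exists_smooth_step : exists A a : R -> R,
  [/\ smooth1 A, smooth1 a, forall x, is_derive x 1 A (a x) &
      [/\ forall x, 0 <= a x, forall x, 1 <= `|x| -> a x = 0,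
        forall x, x <= -1 -> A x = 0 & forall x, 1 <= x -> A x = 1]].
Proof.
pose p x := flat 0 (1 * x + 1); pose q x := flat 0 (- 1 * x + 1).
have dp x : is_derive x 1 p (flat 2 (1 * x + 1)).
  have := @is_derive_affine (flat 0) 1 1 x _ (is_derive_flat _ _).
  by rewrite mul0r subr0 mul1r.
have dq x : is_derive x 1 q (- flat 2 (-1 * x + 1)).
  apply: (is_derive_eq (is_derive_affine (is_derive_flat 0 (-1 * x + 1)))).
  by rewrite mul0r; ring.
have pq0 x : 0 < p x + q x.
  have [x0|x0] := ltP (-1) x.
    apply: ltr_pwDl; last exact: flat_ge0.
    by rewrite /p /flat mul1r -ltrBlDr sub0r x0 expr0 mul1r expR_gt0.
  apply: ltr_wpDl; first exact: flat_ge0.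
  rewrite /q /flat mulN1r ifT ?expr0 ?mul1r ?expR_gt0//; lra.
pose A x := p x * (p x + q x)^-1.
pose a x := (p x + q x) ^- 2 * (flat 2 (1 * x + 1) * q x + p x * flat 2 (-1 * x + 1)).
have dA x : is_derive x 1 A (a x).
  have Hv : is_derive x 1 (fun y => (p y + q y)^-1) (- (p x + q x) ^- 2 *
      (flat 2 (1 * x + 1) - flat 2 (-1 * x + 1))).
    have pqx : p x + q x != 0 by rewrite gt_eqF.
    exact: (is_derive_inv (f := fun y => p y + q y) pqx (is_derive_add _ _)).
  apply: (is_derive_eq (is_derive_mul (dp x) Hv)); rewrite /a.
  have : p x + q x != 0 by rewrite gt_eqF.
  by move=> ?; field.
have sA : flat_alg A by do !constructor => //; move=> x; rewrite gt_eqF.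
exists A, a; split=> //.
- exact: flat_alg_smooth1.
- rewrite (_ : a = (derive1 A)); first exact/smooth1_derive/flat_alg_smooth1.
  by apply/funext => x; rewrite derive1E derive_val.
have flat0 n x : x <= 0 -> flat n x = 0 by rewrite /flat ltNge => ->.
split=> [x|x|x xN1|x x1].
- rewrite mulr_ge0 ?invr_ge0 ?exprn_ge0 ?(ltW (pq0 x))//.
  by rewrite addr_ge0// mulr_ge0// flat_ge0.
- rewrite ler_normr => /orP[] x1; rewrite /a /p /q.
    by rewrite !(@flat0 _ (-1 * x + 1)) ?mulr0 ?addr0 ?mulr0//; lra.
  by rewrite !(@flat0 _ (1 * x + 1)) ?mul0r ?addr0 ?mulr0//; lra.
- by rewrite /A /p flat0 ?mul0r//; lra.
- have q0 : q x = 0 by rewrite /q flat0//; lra.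
  by have := pq0 x; rewrite /A q0 addr0 => /gt_eqF /negbT; exact: divff.
Qed.

End Bump.

(** * Integrals over the unit segment and uniformity in a parameter *)

Section Unit_interval_integral.
Context {R : realType}.

Definition int01 (f : R -> R) : R := Rintegral (@lebesgue_measure R) `[0, 1] f.

Lemma int01_integrable (f : R -> R) : continuous f ->
  (@lebesgue_measure R).-integrable `[0, 1] (EFin \o f).
Proof.
move=> cf; apply: continuous_compact_integrable; first exact: segment_compact.
exact: continuous_subspaceT.
Qed.

Lemma int01_bound (f : R -> R) e : continuous f ->
  (forall t, 0 <= t <= 1 -> `|f t| <= e) -> `|int01 f| <= e.
Proof.
move=> cf fe; apply: le_trans (le_normr_Rintegral _ _) _ => //.
  exact: int01_integrable.
have -> : e = int01 (cst e).
  rewrite /int01 Rintegral_cst //= lebesgue_measure_itv /= lte_fin ltr01.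
  by rewrite -EFinB subr0 mulr1.
apply: le_Rintegral => //.
- apply: (int01_integrable (f := fun t => `|f t|)) => t.
  by apply: continuous_comp; [exact: cf|exact: norm_continuous].
- by apply: (int01_integrable (f := cst e)) => t; exact: cst_continuous.
Qed.

Lemma int01B (f g : R -> R) : continuous f -> continuous g ->
  int01 (fun t => f t - g t) = int01 f - int01 g.
Proof. by move=> cf cg; apply: RintegralB => //; exact: int01_integrable. Qed.

Lemma int01Zl (f : R -> R) k : continuous f ->
  int01 (fun t => k * f t) = k * int01 f.
Proof. by move=> cf; apply: RintegralZl => //; exact: int01_integrable. Qed.

Lemma int01_FTC (F f : R -> R) : continuous f ->
  (forall t : R, is_derive t 1 F (f t)) -> int01 f = F 1 - F 0.
Proof.
move=> cf Ff; have cF : continuous F.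
  move=> t; apply: differentiable_continuous.
  by apply/derivable1_diffP; exact: ex_derive.
rewrite /int01 /Rintegral (@continuous_FTC2 _ f F) //.
- exact: continuous_subspaceT.
- split=> [t _||]; first exact: ex_derive.
  + by apply: cvg_at_right_filter; exact: cF.
  + by apply: cvg_at_left_filter; exact: cF.
- by move=> t _; rewrite derive1E derive_val.
Qed.

Lemma tube_near (T : topologicalType) (P : T -> R -> Prop) (x0 : T) :
  (forall t : R, 0 <= t <= 1 -> \forall p \near (x0, t), P p.1 p.2) ->
  \forall x \near x0, forall t : R, 0 <= t <= 1 -> P x t.
Proof.
move=> nP; have /compact_near_coveringP := @segment_compact R 0 1.
move=> /(_ T (nbhs x0) P _) H.
have := H _ => {}H; apply: filterS (H _) => [x Hx t t01|t].
  by apply: Hx; rewrite /= in_itv.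
rewrite /= in_itv /= => t01; have [[X Y] /= [Xx Yt] XY] := nP t t01.
by exists (Y, X) => //= -[s x] /= [Ys Xs]; exact: (XY (x, s)).
Qed.

(* Continuity in the parameter is uniform over the compact segment. *)
Lemma tube (T : topologicalType) (F : T -> R -> R) (x0 : T) (e : R) :
  (forall t : R, 0 <= t <= 1 -> F p.1 p.2 @[p --> (x0, t)] --> F x0 t) -> 0 < e ->
  \forall x \near x0, forall t, 0 <= t <= 1 -> `|F x t - F x0 t| < e.
Proof.
move=> cF e0; apply: (tube_near (P := fun x t => `|F x t - F x0 t| < e)) => t t01.
have e20 : 0 < e / 2 by rewrite divr_gt0.
have [[X Y] /= [Xx Yt] XY] : nbhs (x0, t) [set p | `|F p.1 p.2 - F x0 t| < e / 2].
  by have /cvgrPdistC_lt/(_ _ e20) := cF t t01.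
exists (X, Y) => //= -[x s] /= [Xs Ys].
have h1 : `|F x s - F x0 t| < e / 2 by exact: (XY (x, s)).
have h2 : `|F x0 s - F x0 t| < e / 2.
  by apply: (XY (x0, s)); split => //=; exact: nbhs_singleton.
rewrite (_ : F x s - F x0 s = (F x s - F x0 t) - (F x0 s - F x0 t)); last ring.
by apply: le_lt_trans (ler_normB _ _) _; rewrite [ltRHS](splitr e) ltrD.
Qed.

(** The intermediate point is written [s * h] with [s] in the unit segment, so that one statement
    serves both signs of [h] and [h = 0]. *)
Lemma MVT0 (f df : R -> R) (h : R) : (forall x : R, is_derive x 1 f (df x)) ->
  exists2 s, 0 <= s <= 1 & f h - f 0 = df (s * h) * h.
Proof.
move=> Df; have cf : continuous f.
  move=> t; apply: differentiable_continuous.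
  by apply/derivable1_diffP; exact: ex_derive.
have [h0|h0|<-] := ltgtP 0 h; last first.
- by exists 0; rewrite ?lexx ?ler01 // subrr mulr0.
- have [c] := @MVT_segment R f df h 0 (ltW h0) (fun x _ => Df x) (continuous_subspaceT cf).
  rewrite in_itv /= => /andP[c0 ch] E; exists (c / h).
    by rewrite ler_ndivlMr // ler_ndivrMr // mul0r mul1r c0 ch.
  by rewrite divfK ?lt_eqF // -opprB E sub0r mulrN opprK.
- have [c] := @MVT_segment R f df 0 h (ltW h0) (fun x _ => Df x) (continuous_subspaceT cf).
  rewrite in_itv /= => /andP[c0 ch] E; exists (c / h).
    by rewrite ler_pdivlMr // ler_pdivrMr // mul0r mul1r c0 ch.
  by rewrite divfK ?gt_eqF // E subr0.
Qed.

End Unit_interval_integral.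

(** * Smooth functions on the plane *)

Section Directional_derivatives.
Context {R : realType} {V : normedModType R}.
Implicit Types (f : V -> R) (z v : V).

Lemma is_derive_line f z v df :
  is_derive z v f df <-> is_derive (0 : R) 1 (fun h : R => f (h *: v + z)) df.
Proof.
have E : (fun h : R => h^-1 *: ((f \o shift z) (h *: v) - f z)) =
    (fun h : R => h^-1 *: (((fun h : R => f (h *: v + z)) \o shift 0) (h *: (1 : R))
      - f (0 *: v + z))).
  by apply/funext => h /=; rewrite addr0 scale0r add0r [_%:A]mulr1.
by split=> -[Hd <-]; apply: DeriveDef; move: Hd; rewrite /derivable /derive E.
Qed.

Lemma is_derive_compR (h : R -> R) f z v dh df :
  is_derive (f z) 1 h dh -> is_derive z v f df ->
  is_derive z v (fun y => h (f y)) (dh * df).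
Proof.
move=> Dh /is_derive_line Df; apply/is_derive_line.
apply: (@is_derive1_comp R h (fun k : R => f (k *: v + z))) => //.
by rewrite scale0r add0r.
Qed.

End Directional_derivatives.

Lemma is_derive_along {R : realType} {V : normedModType R} (f : V -> R) (z v : V) (df : V -> R) (h : R) :
  (forall z, is_derive z v f (df z)) ->
  is_derive h 1 (fun h : R => f (h *: v + z)) (df (h *: v + z)).
Proof.
move=> Df; have /is_derive_line H := Df (h *: v + z).
apply/is_derive_line; rewrite (_ : (fun _ => _) =
  (fun h0 : R => f (h0 *: v + (h *: v + z)))) //.
by apply/funext => k; rewrite [k *: 1]mulr1 scalerDl addrA.
Qed.

Lemma fst_derive {R : realType} (z v : plane R) : is_derive z v fst v.1.
Proof.
apply/is_derive_line.
rewrite (_ : (fun _ => _) = (fun h : R => v.1 * h + z.1)); last first.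
  by apply/funext => h /=; rewrite mulrC.
by apply: is_derive_eq; rewrite addr0 [_ *: _]mulr1.
Qed.

Lemma snd_derive {R : realType} (z v : plane R) : is_derive z v snd v.2.
Proof.
apply/is_derive_line.
rewrite (_ : (fun _ => _) = (fun h : R => v.2 * h + z.2)); last first.
  by apply/funext => h /=; rewrite mulrC.
by apply: is_derive_eq; rewrite addr0 [_ *: _]mulr1.
Qed.

Section Smooth_algebra.
Context {R : realType}.
Implicit Types (f g K : plane R -> R) (z v : plane R).

(* The class is closed under directional derivatives, hence its members are smooth. *)
Inductive smooth_alg : (plane R -> R) -> Prop :=
| smooth_algC c : smooth_alg (fun=> c)
| smooth_alg1 : smooth_alg fst
| smooth_alg2 : smooth_alg snd
| smooth_algD f g : smooth_alg f -> smooth_alg g -> smooth_alg (fun z => f z + g z)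
| smooth_algM f g : smooth_alg f -> smooth_alg g -> smooth_alg (fun z => f z * g z)
| smooth_alg_comp h f : smooth1 h -> smooth_alg f -> smooth_alg (fun z => h (f z))
| smooth_alg_int K (c : R -> plane R) (k : R -> R) :
    continuous c -> continuous k -> smooth_alg K ->
    smooth_alg (fun z => int01 (fun t => K (z - c t) * k t)).

Lemma param_continuous K (c : R -> plane R) (k : R -> R) z t :
  continuous K -> continuous c -> continuous k ->
  K (p.1 - c p.2) * k p.2 @[p --> (z, t)] --> K (z - c t) * k t.
Proof.
move=> cK cc ck; apply: cvgM; last first.
  by apply: (@cvg_comp _ _ _ snd k _ (nbhs t)); [exact: cvg_snd|exact: ck].
apply: (@cvg_comp _ _ _ (fun p : plane R * R => p.1 - c p.2) K _ (nbhs (z - c t))).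
  apply: cvgB; first exact: cvg_fst.
  by apply: (@cvg_comp _ _ _ snd c _ (nbhs t)); [exact: cvg_snd|exact: cc].
exact: cK.
Qed.

Lemma param_continuous1 K (c : R -> plane R) (k : R -> R) z :
  continuous K -> continuous c -> continuous k ->
  continuous (fun t => K (z - c t) * k t).
Proof.
move=> cK cc ck t.
apply: (@cvg_comp _ _ _ (fun t => (z, t))
  (fun p : plane R * R => K (p.1 - c p.2) * k p.2) _ (nbhs (z, t))).
  apply: (@cvg_pair _ _ _ (nbhs t) (nbhs z) (nbhs t)).
  - exact: cvg_cst.
  - exact: cvg_id.
exact: (param_continuous cK cc ck).
Qed.

Lemma int01_param_continuous K (c : R -> plane R) (k : R -> R) :
  continuous K -> continuous c -> continuous k ->
  continuous (fun z => int01 (fun t => K (z - c t) * k t)).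
Proof.
move=> cK cc ck z; apply/cvgrPdistC_le => e e0; near=> y.
rewrite -int01B; try exact: param_continuous1.
apply: int01_bound.
  by move=> t; apply: cvgB; exact: param_continuous1.
near: y; apply: filterS (tube (F := fun z t => K (z - c t) * k t) _ e0).
  by move=> y H t /H /ltW.
by move=> t _; exact: (param_continuous cK cc ck).
Unshelve. all: by end_near. Qed.

(** By the mean value theorem the difference quotients are values of [dK] at intermediate points.
    They converge uniformly over the segment by [tube], so the limit passes under the integral. *)
Lemma int01_param_derive K (dK : plane R -> R) v (c : R -> plane R) (k : R -> R) z :
  continuous K -> continuous dK -> continuous c -> continuous k ->
  (forall z, is_derive z v K (dK z)) ->
  is_derive z v (fun z => int01 (fun t => K (z - c t) * k t))
    (int01 (fun t => dK (z - c t) * k t)).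
Proof.
move=> cK cdK cc ck DK.
set F := fun z => int01 _.
have H : (fun h : R => h^-1 *: ((F \o shift z) (h *: v) - F z)) @ 0^' -->
    int01 (fun t => dK (z - c t) * k t).
  apply/cvgrPdistC_le => e e0.
  have [r /= r0 Hr] : nbhs (0 : R) [set s : R | forall t, 0 <= t <= 1 ->
      `|dK (s *: v + z - c t) * k t - dK (z - c t) * k t| < e].
    have := tube (F := fun z t => dK (z - c t) * k t)
      (fun t _ => param_continuous (z := z) (t := t) cdK cc ck) e0.
    have cs : s *: v + z @[s --> (0 : R)] --> z.
      rewrite -[X in _ --> X]add0r -(scale0r v).
      by apply: cvgD; [exact: scalel_continuous|exact: cvg_cst].
    by move=> /cs.
  near=> h.
  have h0 : h != 0 by near: h; exact: nbhs_dnbhs_neq.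
  have hr : `|h| < r by near: h; exact: dnbhs0_lt.
  rewrite /= /F -int01B; try exact: param_continuous1.
  have cB : continuous (fun t => K (h *: v + z - c t) * k t - K (z - c t) * k t).
    by move=> t; apply: cvgB; exact: param_continuous1.
  rewrite (_ : h^-1 *: _ = int01 (fun t => h^-1 * (K (h *: v + z - c t) * k t -
    K (z - c t) * k t))); last by rewrite int01Zl.
  have c1 : continuous (fun t => dK (z - c t) * k t).
    exact: (param_continuous1 cdK cc ck).
  have c2 : continuous (fun t => h^-1 * (K (h *: v + z - c t) * k t -
    K (z - c t) * k t)) by move=> t; apply: cvgM; [exact: cvg_cst|exact: cB].
  rewrite -(int01B c2 c1).
  - apply: int01_bound => [t|t t01].
      by apply: cvgB; [exact: c2|exact: c1].
    have [s s01] := MVT0 h (fun x => is_derive_along (z - c t) x DK).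
    rewrite scale0r add0r -addrA => E.
    have sr : ball (0 : R) r (s * h).
      rewrite -ball_normE /= sub0r normrN (le_lt_trans _ hr)// normrM.
      by rewrite ler_piMl // ger0_norm; case/andP: s01.
    have := Hr _ sr t t01; rewrite /= -[_ + z - _]addrA => /ltW; congr (`|_ - _| <= _).
    by rewrite -mulrBl E; field.
apply: DeriveDef; first by apply/cvg_ex; exists (int01 (fun t => dK (z - c t) * k t)).
exact: cvg_lim H.
Unshelve. all: by end_near. Qed.

Lemma smooth_alg_continuous f : smooth_alg f -> continuous f.
Proof.
elim=> {f}[c||| f g _ cf _ cg|f g _ cf _ cg|h f sh _ cf|K c k cc ck _ cK] z.
- exact: cvg_cst.
- exact: cvg_fst.
- exact: cvg_snd.
- by apply: cvgD; [exact: cf|exact: cg].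
- by apply: cvgM; [exact: cf|exact: cg].
- by apply: continuous_comp; [exact: cf|exact: smooth1_continuous].
- exact: int01_param_continuous.
Qed.

Lemma smooth_alg_derive f v : smooth_alg f ->
  exists2 df, smooth_alg df & forall z, is_derive z v f (df z).
Proof.
elim=> {f}[c|||f g _ [df sf Df] _ [dg sg Dg]|f g sf [df sdf Df] sg [dg sdg Dg]
  |h f sh sf [df sdf Df]|K c k cc ck sK [dK sdK DK]].
- by exists (fun=> 0); [constructor|move=> z; exact: is_derive_cst].
- by exists (fun=> v.1); [constructor|move=> z; exact: fst_derive].
- by exists (fun=> v.2); [constructor|move=> z; exact: snd_derive].
- by exists (fun z => df z + dg z); [constructor|move=> z; exact: is_derive_add].
- exists (fun z => f z * dg z + g z * df z); first by do !constructor.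
  by move=> z; exact: is_derive_mul.
- exists (fun z => (derive1 h) (f z) * df z).
    apply: smooth_algM => //; apply: (smooth_alg_comp (h := derive1 h)) => //.
    exact: smooth1_derive.
  move=> z; apply: is_derive_compR => //.
  by rewrite derive1E; apply: DeriveDef => //; exact: smooth1_derivable.
- exists (fun z => int01 (fun t => dK (z - c t) * k t)); first by constructor.
  by move=> z; apply: int01_param_derive => //; exact: smooth_alg_continuous.
Qed.

Lemma smooth_algE f v : smooth_alg f ->
  smooth_alg ('D_v f) /\ forall z, is_derive z v f ('D_v f z).
Proof.
move=> /(smooth_alg_derive v)[df sdf Df].
have -> : 'D_v f = df by apply/funext => z; rewrite derive_val.
by [].
Qed.

Lemma smooth_alg_smooth_on f U : smooth_alg f -> smooth_on U f.
Proof.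
move=> sf vs z _ /=; suff sg : smooth_alg (foldr (fun v (h : plane R -> R) => 'D_v h) f vs).
  split; first exact: smooth_alg_continuous.
  by move=> v; have [_ Dg] := smooth_algE v sg; exact: ex_derive.
by elim: vs => //= v vs IH; exact: (smooth_algE v IH).1.
Qed.

End Smooth_algebra.

Lemma hshift {R : realType} (h : R) (z : plane R) :
  h *: ((1, 0) : plane R) + z = (h + z.1, z.2).
Proof.
by apply/pair_equal_spec; split; rewrite /= ?scaler0 ?add0r // [_ *: _]mulr1.
Qed.

Lemma vshift {R : realType} (h : R) (z : plane R) :
  h *: ((0, 1) : plane R) + z = (z.1, h + z.2).
Proof.
by apply/pair_equal_spec; split; rewrite /= ?scaler0 ?add0r // [_ *: _]mulr1.
Qed.

(** * Smoothed winding numbers *)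

Section Winding.
Context {R : realType}.

Lemma atan_inv (x : R) : 0 < x -> atan x^-1 = pi / 2 - atan x.
Proof.
move=> x0; have a0 : 0 < atan x by rewrite -atan0 lt_atan.
have a1 := atan_ltpi2 x; have p0 := pi_gt0 R.
suff E : x^-1 = tan (pi / 2 - atan x).
  by rewrite E tanK // in_itv /=; apply/andP; split; lra.
rewrite /tan sinB cosB cos_pihalf sin_pihalf !mul0r !mul1r subr0 add0r.
by rewrite -[in LHS](atanK x) /tan invf_div.
Qed.

Lemma is_derive_div (x y : R -> R) (dx dy t : R) : x t != 0 ->
  is_derive t 1 x dx -> is_derive t 1 y dy ->
  is_derive t 1 (fun s => y s / x s) ((x t * dy - y t * dx) / x t ^+ 2).
Proof.
move=> x0 Dx Dy; apply: (is_derive_eq (is_derive_mul Dy (is_derive_inv x0 Dx))).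
by field.
Qed.

Lemma is_derive_angle (x y : R -> R) (dx dy t : R) : x t != 0 ->
  is_derive t 1 x dx -> is_derive t 1 y dy ->
  is_derive t 1 (fun s => atan (y s / x s))
    ((x t * dy - y t * dx) / (x t ^+ 2 + y t ^+ 2)).
Proof.
move=> x0 Dx Dy.
apply: (is_derive_eq (is_derive_compR (is_derive1_atan _) (is_derive_div x0 Dx Dy))).
have : x t ^+ 2 + y t ^+ 2 != 0.
  by rewrite gt_eqF // ltr_pwDl ?sqr_ge0 // exprn_even_gt0.
by move=> H; field; rewrite H x0.
Qed.

Record step_pair (A a : R -> R) : Prop := StepPair {
  step_smooth : smooth1 A;
  bump_smooth : smooth1 a;
  step_derive : forall x : R, is_derive x 1 A (a x);
  bump_ge0 : forall x, 0 <= a x;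
  bump_out : forall x, 1 <= `|x| -> a x = 0;
  step_left : forall x, x <= -1 -> A x = 0;
  step_right : forall x, 1 <= x -> A x = 1 }.

Record C1_loop (c dc : R -> plane R) : Prop := C1Loop {
  loop_continuous : continuous c;
  loop_dcontinuous : continuous dc;
  loop_derive1 : forall t : R, is_derive t 1 (fun s => (c s).1) (dc t).1;
  loop_derive2 : forall t : R, is_derive t 1 (fun s => (c s).2) (dc t).2;
  loop_periodic : forall t, c (t + 1) = c t }.

Lemma loop_closed (c dc : R -> plane R) : C1_loop c dc -> c 1 = c 0.
Proof. by move=> cdc; rewrite -[in LHS](add0r 1) (loop_periodic cdc). Qed.

Variables (A a : R -> R) (Aa : step_pair A a).
Variables (c dc : R -> plane R) (cdc : C1_loop c dc).

Section Scale.
Variables (e : R) (e0 : 0 < e).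

Let Ae x := A (e^-1 * x).
Let ae x := e^-1 * a (e^-1 * x).

Let Ae_smooth : smooth1 Ae.
Proof.
have := smooth1_affine (k := 1) (c := e^-1) (d := 0) (step_smooth Aa).
by rewrite (_ : (fun _ => _) = Ae)//; apply/funext => x; rewrite mul1r addr0.
Qed.

Let ae_smooth : smooth1 ae.
Proof.
have := smooth1_affine (k := e^-1) (c := e^-1) (d := 0) (bump_smooth Aa).
by rewrite (_ : (fun _ => _) = ae)//; apply/funext => x; rewrite addr0.
Qed.

Let Ae_derive (x : R) : is_derive x 1 Ae (ae x).
Proof.
have := @is_derive_affine _ A e^-1 0 x _ (step_derive Aa _).
rewrite addr0 (_ : (fun _ => _) = Ae)//.
by apply/funext => y; rewrite addr0.
Qed.

Let Ae_left x : x <= - e -> Ae x = 0.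
Proof. by move=> xe; apply: (step_left Aa); rewrite mulrC ler_pdivrMr // mulN1r. Qed.

Let Ae_right x : e <= x -> Ae x = 1.
Proof. by move=> xe; apply: (step_right Aa); rewrite mulrC ler_pdivlMr // mul1r. Qed.

Let ae_out x : e <= `|x| -> ae x = 0.
Proof.
move=> xe; rewrite /ae (bump_out Aa) ?mulr0 // normrM gtr0_norm ?invr_gt0 //.
by rewrite mulrC ler_pdivlMr // mul1r.
Qed.

Definition mollifier (z : plane R) : R := (e^-1 * a (e^-1 * z.1)) * (e^-1 * a (e^-1 * z.2)).

(* Minus the winding number of [c], smoothed at scale [e]. *)
Definition soft_winding (z : plane R) : R :=
  int01 (fun t => A (e^-1 * (z - c t).1) * (e^-1 * a (e^-1 * (z - c t).2)) * (dc t).2).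

Let K (z : plane R) := Ae z.1 * ae z.2.

Let K_alg : smooth_alg K.
Proof.
by apply: smooth_algM; apply: smooth_alg_comp => //; constructor.
Qed.

Lemma dc2_continuous : continuous (fun t => (dc t).2).
Proof.
move=> t; apply: (@continuous_comp _ _ _ dc snd); last exact: cvg_snd.
exact: (loop_dcontinuous cdc).
Qed.

Lemma dc1_continuous : continuous (fun t => (dc t).1).
Proof.
move=> t; apply: (@continuous_comp _ _ _ dc fst); last exact: cvg_fst.
exact: (loop_dcontinuous cdc).
Qed.

Lemma soft_winding_alg : smooth_alg soft_winding.
Proof.
apply: (smooth_alg_int (K := K)) => //; first exact: (loop_continuous cdc).
exact: dc2_continuous.
Qed.

Lemma mollifier_alg : smooth_alg mollifier.
Proof.
apply: (smooth_algM (f := fun z => ae z.1) (g := fun z => ae z.2)).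
  by apply: (smooth_alg_comp (f := fst)) => //; constructor.
by apply: (smooth_alg_comp (f := snd)) => //; constructor.
Qed.

Lemma soft_winding_d1 (z : plane R) : is_derive z ((1, 0) : plane R) soft_winding
  (int01 (fun t => mollifier (z - c t) * (dc t).2)).
Proof.
apply: (@int01_param_derive _ K mollifier).
- exact: smooth_alg_continuous K_alg.
- exact: smooth_alg_continuous mollifier_alg.
- exact: (loop_continuous cdc).
- exact: dc2_continuous.
move=> y; have D1 := is_derive_compR (Ae_derive y.1) (fst_derive y (1, 0)).
have D2 := is_derive_compR (derivableP (smooth1_derivable (x := y.2) ae_smooth))
  (snd_derive y (1, 0)).
apply: (is_derive_eq (is_derive_mul D1 D2)).
by rewrite mulr0 mulr0 add0r mulr1 mulrC.
Qed.

(** Differentiation under the integral yields the derivative of the bump against the second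
    component of [dc]. Integration by parts along the closed loop ([F] below returns to its initial
    value) trades it for the mollifier against the first component. Together with [soft_winding_d1]
    the gradient is then the mollified tangent of [c] turned by a right angle, so it lives near the
    loop. *)
Lemma soft_winding_d2 (z : plane R) : is_derive z ((0, 1) : plane R) soft_winding
  (- int01 (fun t => mollifier (z - c t) * (dc t).1)).
Proof.
pose dae : R -> R := derive1 ae.
have dae_smooth : smooth1 dae by exact: smooth1_derive.
have ae_derive (x : R) : is_derive x 1 ae (dae x).
  by rewrite /dae derive1E; apply: derivableP; exact: smooth1_derivable.
have dK_alg : smooth_alg (fun z : plane R => Ae z.1 * dae z.2).
  by apply: smooth_algM; apply: smooth_alg_comp => //; constructor.
have D : is_derive z ((0, 1) : plane R) soft_winding
    (int01 (fun t => Ae (z - c t).1 * dae (z - c t).2 * (dc t).2)).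
  apply: (@int01_param_derive _ K (fun z => Ae z.1 * dae z.2)).
  - exact: smooth_alg_continuous K_alg.
  - exact: smooth_alg_continuous dK_alg.
  - exact: (loop_continuous cdc).
  - exact: dc2_continuous.
  move=> y; have D1 := is_derive_compR (Ae_derive y.1) (fst_derive y (0, 1)).
  have D2 := is_derive_compR (ae_derive y.2) (snd_derive y (0, 1)).
  by apply: (is_derive_eq (is_derive_mul D1 D2)) => /=; ring.
apply: (is_derive_eq D).
have c1 := param_continuous1 (z := z) (smooth_alg_continuous dK_alg)
  (loop_continuous cdc) dc2_continuous.
have c2 := param_continuous1 (z := z) (smooth_alg_continuous mollifier_alg)
  (loop_continuous cdc) dc1_continuous.
apply/eqP; rewrite -addr_eq0; apply/eqP.
pose F t := - (Ae (z - c t).1 * ae (z - c t).2).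
pose f t := Ae (z - c t).1 * dae (z - c t).2 * (dc t).2 -
  - 1 * (mollifier (z - c t) * (dc t).1).
have DF (t : R) : is_derive t 1 F (f t).
  have d1 : is_derive t 1 (fun s => (z - c s).1) (- (dc t).1).
    have := is_derive_add (is_derive_cst z.1 t 1) (is_deriveN (loop_derive1 cdc t)).
    by rewrite add0r.
  have d2 : is_derive t 1 (fun s => (z - c s).2) (- (dc t).2).
    have := is_derive_add (is_derive_cst z.2 t 1) (is_deriveN (loop_derive2 cdc t)).
    by rewrite add0r.
  have D1 := is_derive_compR (Ae_derive _) d1.
  have D2 := is_derive_compR (ae_derive _) d2.
  apply: (is_derive_eq (is_deriveN (is_derive_mul D1 D2))).
  by rewrite /f /mollifier -!/(ae _); ring.
have c2' : continuous (fun t => -1 * (mollifier (z - c t) * (dc t).1)).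
  by move=> t; apply: cvgM; [exact: cvg_cst|exact: c2].
have cf : continuous f by move=> t; apply: cvgB; [exact: c1|exact: c2'].
have := int01_FTC cf DF; rewrite /F (loop_closed cdc) subrr.
by rewrite /f (int01B c1 c2') int01Zl // mulN1r opprK.
Qed.

Lemma mollifier_out (z : plane R) : e <= `|z| -> mollifier z = 0.
Proof.
rewrite prod_normE le_max /mollifier -!/(ae _) => /orP[] H.
  by rewrite [ae z.1]ae_out // mul0r.
by rewrite [ae z.2]ae_out // mulr0.
Qed.

Lemma soft_winding_d1_far (z : plane R) : (forall t, e <= `|z - c t|) ->
  is_derive z ((1, 0) : plane R) soft_winding 0.
Proof.
move=> zc; apply: (is_derive_eq (soft_winding_d1 z)).
rewrite (_ : (fun _ => _) = fun=> 0 * 0); last first.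
  by apply/funext => t; rewrite mollifier_out // !mul0r.
by rewrite int01Zl ?mul0r // => t; exact: cvg_cst.
Qed.

Lemma soft_winding_d2_far (z : plane R) : (forall t, e <= `|z - c t|) ->
  is_derive z ((0, 1) : plane R) soft_winding 0.
Proof.
move=> zc; apply: (is_derive_eq (soft_winding_d2 z)).
rewrite (_ : (fun _ => _) = fun=> 0 * 0); last first.
  by apply/funext => t; rewrite mollifier_out // !mul0r.
by rewrite int01Zl ?mul0r ?oppr0 // => t; exact: cvg_cst.
Qed.

(** The gradient vanishes at sup distance at least [e] from the loop, and two axis-parallel segments
    within a sup-norm ball around [p] lead from [p] to [p']. *)
Lemma soft_winding_const (p p' : plane R) r :
  (forall t, e + r <= `|p - c t|) -> `|p' - p| <= r ->
  soft_winding p' = soft_winding p.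
Proof.
move=> pc p'p.
have far (z : plane R) : `|z - p| <= r -> forall t, e <= `|z - c t|.
  move=> zp t; have : `|p - c t| <= `|z - p| + `|z - c t|.
    rewrite (_ : p - c t = (z - c t) - (z - p)).
      by rewrite [leRHS]addrC; exact: ler_normB.
    by rewrite opprB [RHS]addrC addrA subrK.
  have := pc t; lra.
move: p'p; rewrite prod_normE ge_max /= => /andP[p1 p2].
have E1 : soft_winding p' = soft_winding (p.1, p'.2).
  have [s s01] := MVT0 (p'.1 - p.1) (fun h => is_derive_along (p.1, p'.2) h soft_winding_d1).
  rewrite !hshift /= add0r subrK -[(p'.1, p'.2)]surjective_pairing.
  set q := (s * _ + _, _); suff -> : int01 (fun t => mollifier (q - c t) * (dc t).2) = 0.
    by rewrite mul0r => /eqP; rewrite subr_eq0 => /eqP.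
  have -> : int01 (fun t => mollifier (q - c t) * (dc t).2) = 'D_(1, 0) soft_winding q.
    by have := soft_winding_d1 q => D; rewrite derive_val.
  have D := @soft_winding_d1_far q _; rewrite (@derive_val _ _ _ _ _ _ _ (D _)) //.
  apply: far; rewrite prod_normE ge_max /q /=; apply/andP; split.
    rewrite addrK normrM; apply: le_trans p1; rewrite ler_piMl // ger0_norm; by case/andP: s01.
  exact: p2.
rewrite E1.
have [s s01] := MVT0 (p'.2 - p.2) (fun h => is_derive_along p h soft_winding_d2).
rewrite !vshift /= add0r subrK -[(p.1, p.2)]surjective_pairing.
set q := (_, s * _ + _); suff -> : - int01 (fun t => mollifier (q - c t) * (dc t).1) = 0.
  by rewrite mul0r => /eqP; rewrite subr_eq0 => /eqP.
have -> : - int01 (fun t => mollifier (q - c t) * (dc t).1) = 'D_(0, 1) soft_winding q.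
  by have := soft_winding_d2 q => D; rewrite derive_val.
have D := @soft_winding_d2_far q _; rewrite (@derive_val _ _ _ _ _ _ _ (D _)) //.
apply: far; rewrite prod_normE ge_max /q /=; apply/andP; split.
  by rewrite subrr normr0 (le_trans _ p1).
rewrite addrK normrM.
by apply: le_trans p2; rewrite ler_piMl // ger0_norm; case/andP: s01.
Qed.

Section Primitive.
Variable p : plane R.
Hypothesis far : forall t, e <= `|c t - p|.

Let x t := (c t).1 - p.1.
Let y t := (c t).2 - p.2.

Let x_derive (t : R) : is_derive t 1 x (dc t).1.
Proof.
have := is_derive_add (loop_derive1 cdc t) (is_derive_cst (- p.1) t 1).
by rewrite addr0.
Qed.

Let y_derive (t : R) : is_derive t 1 y (dc t).2.
Proof.
have := is_derive_add (loop_derive2 cdc t) (is_derive_cst (- p.2) t 1).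
by rewrite addr0.
Qed.

(* A polar angle divided by [2 pi]: the term [Ae] smooths the jump of the angle
   across the negative first axis. *)
Let angle t := if 0 < x t then atan (y t / x t) / (2 * pi)
  else if x t < 0 then atan (y t / x t) / (2 * pi) + 2^-1 - Ae (- y t)
  else if 0 < y t then 4^-1 else - 4^-1.

Let dangle t := (x t * (dc t).2 - y t * (dc t).1) / (x t ^+ 2 + y t ^+ 2) / (2 * pi)
  + Ae (- x t) * ae (- y t) * (dc t).2.

Let cont (f : R -> R) (df : R -> R) :
  (forall t : R, is_derive t 1 f (df t)) -> continuous f.
Proof.
move=> Df t; apply: differentiable_continuous.
by apply/derivable1_diffP; exact: ex_derive.
Qed.

Let xory t : e <= `|x t| \/ e <= `|y t|.
Proof. by have := far t; rewrite prod_normE le_max => /orP[]; [left|right]. Qed.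

Let nz t : x t ^+ 2 + y t ^+ 2 != 0.
Proof.
rewrite gt_eqF //.
have sq z : e <= `|z| -> 0 < z ^+ 2.
  by move=> ez; rewrite exprn_even_gt0 //= -normr_gt0 (lt_le_trans e0).
case: (xory t) => /sq H.
  by rewrite ltr_pwDl // sqr_ge0.
by rewrite ltr_wpDl // sqr_ge0.
Qed.

(** As [x t] and [y t] are never both smaller than [e] in absolute value, [Ae (- x t)] is 0 or 1
    wherever [ae (- y t)] is nonzero. The second term of [dangle] is therefore exactly the
    derivative of the smoothed jump on the left half-plane and 0 on the right one. *)
Let angle_derive (t : R) : is_derive t 1 angle (dangle t).
Proof.
have p0 : (pi : R) != 0 by rewrite gt_eqF // pi_gt0.
have cx := cont x_derive; have cy := cont y_derive.
have Dat (z : R -> R) (dz k : R) : is_derive t 1 z dz ->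
    is_derive t 1 (fun s => z s * k) (dz * k).
  move=> D; apply: (is_derive_eq (is_derive_mul D (is_derive_cst k t 1))).
  by rewrite mulr0 add0r mulrC.
have [x0|x0|x0] := ltgtP 0 (x t).
- apply: (near_eq_is_derive (f := fun s => atan (y s / x s) / (2 * pi))).
    have : \forall s \near t, 0 < x s by exact: (cx t _ (lt_nbhsr x0)).
    by apply: filterS => s xs; rewrite /angle xs.
  have x1 : x t != 0 by rewrite gt_eqF.
  apply: (is_derive_eq (Dat _ _ _ (is_derive_angle x1 (x_derive t) (y_derive t)))).
  rewrite /dangle (_ : Ae (- x t) * _ = 0) ?mul0r ?addr0 //.
  case: (xory t) => H; first by rewrite Ae_left ?mul0r // lerN2 -(gtr0_norm x0).
  by rewrite ae_out ?mulr0 // normrN.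
- apply: (near_eq_is_derive
    (f := fun s => atan (y s / x s) / (2 * pi) + (2^-1 - Ae (- y s)))).
    have : \forall s \near t, x s < 0 by exact: (cx t _ (lt_nbhsl x0)).
    by apply: filterS => s xs; rewrite /angle xs ltNge (ltW xs) /= addrA.
  have x1 : x t != 0 by rewrite lt_eqF.
  have D1 := Dat _ _ (2 * pi)^-1 (is_derive_angle x1 (x_derive t) (y_derive t)).
  have D2 := is_derive_compR (Ae_derive _) (is_deriveN (y_derive t)).
  have D3 := is_derive_add (is_derive_cst (2^-1 : R) t 1) (is_deriveN D2).
  apply: (is_derive_eq (is_derive_add D1 D3)).
  rewrite /dangle add0r mulrN opprK; congr (_ + _).
  case: (xory t) => H; first by rewrite Ae_right ?mul1r // -(ltr0_norm x0).
  by rewrite ae_out ?mulr0 ?mul0r // normrN.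
- have x1 := esym x0.
  have yt : e <= `|y t|.
    by case: (xory t) => //; rewrite x1 normr0 leNgt e0.
  have y1 : y t != 0 by rewrite -normr_gt0 (lt_le_trans e0).
  have near1 : \forall s \near t, `|x s| < e.
    have H : `|x s| @[s --> t] --> (0 : R).
      by rewrite -(normr0 R) -x1; exact: (cvg_norm (cx t)).
    exact: (H _ (lt_nbhsl e0)).
  (* Next to the vertical axis [x / y] replaces [y / x]: the angle is a signed quarter turn minus
     [atan (x / y)], which is differentiable there because [y] stays away from 0. *)
  pose k : R := if 0 < y t then 4^-1 else - 4^-1.
  apply: (near_eq_is_derive (f := fun s => k + (atan (x s / y s)) * (- (2 * pi)^-1))).
    have near2 : \forall s \near t, 0 < y s * y t.
      have H : y s * y t @[s --> t] --> y t * y t.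
        by apply: cvgM; [exact: cy|exact: cvg_cst].
      have yy0 : 0 < y t * y t by rewrite -expr2 exprn_even_gt0.
      exact: (H _ (lt_nbhsr yy0)).
    near=> s.
    have xs : `|x s| < e by near: s.
    have yst : 0 < y s * y t by near: s.
    have ys : e <= `|y s| by case: (xory s) => // /(lt_le_trans xs); rewrite ltxx.
    have ky : (0 < y t) = (0 < y s).
      apply/idP/idP => H; first by rewrite -(pmulr_lgt0 _ H).
      by rewrite -(pmulr_rgt0 _ H).
    have ys0 : y s != 0 by rewrite -normr_gt0 (lt_le_trans e0).
    rewrite /k /angle ky.
    case: (ltgtP 0 (x s)) => [xs0|xs0|<-]; last by rewrite mul0r atan0 mul0r addr0.
    + case: ifP => ys1.
        have -> : atan (y s / x s) = pi / 2 - atan (x s / y s).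
          by rewrite -atan_inv ?invf_div // divr_gt0.
        by move: (pi : R) p0 => P P0; field.
      have -> : atan (y s / x s) = - (pi / 2) - atan (x s / y s).
        have ys2 : 0 < - y s by rewrite oppr_gt0 lt_neqAle ys0 leNgt ys1.
        have := atan_inv (divr_gt0 xs0 ys2).
        rewrite invf_div invrN mulrN mulNr !atanN; lra.
      by move: (pi : R) p0 => P P0; field.
    + case: ifP => ys1.
        have -> : atan (y s / x s) = - (pi / 2) - atan (x s / y s).
          have xs2 : 0 < - x s by rewrite oppr_gt0.
          have := atan_inv (divr_gt0 xs2 ys1).
          rewrite invf_div invrN mulrN mulNr !atanN; lra.
        rewrite Ae_left; last by rewrite lerN2 -(gtr0_norm ys1).
        by move: (pi : R) p0 => P P0; field.
      have ys2 : y s < 0 by rewrite lt_neqAle ys0 leNgt ys1.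
      have -> : atan (y s / x s) = pi / 2 - atan (x s / y s).
        have := atan_inv (divr_gt0 _ _ : 0 < - x s / - y s).
        rewrite !oppr_gt0 => /(_ xs0 ys2).
        by rewrite invf_div !invrN !mulrNN.
      rewrite Ae_right; last by rewrite -(ltr0_norm ys2).
      by move: (pi : R) p0 => P P0; field.
  have D1 := Dat _ _ (- (2 * pi)^-1) (is_derive_angle y1 (y_derive t) (x_derive t)).
  apply: (is_derive_eq (is_derive_add (is_derive_cst k t 1) D1)).
  rewrite /dangle [ae _]ae_out ?normrN // mulr0 mul0r addr0 add0r.
  have := nz t; rewrite x1 expr0n add0r !mul0r addr0 => ?.
  by move: (pi : R) p0 => P P0; field; rewrite y1 P0.
Unshelve. all: by end_near. Qed.

(** In the limit of small [e], [soft_winding] counts the crossings of the horizontal ray to the left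
    of [p], with the sign of the second component of [dc]. A positive loop crosses this ray
    downwards, hence the minus sign. The identity is exact at every admissible scale, since the
    integral of [dangle] over the closed loop is 0. *)
Lemma soft_winding_far : soft_winding p = - (int01 (fun t =>
  (- y t / (x t ^+ 2 + y t ^+ 2)) * (dc t).1 + (x t / (x t ^+ 2 + y t ^+ 2)) * (dc t).2)
  / (2 * pi)).
Proof.
have p0 : (pi : R) != 0 by rewrite gt_eqF // pi_gt0.
have cx := cont x_derive; have cy := cont y_derive.
pose f t := (x t * (dc t).2 - y t * (dc t).1) / (x t ^+ 2 + y t ^+ 2).
have cf : continuous f.
  move=> t; apply: cvgM.
    apply: cvgB; apply: cvgM; [exact: cx|exact: dc2_continuous|exact: cy|exact: dc1_continuous].
  apply: cvgV => //; apply: cvgD.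
    by apply: (@continuous_comp _ _ _ x (fun z => z ^+ 2) t); [exact: cx|exact: exprn_continuous].
  by apply: (@continuous_comp _ _ _ y (fun z => z ^+ 2) t); [exact: cy|exact: exprn_continuous].
have cg : continuous (fun t => Ae (- x t) * ae (- y t) * (dc t).2).
  have := param_continuous1 (z := p) (smooth_alg_continuous K_alg)
    (loop_continuous cdc) dc2_continuous.
  rewrite (_ : (fun _ => _) = (fun t => Ae (- x t) * ae (- y t) * (dc t).2)) //.
  by apply/funext => t; rewrite /K /x /y !opprB.
have cf2 : continuous (fun t => (2 * pi)^-1 * f t).
  by move=> t; apply: cvgM; [exact: cvg_cst|exact: cf].
have cd : continuous dangle.
  move=> t; rewrite /continuous_at /dangle.
  apply: cvgD; last exact: cg.
  by apply: cvgM; [exact: cf|exact: cvg_cst].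
have := int01_FTC cd angle_derive.
have -> : angle 1 = angle 0 by rewrite /angle /x /y (loop_closed cdc).
rewrite subrr => E.
have cgN : continuous (fun t => -1 * (Ae (- x t) * ae (- y t) * (dc t).2)).
  by move=> t; apply: cvgM; [exact: cvg_cst|exact: cg].
have : int01 dangle = (2 * pi)^-1 * int01 f + soft_winding p.
  have -> : soft_winding p = int01 (fun t => Ae (- x t) * ae (- y t) * (dc t).2).
    by congr int01; apply/funext => t; rewrite /x /y !opprB.
  rewrite -[X in _ + X]opprK -[- int01 _]mulN1r -int01Zl // -int01Zl // -int01B //.
  by congr int01; apply/funext => t; rewrite /dangle /f; ring.
rewrite E => /esym /eqP; rewrite addrC addr_eq0 => /eqP ->; rewrite mulrC.
by congr (- (int01 _ / _)); apply/funext => t; rewrite /f; field; exact: nz.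
Qed.

End Primitive.

(** A point outside the unit disk can be pushed horizontally, away from the second axis, without
    coming near the loop. Far to the left the factor [A] is 0; far to the right it is 1 and the
    integrand becomes exact. *)
Lemma soft_winding_outside (p : plane R) :
  (forall z : plane R, (exists t, `|z - c t| < e) -> z.1 ^+ 2 + z.2 ^+ 2 < 1) ->
  1 <= p.1 ^+ 2 + p.2 ^+ 2 -> soft_winding p = 0.
Proof.
move=> cD pD.
have far (z : plane R) : 1 <= z.1 ^+ 2 + z.2 ^+ 2 -> forall t, e <= `|z - c t|.
  move=> zD t; rewrite leNgt; apply/negP => zt.
  by have := cD z (ex_intro _ t zt); rewrite ltNge zD.
have c1 t : `|(c t).1| <= 1.
  have : (c t).1 ^+ 2 + (c t).2 ^+ 2 < 1.
    by apply: cD; exists t; rewrite subrr normr0.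
  have := sqr_ge0 (c t).2 => h1 h2.
  by rewrite -(ler_pXn2r (n := 2)) ?nnegrE // expr1n real_normK ?num_real //; lra.
have ray L : 0 <= L * p.1 -> soft_winding p = soft_winding (L + p.1, p.2).
  move=> L0.
  have [s s01] := MVT0 L (fun h => is_derive_along p h soft_winding_d1).
  rewrite !hshift add0r -[(p.1, p.2)]surjective_pairing.
  set q := (s * _ + _, _); suff -> : int01 (fun t => mollifier (q - c t) * (dc t).2) = 0.
    by rewrite mul0r => /eqP; rewrite subr_eq0 => /eqP.
  have -> : int01 (fun t => mollifier (q - c t) * (dc t).2) = 'D_(1, 0) soft_winding q.
    by have := soft_winding_d1 q => D; rewrite derive_val.
  have D := @soft_winding_d1_far q _; rewrite (@derive_val _ _ _ _ _ _ _ (D _)) //.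
  apply: far; rewrite /q /=.
  apply: le_trans pD _; rewrite lerD2r.
  rewrite -subr_ge0 (_ : _ - _ = (s * L) ^+ 2 + 2 * (s * (L * p.1))); last by ring.
  by rewrite addr_ge0 ?sqr_ge0// mulr_ge0// mulr_ge0//; case/andP: s01.
have [p0|p0] := leP (p.1) 0.
  pose L := p.1 - 2 - e.
  rewrite (ray L); last first.
    rewrite /L -mulrNN mulr_ge0 //; have := e0; lra.
  rewrite /soft_winding (_ : (fun _ => _) = fun=> 0 * 0); last first.
    apply/funext => t; rewrite -/(Ae _) Ae_left ?mul0r //=.
    rewrite /L; have := c1 t; rewrite ler_norml => /andP[].
    lra.
  by rewrite int01Zl ?mul0r // => t; exact: cvg_cst.
pose L := 2 + e.
rewrite (ray L); last by rewrite mulr_ge0 ?(ltW p0) // /L; have := e0; lra.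
pose F t := - Ae (p.2 - (c t).2); pose f t := ae (p.2 - (c t).2) * (dc t).2.
have DF (t : R) : is_derive t 1 F (f t).
  have d2 : is_derive t 1 (fun s => p.2 - (c s).2) (- (dc t).2).
    have := is_derive_add (is_derive_cst p.2 t 1) (is_deriveN (loop_derive2 cdc t)).
    by rewrite add0r.
  have D2 := is_derive_compR (Ae_derive _) d2.
  by apply: (is_derive_eq (is_deriveN D2)); rewrite mulrN opprK.
have -> : soft_winding (L + p.1, p.2) = int01 f.
  congr int01; apply/funext => t; rewrite -/(Ae _) Ae_right ?mul1r //=.
  rewrite /L; have := c1 t; rewrite ler_norml => /andP[].
  lra.
rewrite (int01_FTC _ DF) /F ?(loop_closed cdc) ?subrr // => t.
have ae_alg : smooth_alg (fun z : plane R => ae z.2).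
  by apply: smooth_alg_comp => //; constructor.
exact: (param_continuous1 (z := p) (smooth_alg_continuous ae_alg)
  (loop_continuous cdc) dc2_continuous).
Qed.

End Scale.
End Winding.

(** * Lebesgue measure on the plane and integrals over a subset *)

Section Plane_measure.
Context {R : realType}.

(* The library does not infer that a product of sigma-finite measures is one. *)
Definition leb2 : set (mplane R) -> \bar R := lebesgue2 R.

Let leb2_0 : leb2 set0 = 0%E.
Proof. exact: (@measure0 _ _ _ (lebesgue_measure \x lebesgue_measure)%E). Qed.

Let leb2_ge0 A : (0 <= leb2 A)%E.
Proof. exact: (@measure_ge0 _ _ _ (lebesgue_measure \x lebesgue_measure)%E). Qed.

Let leb2_sigma : semi_sigma_additive leb2.
Proof.
exact: (@measure_semi_sigma_additive _ _ _ (lebesgue_measure \x lebesgue_measure)%E).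
Qed.

HB.instance Definition _ := isMeasure.Build _ _ _ leb2 leb2_0 leb2_ge0 leb2_sigma.

Lemma leb2X (A B : set (measurableTypeR R)) : measurable A -> measurable B ->
  leb2 (A `*` B) = (lebesgue_measure A * lebesgue_measure B)%E.
Proof. exact: product_measure1E. Qed.

Let leb2_sigma_finite : sigma_finite setT leb2.
Proof.
have /sigma_finiteP[F [TF ndF Foo]] := sigma_finiteT (@lebesgue_measure R).
exists (fun n => F n `*` F n).
  rewrite -setXTT TF predeqE => -[x y]; split => [[/= [n _ Fnx] [k _ Gky]]|].
    exists (maxn n k) => //; split.
    - by move: x Fnx; exact/subsetPset/ndF/leq_maxl.
    - by move: y Gky; exact/subsetPset/ndF/leq_maxr.
  by move=> [n _ []/= ? ?]; split; exists n.
move=> k; have [? ?] := Foo k.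
split; first exact: measurableX.
by rewrite leb2X// lte_mul_pinfty// ge0_fin_numE.
Qed.

HB.instance Definition _ :=
  Measure_isSigmaFinite.Build _ _ _ leb2 leb2_sigma_finite.

(** An open set is the countable union of the boxes with rational centre and radius [n.+1%:R^-1]
    that it contains, and each box is a measurable rectangle. *)
Lemma open_plane_measurable (U : set (plane R)) :
  open U -> measurable (U : set (mplane R)).
Proof.
move=> oU.
pose C (p q : rat) (n : nat) : set (mplane R) :=
  (ball (ratr p : R) n.+1%:R^-1 `*` ball (ratr q : R) n.+1%:R^-1).
pose F p q n := if `[< C p q n `<=` U >] then C p q n else set0.
have -> : U = \bigcup_p \bigcup_q \bigcup_n F p q n.
  apply/seteqP; split => [z Uz|z [p _ [q _ [n _]]]]; last first.
    by rewrite /F; case: asboolP => // H; exact: H.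
  have /nbhs_ballP[e /= e0 zU] : nbhs z U by exact: open_nbhs_nbhs.
  have [n ne] : exists n, n.+1%:R^-1 < e / 2.
    have e20 : 0 < e / 2 by rewrite divr_gt0.
    have [n] := @ltr_add_invr R 0 (e / 2) e20.
    by rewrite add0r; exists n.
  have n0 : (0 : R) < n.+1%:R^-1 by rewrite invr_gt0.
  have rat_near (x : R) : exists p : rat, `|ratr p - x| < n.+1%:R^-1.
    have xx : x - n.+1%:R^-1 < x + n.+1%:R^-1 by rewrite ltrD2l gtrN.
    have [p] := rat_in_itvoo xx.
    by rewrite in_itv /= => xp; exists p; rewrite ltr_distl.
  have [p zp] := rat_near z.1; have [q zq] := rat_near z.2.
  exists p => //; exists q => //; exists n => //; rewrite /F asboolT.
    by split; rewrite -ball_normE.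
  move=> w [] /=; rewrite -!ball_normE /= => w1 w2; apply: zU.
  split; rewrite -ball_normE /=.
    rewrite (_ : z.1 - w.1 = (ratr p - w.1) - (ratr p - z.1)); last by ring.
    by apply: le_lt_trans (ler_normB _ _) _; move: (ltrD w1 zp) ne; move: (n.+1%:R^-1) => k; lra.
  rewrite (_ : z.2 - w.2 = (ratr q - w.2) - (ratr q - z.2)); last by ring.
  by apply: le_lt_trans (ler_normB _ _) _; move: (ltrD w2 zq) ne; move: (n.+1%:R^-1) => k; lra.
apply: bigcupT_measurable_rat => p; apply: bigcupT_measurable_rat => q.
apply: bigcupT_measurable => n; rewrite /F; case: ifP => // _.
by apply: measurableX; exact: measurable_ball.
Qed.

Lemma continuous_plane_measurable (f : plane R -> R) : continuous f ->
  measurable_fun setT (f : mplane R -> R).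
Proof.
move=> cf; apply: (measurability _ (RGenOpens.measurableE R)).
move=> _ [_ [a [b ->] <-]]; rewrite setTI; apply: open_plane_measurable.
move/continuousP : cf; apply; exact: interval_open.
Qed.

End Plane_measure.

Section Patched_integrals.
Context d (T : measurableType d) (R : realType) (mu : {measure set T -> \bar R}).

Lemma integral_indicr (D : set T) (f : T -> R) :
  (\int[mu]_x (f x * \1_D x)%:E = \int[mu]_(x in D) (f x)%:E)%E.
Proof.
rewrite [RHS]integral_mkcond; apply: eq_integral => x _.
by rewrite patchE indicE; case: ifPn; rewrite ?mulr1 ?mulr0.
Qed.

Lemma integrable_indicr (D : set T) (f : T -> R) : measurable D ->
  mu.-integrable D (EFin \o f) <->
  mu.-integrable setT (fun x => (f x * \1_D x)%:E).
Proof.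
move=> mD; have -> : (fun x => (f x * \1_D x)%:E) = (EFin \o f) \_ D.
  apply/funext => x.
  by rewrite patchE indicE; case: ifPn; rewrite ?mulr1 ?mulr0.
by rewrite -[X in _.-integrable X _ <-> _](setTI D); exact: integrable_restrict.
Qed.

Lemma integrable_indic (D : set T) (f : T -> R) : measurable D ->
  mu.-integrable D (EFin \o f) -> mu.-integrable setT (fun x => (f x * \1_D x)%:E).
Proof. by move=> mD; have [] := integrable_indicr f mD. Qed.

Lemma integrable_subr (D : set T) (f g : T -> R) : measurable D ->
  mu.-integrable D (EFin \o f) -> mu.-integrable D (EFin \o g) ->
  mu.-integrable D (EFin \o (fun x => f x - g x)).
Proof.
move=> mD If Ig; have := integrableB mD If Ig.
by apply: eq_integrable => // x _; rewrite /= EFinB.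
Qed.

Lemma integrable_addr (D : set T) (f g : T -> R) : measurable D ->
  mu.-integrable D (EFin \o f) -> mu.-integrable D (EFin \o g) ->
  mu.-integrable D (EFin \o (fun x => f x + g x)).
Proof.
move=> mD If Ig; have := integrableD mD If Ig.
by apply: eq_integrable => // x _; rewrite /= -EFinD.
Qed.

Lemma integrable_scaler (D : set T) (r : R) (f : T -> R) : measurable D ->
  mu.-integrable D (EFin \o f) -> mu.-integrable D (EFin \o (fun x => r * f x)).
Proof.
move=> mD If; have := integrableZl mD r If.
by apply: eq_integrable => // x _; rewrite /= EFinM.
Qed.

End Patched_integrals.

(** * Mollified line integrals and their limit at small scales *)

Section Mollification.
Context {R : realType}.
Variables (A a : R -> R) (Aa : step_pair A a).
Implicit Types (c : R -> plane R) (k : R -> R).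

Lemma bump_integral (e y0 : R) : 0 < e ->
  (\int[@lebesgue_measure R]_y (e^-1 * a (e^-1 * (y - y0)))%:E = 1)%E.
Proof.
move=> e0.
pose F y := A (e^-1 * y + (- (e^-1 * y0))).
pose g y := e^-1 * a (e^-1 * (y - y0)).
have DF (y : R) : is_derive y 1 F (g y).
  rewrite /g mulrBr; apply: is_derive_affine; exact: (step_derive Aa).
have g0 y : ~~ (y \in `[y0 - e, y0 + e]) -> g y = 0.
  move=> H; rewrite /g (bump_out Aa) ?mulr0 // normrM gtr0_norm ?invr_gt0 //.
  rewrite mulrC ler_pdivlMr // mul1r leNgt; apply: contra H.
  by rewrite ltr_norml in_itv /= => /andP[? ?]; apply/andP; split; lra.
have -> : (\int[@lebesgue_measure R]_y (g y)%:E)%E =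
    (\int[@lebesgue_measure R]_(y in `[(y0 - e)%R, (y0 + e)%R]) (g y)%:E)%E.
  rewrite [RHS]integral_mkcond; apply: eq_integral => y _.
  rewrite patchE; case: ifPn => // H; rewrite g0 //.
  by apply: contra H; rewrite inE /=.
have cg : continuous g.
  move=> y; apply: cvgM; first exact: cvg_cst.
  apply: (@continuous_comp _ _ _ (fun y => e^-1 * (y - y0)) a).
    apply: cvgM; first exact: cvg_cst.
    by apply: cvgB; [exact: cvg_id|exact: cvg_cst].
  exact: smooth1_continuous (bump_smooth Aa) _.
have cF : continuous F.
  move=> y; apply: differentiable_continuous.
  by apply/derivable1_diffP; exact: ex_derive.
have ab : y0 - e < y0 + e by lra.
rewrite (@continuous_FTC2 _ g F) //.
- have -> : F (y0 + e) = 1.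
    by rewrite /F (step_right Aa) // -mulrBr addrC addKr mulVf ?gt_eqF.
  have -> : F (y0 - e) = 0.
    by rewrite /F (step_left Aa) // -mulrBr addrC addKr mulrN mulVf ?gt_eqF.
  by rewrite sube0.
- exact: continuous_subspaceT.
- split=> [y _||]; first exact: ex_derive.
  + by apply: cvg_at_right_filter; exact: cF.
  + by apply: cvg_at_left_filter; exact: cF.
- by move=> y _; rewrite derive1E derive_val.
Qed.

Lemma bump_scaled_measurable (e : R) d (T : measurableType d) (h : T -> R) :
  measurable_fun setT h -> measurable_fun setT (fun x => e^-1 * a (e^-1 * h x)).
Proof.
move=> mh; apply: measurable_funM => //.
apply: (@measurableT_comp _ _ _ _ _ _ a).
  exact: continuous_measurable_fun (smooth1_continuous (bump_smooth Aa)).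
exact: measurable_funM.
Qed.

Lemma mollifier_ge0 e z : 0 < e -> 0 <= mollifier a e z.
Proof.
move=> e0; rewrite /mollifier; apply: mulr_ge0; apply: mulr_ge0;
  by rewrite ?invr_ge0 ?(ltW e0) // (bump_ge0 Aa).
Qed.

Lemma mollifier_measurable e d (T : measurableType d) (h : T -> mplane R) :
  measurable_fun setT h -> measurable_fun setT (fun x => mollifier a e (h x)).
Proof.
move=> mh; apply: measurable_funM; apply: bump_scaled_measurable.
  by apply: measurableT_comp => //; exact: measurable_fst.
by apply: measurableT_comp => //; exact: measurable_snd.
Qed.

Lemma sub_plane_measurable d (T : measurableType d) (h g : T -> mplane R) :
  measurable_fun setT h -> measurable_fun setT g ->
  measurable_fun setT ((fun x => h x - g x) : T -> mplane R).
Proof.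
move=> mh mg; apply/measurable_fun_pairP; split.
  by apply: measurable_funB; apply: measurableT_comp => //; exact: measurable_fst.
by apply: measurable_funB; apply: measurableT_comp => //; exact: measurable_snd.
Qed.

Lemma mollifier_integral (e : R) (z0 : plane R) : 0 < e ->
  (\int[leb2]_z (mollifier a e (z - z0))%:E = 1)%E.
Proof.
move=> e0.
have mf : measurable_fun setT (fun z : mplane R => (mollifier a e (z - z0))%:E).
  apply/measurable_EFinP; apply: mollifier_measurable.
  by apply: sub_plane_measurable; [exact: measurable_id|exact: measurable_cst].
transitivity (\int[(@lebesgue_measure R \x @lebesgue_measure R)%E]_z
  (mollifier a e (z - z0))%:E)%E => //.
rewrite fubini_tonelli1 //; last by move=> z; rewrite lee_fin mollifier_ge0.
rewrite -(bump_integral z0.1 e0); apply: eq_integral => x _.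
rewrite /fubini_F /mollifier /=; under eq_integral do rewrite EFinM.
rewrite ge0_integralZl ?bump_integral ?mule1 //.
- apply/measurable_EFinP; apply: bump_scaled_measurable.
  by apply: measurable_funB; [exact: measurable_id|exact: measurable_cst].
- by move=> y _; rewrite lee_fin mulr_ge0 ?invr_ge0 ?(ltW e0) ?(bump_ge0 Aa).
- by rewrite lee_fin mulr_ge0 ?invr_ge0 ?(ltW e0) ?(bump_ge0 Aa).
Qed.

End Mollification.

Section Mollified_line_integral.
Context {R : realType}.
Variables (A a : R -> R) (Aa : step_pair A a).

Lemma bump_bounded : exists2 M, 0 < M & forall x, a x <= M.
Proof.
have ca := smooth1_continuous (bump_smooth Aa).
have [x _ Hx] := @EVT_max R a (-1) 1 ltac:(lra) (continuous_subspaceT ca).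
exists (a x + 1) => [|y]; first by rewrite ltr_wpDl // (bump_ge0 Aa).
have [y1|y1] := leP `|y| 1.
  have := Hx y; rewrite in_itv /= -ler_norml => /(_ y1); lra.
by rewrite (bump_out Aa) ?(ltW y1) //; have := bump_ge0 Aa x; lra.
Qed.

Lemma continuous01_bounded (k : R -> R) : continuous k ->
  exists2 M, 0 < M & forall t, 0 <= t <= 1 -> `|k t| <= M.
Proof.
move=> ck; have cnk : continuous (fun t => `|k t|).
  by move=> t; apply: continuous_comp; [exact: ck|exact: norm_continuous].
have [x _ Hx] := @EVT_max R _ 0 1 ler01 (continuous_subspaceT cnk).
exists (`|k x| + 1) => [|y y01]; first by rewrite ltr_wpDl.
by have := Hx y; rewrite in_itv /= => /(_ y01); lra.
Qed.

Section Swap.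
Variables (Om : set (plane R)) (f : plane R -> R) (c : R -> plane R) (k : R -> R).
Hypothesis mOm : measurable (Om : set (mplane R)).
Hypothesis If : leb2.-integrable (Om : set (mplane R)) (EFin \o f).
Hypotheses (cc : continuous c) (ck : continuous k).
Variables (e : R) (e0 : 0 < e).

Let I01 : set (measurableTypeR R) := `[0, 1].

Let mI01 : measurable I01. Proof. exact: measurable_itv. Qed.

(** Both domains of integration are absorbed as indicators, so that Fubini's theorem is applied on
    the whole product. *)
Let F (p : mplane R * measurableTypeR R) : R :=
  (f p.1 * \1_Om p.1) * (mollifier a e (p.1 - c p.2) * k p.2 * \1_I01 p.2).

Let fOm_integrable : leb2.-integrable setT (fun z => (f z * \1_Om z)%:E).
Proof. exact: integrable_indic. Qed.

Let mF : measurable_fun setT (EFin \o F).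
Proof.
apply/measurable_EFinP; apply: measurable_funM.
  apply: (@measurableT_comp _ _ _ _ _ _ (fun z : mplane R => f z * \1_Om z)).
    by apply/measurable_EFinP; apply: measurable_int fOm_integrable.
  exact: measurable_fst.
apply: measurable_funM; last first.
  apply: (@measurableT_comp _ _ _ _ _ _ (\1_I01 : _ -> R)).
    exact: (measurable_indic mI01).
  exact: measurable_snd.
apply: measurable_funM; last first.
  apply: measurableT_comp; last exact: measurable_snd.
  exact: continuous_measurable_fun.
apply: (mollifier_measurable Aa); apply: sub_plane_measurable.
  exact: measurable_fst.
apply/measurable_fun_pairP; split.
  apply: (@measurableT_comp _ _ _ _ _ _ (fun t : measurableTypeR R => (c t).1));
    last exact: measurable_snd.
  apply: continuous_measurable_fun => t.
  by apply: (@continuous_comp _ _ _ c fst); [exact: cc|exact: cvg_fst].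
apply: (@measurableT_comp _ _ _ _ _ _ (fun t : measurableTypeR R => (c t).2));
  last exact: measurable_snd.
apply: continuous_measurable_fun => t.
by apply: (@continuous_comp _ _ _ c snd); [exact: cc|exact: cvg_snd].
Qed.

Let iF : (leb2 \x @lebesgue_measure R)%E.-integrable setT (EFin \o F).
Proof.
have [M M0 aM] := bump_bounded.
have [N N0 kN] := continuous01_bounded ck.
(* [C] bounds the kernel times [k], so [F] is dominated by an integrable function of the point times
   the indicator of the segment. *)
pose C := (e^-1 * M) ^+ 2 * N.
have C0 : 0 < C by rewrite mulr_gt0 ?exprn_gt0 ?mulr_gt0 ?invr_gt0.
have FC p : `|F p| <= `|f p.1 * \1_Om p.1| * C * \1_I01 p.2.
  rewrite /F normrM -[leRHS]mulrA; apply: ler_wpM2l => //.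
  rewrite indicE; case: (boolP (p.2 \in I01)) => [|_]; last by rewrite !mulr0 normr0.
  rewrite inE /I01 /= in_itv /= => p01; rewrite !mulr1 normrM /C.
  apply: ler_pM => //; last exact: kN.
  rewrite ger0_norm ?(mollifier_ge0 Aa) // /mollifier expr2.
  by apply: ler_pM; rewrite ?mulr_ge0 ?invr_ge0 ?(ltW e0) ?(bump_ge0 Aa) //;
    rewrite ler_pM2l ?invr_gt0.
apply/(integrable12ltyP _ _ mF).

have I2 : leb2.-integrable setT (fun z => (C * `|f z * \1_Om z|)%:E).
  have := integrableZl measurableT C (integrable_norm fOm_integrable).
  by apply: eq_integrable => // z _; rewrite EFinM.
have /integrableP[_] := I2; apply: le_lt_trans.
apply: ge0_le_integral => //.
- by move=> z _; apply: integral_ge0.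
- apply: (measurable_fun_fubini_tonelli_F (abse \o (EFin \o F))) => //.
    exact: measurableT_comp.
  by move=> p; exact: abse_ge0.
- by apply: measurableT_comp => //; apply: measurable_int I2.
move=> z _; rewrite gee0_abs; last by rewrite lee_fin pmulr_rge0.
apply: (@le_trans _ _ (\int[@lebesgue_measure R]_y
   ((`|f z * \1_Om z| * C) * \1_I01 y)%:E)%E).
  apply: ge0_le_integral => //.
  - apply: measurableT_comp => //.
    apply: (@measurableT_comp _ _ _ _ _ _ (EFin \o F) _ (fun y => (z, y))) => //.
    exact: pair1_measurable.
  - apply/measurable_EFinP; apply: measurable_funM => //; exact: (measurable_indic mI01).
  - by move=> y _; exact: (FC (z, y)).
rewrite integral_indicr integral_cst /=; last exact: measurable_itv.
by rewrite /I01 lebesgue_measure_itv /= lte_fin ltr01 -EFinB subr0 mule1 mulrC.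
Qed.

Let Fz z : (\int[@lebesgue_measure R]_t (F (z, t))%:E)%E =
  ((f z * int01 (fun t => mollifier a e (z - c t) * k t)) * \1_Om z)%:E.
Proof.
have cm : continuous (fun t => mollifier a e (z - c t) * k t).
  apply: param_continuous1 => //; apply: smooth_alg_continuous.
  exact: (mollifier_alg Aa).
transitivity (\int[@lebesgue_measure R]_t ((f z * \1_Om z)%:E *
    (mollifier a e (z - c t) * k t * \1_I01 t)%:E))%E.
  by apply: eq_integral => t _; rewrite -EFinM.
have I1 := int01_integrable cm.
rewrite integralZl //; last exact: (integrable_indic mI01 I1).
rewrite integral_indicr /int01 /Rintegral [in RHS]mulrAC [RHS]EFinM fineK //.
exact: (integrable_fin_num _ I1).
Qed.

Lemma mollified_integrable : leb2.-integrable (Om : set (mplane R))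
  (fun z => (f z * int01 (fun t => mollifier a e (z - c t) * k t))%:E).
Proof.
apply/integrable_indicr => //; have := integrable_fubini_F iF.
by apply: eq_integrable => // z _; rewrite /fubini_F Fz.
Qed.

Lemma mollifier_mul_integrable (z0 : plane R) : leb2.-integrable (Om : set (mplane R))
  (fun z => (f z * mollifier a e (z - z0))%:E).
Proof.
  have [M M0 aM] := bump_bounded.
  apply: (le_integrable _ _ _ (integrableZl mOm ((e^-1 * M) ^+ 2) If)) => //.
    apply/measurable_EFinP; apply: measurable_funM.
      by apply/measurable_EFinP; apply: measurable_int If.
    apply: measurable_funTS; apply: (mollifier_measurable Aa).
    by apply: sub_plane_measurable; [exact: measurable_id|exact: measurable_cst].
  move=> z _; rewrite /= lee_fin [leLHS]normrM [leRHS]normrM [leLHS]mulrC ler_wpM2r //.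
  have B0 : 0 <= e^-1 * M by rewrite mulr_ge0 ?invr_ge0 ?(ltW e0) ?(ltW M0).
  rewrite (ger0_norm (exprn_ge0 2 B0)) ger0_norm ?(mollifier_ge0 Aa) //.
  rewrite /mollifier expr2.
  by apply: ler_pM; rewrite ?mulr_ge0 ?invr_ge0 ?(ltW e0) ?(bump_ge0 Aa) //;
    rewrite ler_pM2l ?invr_gt0.
Qed.

Let G t := k t * Rintegral leb2 Om (fun z => f z * mollifier a e (z - c t)).

Let Ft t : (\int[leb2]_z (F (z, t))%:E)%E = (G t * \1_I01 t)%:E.
Proof.
have mol_int := mollifier_mul_integrable (c t).
transitivity (\int[leb2]_z ((k t * \1_I01 t)%:E *
    (f z * mollifier a e (z - c t) * \1_Om z)%:E))%E.
  by apply: eq_integral => z _; rewrite /F /= -EFinM; congr EFin; ring.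
rewrite integralZl //; last exact: (integrable_indic mOm mol_int).
rewrite integral_indicr /G mulrAC [RHS]EFinM /Rintegral fineK //.
exact: (integrable_fin_num _ mol_int).
Qed.

Lemma mollified_swap_integrable :
  (@lebesgue_measure R).-integrable `[0, 1] (EFin \o G).
Proof.
apply/integrable_indicr; first exact: measurable_itv.
have iG : (@lebesgue_measure R).-integrable setT (fubini_G leb2 (EFin \o F)).
  apply/integrableP; split; first exact: (measurable_fubini_G iF).
  apply: le_lt_trans ((integrable21ltyP _ _ mF).1 iF).
  apply: ge0_le_integral => //.
  - by apply: measurableT_comp => //; exact: (measurable_fubini_G iF).
  - apply: (measurable_fun_fubini_tonelli_G (abse \o (EFin \o F))) => //.
      exact: measurableT_comp.
    by move=> p; exact: abse_ge0.
  - move=> t _; apply: le_abse_integral => //.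
    by apply: (@measurableT_comp _ _ _ _ _ _ (EFin \o F) _ (fun z => (z, t))).
by move: iG; apply: eq_integrable => // t _; rewrite /fubini_G Ft.
Qed.

Lemma mollified_swap :
  Rintegral leb2 Om (fun z => f z * int01 (fun t => mollifier a e (z - c t) * k t))
  = int01 G.
Proof.
rewrite /Rintegral /int01 /Rintegral; congr fine.
rewrite -[LHS]integral_indicr -[RHS]integral_indicr.
transitivity (\int[leb2]_z \int[@lebesgue_measure R]_t ((EFin \o F) (z, t)))%E.
  by apply: eq_integral => z _; rewrite /comp Fz.
by rewrite (Fubini iF); apply: eq_integral => t _; rewrite /comp Ft.
Qed.

End Swap.

End Mollified_line_integral.

Section Mollified_limit.
Context {R : realType}.
Variables (A a : R -> R) (Aa : step_pair A a).

Lemma mollifier_integrable (e : R) (Om : set (plane R)) (z0 : plane R) : 0 < e ->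
  measurable (Om : set (mplane R)) ->
  leb2.-integrable (Om : set (mplane R)) (fun z => (mollifier a e (z - z0))%:E).
Proof.
move=> e0 mOm; apply: (@integrableS _ _ _ _ setT) => //; apply/integrableP; split.
  apply/measurable_EFinP; apply: (mollifier_measurable Aa).
  by apply: sub_plane_measurable; [exact: measurable_id|exact: measurable_cst].
rewrite (_ : (fun _ => _) = (fun z : mplane R => (mollifier a e (z - z0))%:E)).
  by rewrite (mollifier_integral Aa) // ltry.
by apply/funext => z; rewrite gee0_abs // lee_fin (mollifier_ge0 Aa).
Qed.

Lemma mollifier_Rintegral (e : R) (Om : set (plane R)) (z0 : plane R) : 0 < e ->
  (forall z, `|z - z0| < e -> Om z) ->
  Rintegral leb2 Om (fun z => mollifier a e (z - z0)) = 1.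
Proof.
move=> e0 zOm; rewrite /Rintegral.
suff -> : (\int[leb2]_(z in Om) (mollifier a e (z - z0))%:E = 1)%E by [].
rewrite -(mollifier_integral Aa z0 e0) [LHS]integral_mkcond.
apply: eq_integral => z _; rewrite patchE; case: ifPn => // zO.
rewrite (mollifier_out Aa) // leNgt; apply/negP => /zOm zO'.
by move/negP: zO; apply; rewrite inE.
Qed.

Variables (Om : set (plane R)) (f : plane R -> R) (c : R -> plane R) (k : R -> R).
Hypotheses (oOm : open Om) (cf : forall z, Om z -> {for z, continuous f}).
Hypothesis If : leb2.-integrable (Om : set (mplane R)) (EFin \o f).
Hypotheses (cc : continuous c) (ck : continuous k) (cOm : forall t, Om (c t)).

Let mOm : measurable (Om : set (mplane R)). Proof. exact: open_plane_measurable. Qed.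

(** The kernel is nonnegative, has integral 1 and vanishes at sup distance at least [e]: the
    integral is an average of [f] over a ball on which [f] varies by at most [d]. *)
Lemma mollified_value (e d : R) (z0 : plane R) : 0 < e ->
  (forall z, `|z - z0| < e -> Om z /\ `|f z - f z0| <= d) ->
  `|Rintegral leb2 Om (fun z => f z * mollifier a e (z - z0)) - f z0| <= d.
Proof.
move=> e0 zf.
have zOm z : `|z - z0| < e -> Om z by case/zf.
have d0 : 0 <= d.
  by have := zf z0; rewrite !subrr !normr0 => /(_ e0)[].
have I1 := mollifier_mul_integrable Aa mOm If e0 z0.
have I2 := mollifier_integrable z0 e0 mOm.
have IZ r := integrable_scaler r mOm I2.
have IB := integrable_subr mOm I1 (IZ (f z0)).
have {1}-> : f z0 = Rintegral leb2 Om (fun z => f z0 * mollifier a e (z - z0)).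
  by rewrite RintegralZl // mollifier_Rintegral // mulr1.
rewrite -(RintegralB mOm I1 (IZ (f z0))).
apply: (le_trans (le_normr_Rintegral mOm IB)).
have {1}-> : d = Rintegral leb2 Om (fun z => d * mollifier a e (z - z0)).
  by rewrite RintegralZl // mollifier_Rintegral // mulr1.
apply: (le_Rintegral mOm (integrable_norm IB) (IZ d)).
move=> z _ /=; rewrite -mulrBl normrM [`|mollifier _ _ _|]ger0_norm ?(mollifier_ge0 Aa) //.
have [ze|ze] := ltP `|z - z0| e; last by rewrite (mollifier_out Aa) // !mulr0.
by rewrite ler_wpM2r ?(mollifier_ge0 Aa) //; case: (zf z ze).
Qed.

(** Continuity is available at the points of [Om] only; compactness of the segment turns it into one
    radius that serves the whole curve. *)
Lemma near_curve (d : R) : 0 < d -> exists2 r : R, 0 < r &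
  forall t, 0 <= t <= 1 -> forall z, `|z - c t| < r -> Om z /\ `|f z - f (c t)| < d.
Proof.
move=> d0.
have /nbhs_ballP[r /= r0 Hr] : nbhs (0 : plane R) [set q : plane R | forall t, 0 <= t <= 1 ->
    Om (q + c t) /\ `|f (q + c t) - f (c t)| < d].
  have cs t : p.1 + c p.2 @[p --> ((0 : plane R), t)] --> c t.
    rewrite -[X in _ --> X]add0r; apply: cvgD; first exact: cvg_fst.
    by apply: (@cvg_comp _ _ _ snd c _ (nbhs t)); [exact: cvg_snd|exact: cc].
  have n1 : \forall q \near (0 : plane R), forall t, 0 <= t <= 1 -> Om (q + c t).
    apply: (@tube_near R (plane R) (fun q t => Om (q + c t)) 0) => t _.
    by apply: (cs t); apply: open_nbhs_nbhs; split.
  have n2 : \forall q \near (0 : plane R), forall t, 0 <= t <= 1 ->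
      `|f (q + c t) - f (0 + c t)| < d.
    apply: (@tube R (plane R) (fun q t => f (q + c t)) 0 d _ d0) => t _; rewrite add0r.
    apply: (@cvg_comp _ _ _ (fun p : plane R * R => p.1 + c p.2) f _ (nbhs (c t))).
      exact: cs.
    exact: cf.
  by apply: filterS2 n1 n2 => q h1 h2 t t01; have := h2 t t01; rewrite add0r; split; auto.
exists r => // t t01 z zr.
have zb : ball (0 : plane R) r (z - c t).
  move: zr; rewrite prod_normE gt_max => /andP[z1 z2].
  by split; rewrite -ball_normE /= sub0r normrN.
by have := Hr _ zb t t01; rewrite subrK.
Qed.

(** Once the integrals are exchanged, the integrand at time [t] is [k t] times an average of [f]
    near [c t]. [near_curve] makes the error uniform in [t], and the tolerance [d / N] offsets the
    bound [N] on [k]. *)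
Lemma mollified_limit (d : R) : 0 < d -> exists2 r : R, 0 < r & forall e, 0 < e < r ->
  `|Rintegral leb2 Om (fun z => f z * int01 (fun t => mollifier a e (z - c t) * k t))
    - int01 (fun t => f (c t) * k t)| <= d.
Proof.
move=> d0; have [N N0 kN] := continuous01_bounded ck.
have [r r0 Hr] := near_curve (divr_gt0 d0 N0).
exists r => // e /andP[e0 er].
rewrite (mollified_swap Aa) //.
have cfc : continuous (fun t => f (c t) * k t).
  move=> t; apply: cvgM; last exact: ck.
  by apply: (@continuous_comp _ _ _ c f); [exact: cc|exact/cf].
have I1 := mollified_swap_integrable Aa mOm If cc ck e0.
have I2 := int01_integrable cfc.
have mI : measurable (`[0, 1] : set (measurableTypeR R)) by exact: measurable_itv.
rewrite /int01 -(RintegralB mI I1 I2).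
have IB := integrable_subr mI I1 I2.
apply: (le_trans (le_normr_Rintegral mI IB)).
have -> : d = int01 (cst d).
  rewrite /int01 Rintegral_cst //= lebesgue_measure_itv /= lte_fin ltr01.
  by rewrite -EFinB subr0 mulr1.
have Id : (@lebesgue_measure R).-integrable `[0, 1] (EFin \o cst d).
  by apply: (int01_integrable (f := cst d)) => t; exact: cst_continuous.
apply: (le_Rintegral mI (integrable_norm IB) Id).
move=> t; rewrite /= in_itv /= => t01.
rewrite [f (c t) * _]mulrC -mulrBr normrM.
have H : `|Rintegral leb2 Om (fun z => f z * mollifier a e (z - c t)) - f (c t)| <= d / N.
  apply: (mollified_value e0) => z ze.
  by have [Oz /ltW fz] := Hr t t01 z (lt_trans ze er).
rewrite [leRHS](_ : d = N * (d / N)); last by rewrite mulrC divfK // gt_eqF.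
by apply: ler_pM => //; exact: kN.
Qed.

End Mollified_limit.

(** * Square-integrable forms and test functions *)

Section Forms.
Context {R : realType}.
Implicit Types (Om : set (plane R)) (w g : plane R -> plane R).

Definition sq_form w (z : plane R) : R := (w z).1 ^+ 2 + (w z).2 ^+ 2.

Definition L2_form Om w :=
  [/\ measurable_fun (Om : set (mplane R)) (fun z => (w z).1),
      measurable_fun (Om : set (mplane R)) (fun z => (w z).2) &
      leb2.-integrable (Om : set (mplane R)) (EFin \o sq_form w)].

Lemma sq_form_ge0 w z : 0 <= sq_form w z.
Proof. by rewrite addr_ge0 // sqr_ge0. Qed.

Lemma closed_L2_formW Om w : closed_L2_form Om w -> L2_form Om w.
Proof.
move=> [m1 m2 fin _]; split=> //; apply/integrableP; split.
  by apply/measurable_EFinP; apply: measurable_funD; apply: measurable_funX.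
rewrite (_ : (fun _ => _) = (fun z : mplane R => (sq_form w z)%:E)) //.
by apply/funext => z; rewrite gee0_abs // lee_fin sq_form_ge0.
Qed.

Lemma fine_sqnorm Om w : fine (sqnorm_integral Om w) = Rintegral leb2 Om (sq_form w).
Proof. by []. Qed.

Variable Om : set (plane R).
Hypothesis mOm : measurable (Om : set (mplane R)).

Lemma L2_form_sub w g : L2_form Om w -> L2_form Om g -> L2_form Om (fun z => w z - g z).
Proof.
move=> [w1 w2 wI] [g1 g2 gI].
have m1 : measurable_fun (Om : set (mplane R)) (fun z => (w z).1 - (g z).1).
  exact: measurable_funB.
have m2 : measurable_fun (Om : set (mplane R)) (fun z => (w z).2 - (g z).2).
  exact: measurable_funB.
split=> //.
have iS : leb2.-integrable (Om : set (mplane R))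
    (EFin \o (fun z => 2 * sq_form w z - (-2) * sq_form g z)).
  by apply: integrable_subr => //; exact: integrable_scaler.
apply: (le_integrable mOm _ _ iS).
  by apply/measurable_EFinP; apply: measurable_funD; apply: measurable_funX.
move=> z _ /=; rewrite lee_fin ger0_norm ?sq_form_ge0 //.
apply: le_trans (ler_norm _); rewrite /sq_form /=.
rewrite -subr_ge0 (_ : _ - _ = ((w z).1 + (g z).1) ^+ 2 + ((w z).2 + (g z).2) ^+ 2);
  last by ring.
by rewrite addr_ge0 // sqr_ge0.
Qed.

Definition wedge w g (z : plane R) : R := (w z).1 * (g z).2 - (w z).2 * (g z).1.

(** A weighted substitute for the Cauchy-Schwarz inequality: the weight [s] is chosen anew at each
    use, and no square root appears. *)
Lemma wedge_AMGM w g z (s : R) : 0 < s ->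
  `|wedge w g z| <= 2^-1 * (s * sq_form w z + s^-1 * sq_form g z).
Proof.
move=> s0; rewrite /wedge /sq_form.
move: (w z).1 (w z).2 (g z).1 (g z).2 => a b x y.
pose q := s^-1; have qs : q * s = 1 by rewrite mulVf // gt_eqF.
have q0 : 0 < q by rewrite invr_gt0.
have key (u v : R) : u * v * 2 <= s * u ^+ 2 + q * v ^+ 2.
  have : 0 <= q * (s * u - v) ^+ 2 by rewrite mulr_ge0 ?sqr_ge0 // ltW.
  rewrite (_ : q * (s * u - v) ^+ 2 =
    (q * s) * s * u ^+ 2 - 2 * (q * s) * (u * v) + q * v ^+ 2); last by ring.
  rewrite qs; lra.
have := key a y; have := key b x; have := key a (- y); have := key b (- x).
rewrite -/q ler_norml => h1 h2 h3 h4; apply/andP; split; lra.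
Qed.

Lemma wedge_integrable w g : L2_form Om w -> L2_form Om g ->
  leb2.-integrable (Om : set (mplane R)) (EFin \o wedge w g).
Proof.
move=> [w1 w2 wI] [g1 g2 gI].
have iS : leb2.-integrable (Om : set (mplane R))
    (EFin \o (fun z => 1 * sq_form w z - (-1) * sq_form g z)).
  by apply: integrable_subr => //; exact: integrable_scaler.
apply: (le_integrable mOm _ _ iS).
  apply/measurable_EFinP; apply: measurable_funB; exact: measurable_funM.
move=> z _ /=; have := wedge_AMGM w g z ltr01.
rewrite lee_fin invr1 !mul1r mulN1r opprK => H.
have ge0 := addr_ge0 (sq_form_ge0 w z) (sq_form_ge0 g z).
rewrite [leRHS]ger0_norm //; apply: le_trans H _.
by move: ge0; move: (_ + _) => x x0; lra.
Qed.

Lemma wedge_bound w g (s : R) : L2_form Om w -> L2_form Om g -> 0 < s ->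
  `|Rintegral leb2 Om (wedge w g)| <=
    2^-1 * (s * Rintegral leb2 Om (sq_form w) + s^-1 * Rintegral leb2 Om (sq_form g)).
Proof.
move=> wL gL s0; have I1 := wedge_integrable wL gL.
apply: (le_trans (le_normr_Rintegral mOm I1)).
have [_ _ wI] := wL; have [_ _ gI] := gL.
have wI' := integrable_scaler s mOm wI.
have gI' := integrable_scaler s^-1 mOm gI.
have iS := integrable_addr mOm wI' gI'.
rewrite -!RintegralZl // -RintegralD // -RintegralZl //.
apply: (le_Rintegral mOm (integrable_norm I1) (integrable_scaler _ mOm iS)).
by move=> z _; exact: wedge_AMGM.
Qed.

Lemma L2_form_integrable w : (leb2 Om < +oo)%E -> L2_form Om w ->
  leb2.-integrable (Om : set (mplane R)) (EFin \o (fun z => (w z).1)) /\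
  leb2.-integrable (Om : set (mplane R)) (EFin \o (fun z => (w z).2)).
Proof.
move=> fin [w1 w2 wI].
have I1 : leb2.-integrable (Om : set (mplane R)) (EFin \o cst 1).
  apply/integrableP; split; first by apply/measurable_EFinP; exact: measurable_cst.
  by rewrite /= normr1 integral_cst // mul1e.
have iS := integrable_addr mOm I1 wI.
have b (x y : R) : `|x| <= 1 + (x ^+ 2 + y ^+ 2).
  by rewrite ler_norml; apply/andP; split; nra.
split; apply: (le_integrable mOm _ _ iS).
- exact/measurable_EFinP.
- move=> z _ /=; rewrite lee_fin [leRHS]ger0_norm ?(addr_ge0 ler01 (sq_form_ge0 _ _)) //; exact: b.
- exact/measurable_EFinP.
- move=> z _ /=; rewrite lee_fin [leRHS]ger0_norm ?(addr_ge0 ler01 (sq_form_ge0 _ _)) //.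
  by rewrite /sq_form [_ ^+ 2 + _]addrC; exact: b.
Qed.

Definition grad (phi : plane R -> R) : plane R -> plane R :=
  fun z => ('D_((1, 0) : plane R) phi z, 'D_((0, 1) : plane R) phi z).

Lemma closed_wedge w phi : closed_L2_form Om w -> test_function Om phi ->
  Rintegral leb2 Om (wedge w (grad phi)) = 0.
Proof. by move=> [_ _ _ cl] /cl H; rewrite /Rintegral (_ : integral _ _ _ = 0%E). Qed.

End Forms.

Section Test_functions.
Context {R : realType}.

(** The compact set is the closure of the set where [phi] is nonzero. Vanishing near every point
    outside [Om], and not merely at it, is what keeps this closure within [Om]. *)
Lemma test_functionP (Om : set (plane R)) (phi : plane R -> R) (M : R) :
  smooth_alg phi -> (forall z, phi z != 0 -> `|z| <= M) ->
  (forall p, ~ Om p -> \forall z \near p, phi z = 0) -> test_function Om phi.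
Proof.
move=> sphi bphi nphi; split; first exact: smooth_alg_smooth_on.
exists (closure [set z | phi z != 0]); split.
- apply: (@subclosed_compact _ _ (`[- M, M] `*` `[- M, M])).
  + exact: closed_closure.
  + by apply: compact_setX; exact: segment_compact.
  + have cl : closed (`[- M, M] `*` `[- M, M] : set (plane R)).
      apply: compact_closed; first exact: norm_hausdorff.
      by apply: compact_setX; exact: segment_compact.
    rewrite closureE => z; apply; split=> // y /= /bphi.
    rewrite prod_normE ge_max !ler_norml => /andP[y1 y2].
    by split; rewrite /= in_itv.
- move=> z cz; apply: contrapT => /nphi nz.
  by have [y [/= /eqP y0 /y0]] := cz _ nz.
- move=> z Kz; apply/eqP/negPn/negP => z0; apply: Kz.
  exact: subset_closure.
Qed.

Lemma grad_continuous (phi : plane R -> R) : smooth_alg phi ->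
  continuous (fun z => (grad phi z).1) /\ continuous (fun z => (grad phi z).2).
Proof.
move=> sphi; split; apply: smooth_alg_continuous.
  exact: (smooth_algE ((1, 0) : plane R) sphi).1.
exact: (smooth_algE ((0, 1) : plane R) sphi).1.
Qed.

Lemma gradB (phi psi : plane R -> R) z : smooth_alg phi -> smooth_alg psi ->
  grad (fun z => phi z - psi z) z = grad phi z - grad psi z.
Proof.
move=> sp ss; rewrite /grad; congr pair.
  have [_ D1] := smooth_algE ((1, 0) : plane R) sp.
  have [_ D2] := smooth_algE ((1, 0) : plane R) ss.
  exact: (@derive_val _ _ _ _ _ _ _ (is_deriveB (D1 z) (D2 z))).
have [_ D1] := smooth_algE ((0, 1) : plane R) sp.
have [_ D2] := smooth_algE ((0, 1) : plane R) ss.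
exact: (@derive_val _ _ _ _ _ _ _ (is_deriveB (D1 z) (D2 z))).
Qed.

Lemma smooth_algB (phi psi : plane R -> R) : smooth_alg phi -> smooth_alg psi ->
  smooth_alg (fun z => phi z - psi z).
Proof.
move=> sp ss; rewrite (_ : (fun _ => _) = (fun z => phi z + (-1) * psi z)).
  by do ?constructor.
by apply/funext => z; rewrite mulN1r.
Qed.

End Test_functions.

Section Square.
Context {R : realType}.

Definition square : set (plane R) := `[-1, 1] `*` `[-1, 1].

Lemma square_compact : compact square.
Proof. by apply: compact_setX; exact: segment_compact. Qed.

Lemma square_measurable : measurable (square : set (mplane R)).
Proof. by apply: measurableX; exact: measurable_itv. Qed.

Lemma square_finite : (leb2 square < +oo)%E.
Proof.
rewrite leb2X; [|exact: measurable_itv|exact: measurable_itv].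
have lt11 : (-1 : R) < 1 by lra.
by rewrite !lebesgue_measure_itv /= lte_fin lt11 -EFinD -EFinM ltry.
Qed.

Lemma disk_square (Om : set (plane R)) :
  (forall z, Om z -> z.1 ^+ 2 + z.2 ^+ 2 < 1) -> Om `<=` square.
Proof.
move=> D z /D H; have := sqr_ge0 z.1; have := sqr_ge0 z.2 => h1 h2.
by split; rewrite /= in_itv /=; apply/andP; split; nra.
Qed.

Lemma continuous_square_integrable (f : plane R -> R) (Om : set (plane R)) :
  continuous f -> measurable (Om : set (mplane R)) -> Om `<=` square ->
  leb2.-integrable (Om : set (mplane R)) (EFin \o f).
Proof.
move=> cf mOm sub.
apply: (integrableS square_measurable mOm sub).
apply: measurable_bounded_integrable; first exact: square_measurable.
- exact: square_finite.
- exact: measurable_funTS (continuous_plane_measurable cf).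
have /compact_bounded[M [_ HM]] := continuous_compact
  (continuous_subspaceT (A := square) cf) square_compact.
by exists M; split; rewrite ?num_real // => x Mx z sz; apply: (HM _ Mx); exists z.
Qed.

Lemma grad_L2 (phi : plane R -> R) (Om : set (plane R)) : smooth_alg phi ->
  measurable (Om : set (mplane R)) -> Om `<=` square -> L2_form Om (grad phi).
Proof.
move=> sphi mOm sub; have [c1 c2] := grad_continuous sphi.
split.
- exact: measurable_funTS (continuous_plane_measurable c1).
- exact: measurable_funTS (continuous_plane_measurable c2).
apply: continuous_square_integrable => // z; apply: cvgD.
  apply: (@continuous_comp _ _ _ (fun z => (grad phi z).1) (fun x : R => x ^+ 2)).
    exact: c1.
  exact: exprn_continuous.
apply: (@continuous_comp _ _ _ (fun z => (grad phi z).2) (fun x : R => x ^+ 2)).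
  exact: c2.
exact: exprn_continuous.
Qed.

End Square.

(** * Periods as pairings with the gradient of a smoothed winding number *)

Section Loops.
Context {R : realType}.

Lemma smooth_curve_loop (c : R -> plane R) : smooth_closed_curve c -> C1_loop c (derive1 c).
Proof.
move=> [sc per].
have D0 t : derivable c t 1 by have := sc 0%N t; rewrite derive1n0.
have D1 t : derivable (derive1 c) t 1 by have := sc 1%N t; rewrite derive1n1.
have Dc t : (fun h : R => h^-1 *: ((c \o shift t) (h *: (1 : R)) - c t)) @ 0^' --> derive1 c t.
  by rewrite derive1E; exact: D0.
split; last exact: per.
- by move=> t; apply: differentiable_continuous; apply/derivable1_diffP; exact: D0.
- by move=> t; apply: differentiable_continuous; apply/derivable1_diffP; exact: D1.
- move=> t; have H : (fun h : R => h^-1 *: (((fun s => (c s).1) \o shift t) (h *: (1 : R))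
      - (c t).1)) @ 0^' --> (derive1 c t).1.
    apply: (@cvg_comp _ _ _
      (fun h : R => h^-1 *: ((c \o shift t) (h *: (1 : R)) - c t)) fst _ (nbhs (derive1 c t))).
      exact: Dc.
    exact: cvg_fst.
  apply: DeriveDef; first by apply/cvg_ex; exists (derive1 c t).1.
  exact: cvg_lim H.
- move=> t; have H : (fun h : R => h^-1 *: (((fun s => (c s).2) \o shift t) (h *: (1 : R))
      - (c t).2)) @ 0^' --> (derive1 c t).2.
    apply: (@cvg_comp _ _ _
      (fun h : R => h^-1 *: ((c \o shift t) (h *: (1 : R)) - c t)) snd _ (nbhs (derive1 c t))).
      exact: Dc.
    exact: cvg_snd.
  apply: DeriveDef; first by apply/cvg_ex; exists (derive1 c t).2.
  exact: cvg_lim H.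
Qed.

Lemma loop_param (c dc : R -> plane R) t : C1_loop c dc ->
  exists2 t', 0 <= t' <= 1 & c t = c t'.
Proof.
move=> cdc; have per n s : c (s + n%:R) = c s.
  by elim: n s => [|n IH] s; rewrite ?addr0 // -natr1 addrA (loop_periodic cdc).
have perz (m : int) s : c (s + m%:~R) = c s.
  case: m => n; first exact: per.
  by rewrite NegzE mulrNz -[in RHS](subrK n.+1%:R s) per.
exists (t - (Num.floor t)%:~R); last by rewrite -mulrNz perz.
have := floor_le t; have := floorD1_gt t; rewrite intrD => h1 h2.
by apply/andP; split; lra.
Qed.

End Loops.

Section Pairing.
Context {R : realType}.
Variables (A a : R -> R) (Aa : step_pair A a).
Variables (Om : set (plane R)) (c dc : R -> plane R).
Hypotheses (oOm : open Om) (Om1 : forall z, Om z -> z.1 ^+ 2 + z.2 ^+ 2 < 1).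
Hypotheses (cdc : C1_loop c dc) (cOm : forall t, Om (c t)).

Let mOm : measurable (Om : set (mplane R)). Proof. exact: open_plane_measurable. Qed.

Let Osq : Om `<=` square. Proof. exact: disk_square. Qed.

Let Ofin : (leb2 Om < +oo)%E.
Proof.
apply: le_lt_trans square_finite; apply: le_measure; rewrite ?inE //.
exact: square_measurable.
Qed.

Lemma loop_margin : exists2 r : R, 0 < r & forall t z, `|z - c t| < r -> Om z.
Proof.
have If : leb2.-integrable (Om : set (mplane R)) (EFin \o (fun=> (0 : R))).
  by apply: continuous_square_integrable => // z; exact: cvg_cst.
have [r r0 Hr] := @near_curve R Om (fun=> 0) c oOm
  (fun z _ => cvg_cst _) (loop_continuous cdc) cOm 1 ltr01.
exists r => // t z; have [t' t01 ->] := loop_param t cdc.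
by move=> /(Hr _ t01)[].
Qed.

Variable r0 : R.
Hypothesis margin : forall t z, `|z - c t| < r0 -> Om z.

Let psi e := soft_winding A a c dc e.

Let far p : ~ Om p -> forall t, r0 <= `|p - c t|.
Proof. by move=> pO t; rewrite leNgt; apply/negP => /margin. Qed.

Lemma soft_winding_near e p : 0 < e < r0 -> ~ Om p ->
  \forall z \near p, psi e z = psi e p.
Proof.
move=> /andP[e0 er] pO; have er0 : 0 < r0 - e by rewrite subr_gt0.
have near_p : \forall z \near p, `|z - p| < r0 - e.
  apply/nbhs_ballP; exists (r0 - e) => //= z [z1 z2].
  move: z1 z2; rewrite -!ball_normE /= => z1 z2.
  by rewrite prod_normE gt_max /= distrC z1 /= distrC.
apply: filterS near_p => z /ltW zp.
apply: (soft_winding_const Aa cdc e0 _ zp) => t.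
by rewrite addrC subrK; exact: far.
Qed.

(** By [soft_winding_far] both sides are minus the winding number of [c] around [p], an expression
    without the scale. *)
Lemma soft_winding_scale e e' p : 0 < e < r0 -> 0 < e' < r0 -> ~ Om p -> psi e p = psi e' p.
Proof.
move=> /andP[e0 er] /andP[e0' er'] pO.
rewrite /psi (soft_winding_far Aa cdc e0) ?(soft_winding_far Aa cdc e0') // => t;
  by rewrite distrC; apply: le_trans (far pO t); exact: ltW.
Qed.

Lemma soft_winding_out e p : 0 < e < r0 -> 1 <= p.1 ^+ 2 + p.2 ^+ 2 -> psi e p = 0.
Proof.
move=> /andP[e0 er] p1; apply: (soft_winding_outside Aa cdc e0) => // z [t zt].
by apply: Om1; apply: (margin (t := t)); exact: lt_trans er.
Qed.

Lemma soft_winding_support e z : 0 < e < r0 -> psi e z != 0 -> `|z| <= 1.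
Proof.
move=> er; apply: contraNT => z1; rewrite soft_winding_out //.
rewrite leNgt; apply: contraNN z1 => z1.
have [] : square z; last by rewrite prod_normE ge_max !ler_norml /= !in_itv /= => -> ->.
by apply: (@disk_square _ [set z | z.1 ^+ 2 + z.2 ^+ 2 < 1]).
Qed.

Lemma soft_winding_test e e' : 0 < e < r0 -> 0 < e' < r0 ->
  test_function Om (fun z => psi e z - psi e' z).
Proof.
move=> er er'; apply: (@test_functionP _ _ _ 1).
- by apply: smooth_algB; exact: soft_winding_alg.
- move=> z; have [->|/soft_winding_support -/(_ er) //] := eqVneq (psi e z) 0.
  by rewrite sub0r oppr_eq0 => /soft_winding_support; exact.
- move=> p pO; apply: filterS2 (soft_winding_near er pO) (soft_winding_near er' pO).
  by move=> z -> ->; rewrite (soft_winding_scale er er' pO) subrr.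
Qed.

Definition line (v : plane R -> plane R) :=
  int01 (fun t => (v (c t)).1 * (dc t).1 + (v (c t)).2 * (dc t).2).

(** The potentials at two scales differ by a test function, so the pairing of a closed form does not
    depend on the scale. As the scale tends to 0 the gradient concentrates on the loop and the
    pairing tends to minus the line integral. The limit is thus an equality at each admissible
    scale. *)
Lemma pairing_line v e : closed_L2_form Om v ->
  (forall z, Om z -> {for z, continuous (fun z => (v z).1)}) ->
  (forall z, Om z -> {for z, continuous (fun z => (v z).2)}) -> 0 < e < r0 ->
  Rintegral leb2 Om (wedge v (grad (psi e))) = - line v.
Proof.
move=> cl c1 c2 er; have vL := closed_L2_formW cl.
have sw e' : smooth_alg (psi e') by exact: soft_winding_alg.
have gL e' : L2_form Om (grad (psi e')) by exact: grad_L2.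
have const e' : 0 < e' < r0 -> Rintegral leb2 Om (wedge v (grad (psi e'))) =
    Rintegral leb2 Om (wedge v (grad (psi e))).
  move=> er'; apply/eqP; rewrite -subr_eq0.
  have I1 := wedge_integrable mOm vL (gL e'); have I2 := wedge_integrable mOm vL (gL e).
  rewrite -(RintegralB mOm I1 I2); apply/eqP.
  rewrite -(closed_wedge cl (soft_winding_test er' er)).
  apply: eq_Rintegral => z _; rewrite /wedge (gradB z (sw e') (sw e)).
  by case: (v z) (grad (psi e') z) (grad (psi e) z) => [v1 v2] [x1 x2] [y1 y2] /=; ring.
have [I1 I2] := L2_form_integrable mOm Ofin vL.
have k1 := dc1_continuous cdc; have k2 := dc2_continuous cdc.
have cc := loop_continuous cdc.
apply/eqP; rewrite -subr_eq0 -normr_le0; apply/ler_addgt0Pl => d d0.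
rewrite addr0; have d20 : 0 < d / 2 by rewrite divr_gt0.
have [r1 r10 H1] := mollified_limit Aa oOm c1 I1 cc k1 cOm d20.
have [r2 r20 H2] := mollified_limit Aa oOm c2 I2 cc k2 cOm d20.
pose e' := Num.min e (Num.min r1 r2) / 2.
have m0 : 0 < Num.min e (Num.min r1 r2) by rewrite !lt_min r10 r20; case/andP: er => ->.
have m2 : Num.min e (Num.min r1 r2) / 2 < Num.min e (Num.min r1 r2).
  by rewrite ltr_pdivrMr // ltr_pMr // ltr1n.
have e'0 : 0 < e' by rewrite divr_gt0.
move: (m2); rewrite -/e' !lt_min => /andP[e'e /andP[e'1 e'2]].
have er' : 0 < e' < r0 by rewrite e'0; apply: lt_trans e'e _; case/andP: er.
rewrite -(const e' er').
have {}H1 := H1 e' (introT andP (conj e'0 e'1)).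
have {}H2 := H2 e' (introT andP (conj e'0 e'2)).
have J1 := mollified_integrable Aa mOm I1 cc k1 e'0.
have J2 := mollified_integrable Aa mOm I2 cc k2 e'0.
have -> : Rintegral leb2 Om (wedge v (grad (psi e'))) =
    - (Rintegral leb2 Om (fun z => (v z).1 * int01 (fun t => mollifier a e' (z - c t) * (dc t).1))
     + Rintegral leb2 Om (fun z => (v z).2 * int01 (fun t => mollifier a e' (z - c t) * (dc t).2))).
  rewrite -(RintegralD mOm J1 J2) -mulN1r -RintegralZl //; last exact: integrable_addr.
  apply: eq_Rintegral => z _; rewrite /wedge /grad /=.
  have D1 := soft_winding_d1 Aa cdc e' z; have D2 := soft_winding_d2 Aa cdc e' z.
  by rewrite (@derive_val _ _ _ _ _ _ _ D1) (@derive_val _ _ _ _ _ _ _ D2); ring.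
have C1 : continuous (fun t => (v (c t)).1 * (dc t).1).
  move=> t; apply: cvgM; last exact: k1.
  by apply: (@continuous_comp _ _ _ c (fun z => (v z).1)); [exact: cc|exact: c1].
have C2 : continuous (fun t => (v (c t)).2 * (dc t).2).
  move=> t; apply: cvgM; last exact: k2.
  by apply: (@continuous_comp _ _ _ c (fun z => (v z).2)); [exact: cc|exact: c2].
have -> : line v = int01 (fun t => (v (c t)).1 * (dc t).1) +
    int01 (fun t => (v (c t)).2 * (dc t).2).
  rewrite /line /int01 RintegralD //; exact: int01_integrable.
set x1 := Rintegral _ _ _ in H1 *; set x2 := Rintegral _ _ _ in H2 *.
set y1 := int01 _ in H1 *; set y2 := int01 _ in H2 *.
rewrite (_ : _ - _ = - ((x1 - y1) + (x2 - y2))); last by ring.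
rewrite normrN; apply: le_trans (ler_normD _ _) _; move: H1 H2; lra.
Qed.

(** For a fixed potential the pairing is continuous in the [L^2] norm, so the identity known for the
    smooth approximations [u n] survives in the limit. *)
Lemma pairing_period w p e : closed_L2_form Om w -> 0 < e < r0 ->
  dc = derive1 c -> is_period Om c w p ->
  Rintegral leb2 Om (wedge w (grad (psi e))) = - p.
Proof.
move=> cl er dcE [u [su un up]].
have wL := closed_L2_formW cl.
have sw : smooth_alg (psi e) by exact: soft_winding_alg.
have gL : L2_form Om (grad (psi e)) by exact: grad_L2.
have uL n : L2_form Om (u n) by apply: closed_L2_formW; case: (su n).
have lu n : Rintegral leb2 Om (wedge (u n) (grad (psi e))) = - line_integral c (u n).
  have [cu s1 s2] := su n.
  rewrite pairing_line //.
  - by rewrite /line dcE.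
  - by move=> z Oz; have [] := s1 [::] z Oz.
  - by move=> z Oz; have [] := s2 [::] z Oz.
pose G := Rintegral leb2 Om (sq_form (grad (psi e))).
pose E n := Rintegral leb2 Om (sq_form (fun z => u n z - w z)).
have E0 n : 0 <= E n by apply: Rintegral_ge0 => z _; exact: sq_form_ge0.
have G0 : 0 <= G by apply: Rintegral_ge0 => z _; exact: sq_form_ge0.
have En : E n @[n --> \oo] --> (0 : R).
  have : form_norm Om (fun z => u n z - w z) * form_norm Om (fun z => u n z - w z)
      @[n --> \oo] --> (0 * 0 : R) by apply: cvgM.
  rewrite mulr0; apply: cvg_trans; apply: near_eq_cvg; apply: nearW => n.
  by rewrite /form_norm -expr2 fine_sqnorm sqr_sqrtr; [|exact: E0].
have diff n s : 0 < s -> `|Rintegral leb2 Om (wedge w (grad (psi e))) + line_integral c (u n)|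
    <= 2^-1 * (s * E n + s^-1 * G).
  move=> s0; have := wedge_bound mOm (L2_form_sub mOm (uL n) wL) gL s0.
  rewrite -/(E n) -/G; congr (_ <= _); rewrite -normrN; congr `|_|.
  have J1 := wedge_integrable mOm (uL n) gL; have J2 := wedge_integrable mOm wL gL.
  transitivity (- (Rintegral leb2 Om (wedge (u n) (grad (psi e))) -
      Rintegral leb2 Om (wedge w (grad (psi e))))).
    congr (- _); rewrite -(RintegralB mOm J1 J2).
    apply: eq_Rintegral => z _; rewrite /wedge.
    by case: (u n z) (w z) (grad (psi e) z) => [v1 v2] [x1 x2] [y1 y2] /=; ring.
  by rewrite lu; ring.
set P := Rintegral _ _ _ in diff *.
apply/eqP; rewrite -subr_eq0 opprK -normr_le0; apply/ler_addgt0Pl => d d0.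
rewrite addr0; have d20 : 0 < d / 2 by rewrite divr_gt0.
(* The weight makes the gradient term at most [d / 2]; only then is [n] chosen, with [E n] small
   compared with [s^-1]. The summand 1 keeps [s] positive when [G] is 0. *)
pose s := (G + 1) / (d / 2).
have s0 : 0 < s by rewrite divr_gt0 // ltr_wpDl.
have sG : s^-1 * G <= d / 2.
  rewrite /s invf_div -mulrA ler_piMr ?(ltW d20) //.
  by rewrite mulrC ler_pdivrMr ?ltr_wpDl // mul1r lerDl.
have ds0 : 0 < d / 2 / s by rewrite divr_gt0.
have nE : \forall n \near \oo, `|E n| < d / 2 / s.
  by have /cvgr0Pnorm_lt := En; apply.
have nl : \forall n \near \oo, `|p - line_integral c (u n)| < d / 2.
  by have /cvgrPdist_lt := up; apply.
have [n [En1 ln1]] : exists n, `|E n| < d / 2 / s /\ `|p - line_integral c (u n)| < d / 2.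
  have [N _ HN] : \forall n \near \oo, `|E n| < d / 2 / s /\
      `|p - line_integral c (u n)| < d / 2.
    by apply: filterS2 nE nl => n; split.
  by exists N; apply: HN => /=.
have h1 := diff n s s0.
have sE : s * E n <= d / 2.
  rewrite mulrC -ler_pdivlMr //; apply: ltW; apply: le_lt_trans En1.
  exact: ler_norm.
rewrite (_ : P + p = (P + line_integral c (u n)) + (p - line_integral c (u n))); last by ring.
by apply: le_trans (ler_normD _ _) _; move: h1 ln1 sG sE; lra.
Qed.

End Pairing.

(* [edist] of the extended-metric library would otherwise shadow the Euclidean one. *)
Notation edist := Defs.edist.

(** * Euclidean and hyperbolic geometry of the disk and of the holes *)

Section Euclidean_geometry.
Context {R : realType}.
Implicit Types (z w p : plane R) (B : set (plane R)).

Lemma normc_triangle (x y : R[i]) : ComplexField.Normc.normc (x + y) <=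
  ComplexField.Normc.normc x + ComplexField.Normc.normc y.
Proof. by rewrite -lecR rmorphD /=; exact: (@ler_normD _ R[i]). Qed.

Lemma edistE z w : edist z w = Num.sqrt ((z.1 - w.1) ^+ 2 + (z.2 - w.2) ^+ 2).
Proof. by []. Qed.

Lemma edist_ge0 z w : 0 <= edist z w.
Proof. by rewrite edistE sqrtr_ge0. Qed.

Lemma edist0E z : edist z 0 = ComplexField.Normc.normc (cpx z).
Proof. by rewrite /Defs.edist (_ : cpx 0 = 0) // subr0. Qed.

Lemma edist_sqr z w : edist z w ^+ 2 = (z.1 - w.1) ^+ 2 + (z.2 - w.2) ^+ 2.
Proof. by rewrite edistE sqr_sqrtr // addr_ge0 // sqr_ge0. Qed.

Lemma edistC z w : edist z w = edist w z.
Proof. by rewrite !edistE -(sqrrN (z.1 - _)) -(sqrrN (z.2 - _)) !opprB. Qed.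

Lemma edistxx z : edist z z = 0.
Proof. by rewrite edistE !subrr expr0n /= addr0 sqrtr0. Qed.

Lemma edist_triangle p z w : edist z w <= edist z p + edist p w.
Proof.
rewrite /edist (_ : cpx z - cpx w = (cpx z - cpx p) + (cpx p - cpx w)).
  exact: normc_triangle.
by rewrite addrA subrK.
Qed.

Lemma diskE z : disk R z <-> z.1 ^+ 2 + z.2 ^+ 2 < 1.
Proof.
rewrite /disk /= /modulus /cpx /=; split=> H.
  rewrite -(sqr_sqrtr (addr_ge0 (sqr_ge0 z.1) (sqr_ge0 z.2))).
  by rewrite expr_lt1 // sqrtr_ge0.
by rewrite -(sqrtr1 R) ltr_sqrt.
Qed.

Lemma edist0 z : edist z 0 ^+ 2 = z.1 ^+ 2 + z.2 ^+ 2.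
Proof. by rewrite edist_sqr /= !subr0. Qed.

Lemma disk_edist z : disk R z <-> edist z 0 < 1.
Proof. by rewrite diskE -edist0 expr_lt1 // edist_ge0. Qed.

Lemma edist_le (z w : plane R) (r : R) : 0 <= r ->
  (edist z w <= r) = ((z.1 - w.1) ^+ 2 + (z.2 - w.2) ^+ 2 <= r ^+ 2).
Proof. by move=> r0; rewrite -edist_sqr ler_pXn2r // nnegrE ?edist_ge0. Qed.

(** The value at [2^-1] is [ln 3 / 2], and [3 = 1 + 2 < expR 2]. *)
Lemma arctanh_half_lt1 (t : R) : 0 <= t <= 2^-1 -> arctanh t < 1.
Proof.
move=> /andP[t0 t1]; rewrite /arctanh ltr_pdivrMr // mul1r.
have t2 : 0 < 1 - t by lra.
have q0 : 0 < (1 + t) / (1 - t) by rewrite divr_gt0 //; lra.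
rewrite -(expRK 2) ltr_ln ?posrE ?expR_gt0 //.
apply: (@le_lt_trans _ _ 3); first by rewrite ler_pdivrMr //; lra.
by have := @expR_gt1Dx R 2; rewrite (_ : 1 + 2 = 3 :> R); [apply|ring].
Qed.

(** For [z] in the disk the denominator of the pseudohyperbolic distance has modulus at least
    [1 - edist c 0], so this distance is at most one half. *)
Lemma hdisk_edist (c z : plane R) : disk R c ->
  edist z c <= (1 - edist c 0) / 2 -> hdisk c z.
Proof.
move=> /disk_edist c1 zc; have c0 := edist_ge0 c 0.
have z1 : edist z 0 < 1 by have := edist_triangle c z 0; lra.
split; first exact/disk_edist.
rewrite /hdist; apply: arctanh_half_lt1.
rewrite /modulus ComplexField.Normc.normcM ComplexField.Normc.normcV.
set q := ComplexField.Normc.normc (1 - _); set d := ComplexField.Normc.normc _.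
have dE : d = edist z c by [].
have q1 : 1 - edist c 0 <= q.
  have : ComplexField.Normc.normc (1 : R[i]) <=
      q + ComplexField.Normc.normc (cpx z * conjc (cpx c)).
    apply: le_trans (normc_triangle _ _).
    by rewrite subrK.
  rewrite ComplexField.Normc.normc1 ComplexField.Normc.normcM.
  have -> : ComplexField.Normc.normc (conjc (cpx c)) = edist c 0.
    by rewrite edist0E /cpx /= sqrrN.
  rewrite -edist0E.
  move: (edist_ge0 z 0) c0 z1; set x := edist z 0; set y := edist c 0 => x0 y0 x1.
  have : x * y <= 1 * y by rewrite ler_wpM2r // ltW.
  lra.
have q0 : 0 < q by lra.
apply/andP; split; first by rewrite mulr_ge0 ?invr_ge0 ?(ltW q0) // dE edist_ge0.
by rewrite ler_pdivrMr // dE; apply: le_trans zc _; rewrite mulrC ler_pM2l.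
Qed.

Lemma boundary_point (c : plane R) : disk R c ->
  exists2 p, ~ disk R p & edist c p <= 1 - edist c 0.
Proof.
move=> /disk_edist c1; have c0 := edist_ge0 c 0.
have [E|E] := eqVneq (edist c 0) 0.
  exists (1, 0); first by rewrite diskE /= expr1n expr0n /= addr0 ltxx.
  have : c.1 ^+ 2 + c.2 ^+ 2 = 0 by rewrite -edist0 E expr0n.
  move=> /eqP; rewrite paddr_eq0 ?sqr_ge0 // !sqrf_eq0 => /andP[/eqP e1 /eqP e2].
  by rewrite E subr0 edist_le // e1 e2 /= sub0r sqrrN subrr expr0n addr0.
have E0 : 0 < edist c 0 by rewrite lt_neqAle eq_sym E c0.
pose p : plane R := (c.1 / edist c 0, c.2 / edist c 0).
have e2 := edist0 c.
exists p.
  rewrite diskE /= !expr_div_n -mulrDl -e2 divff ?ltxx //.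
  by rewrite expf_neq0.
rewrite edist_le; last by lra.
move: E E0 e2; set r := edist c 0 => E E0 e2.
rewrite /p /= (_ : _ + _ = (c.1 ^+ 2 + c.2 ^+ 2) * (1 - r^-1) ^+ 2); last by ring.
by rewrite -e2 -exprMn mulrBr mulr1 divff // -sqrrN opprB.
Qed.

Lemma edist_near p (r : R) : 0 < r -> \forall z \near p, edist z p < r.
Proof.
move=> r0; have r20 : 0 < r / 2 by rewrite divr_gt0.
apply/nbhs_ballP; exists (r / 2) => //= z [].
rewrite -!ball_normE /= => z1 z2.
have r1 := ltW r0; rewrite -(gtr0_norm r0) -sqrtr_sqr edistE ltr_sqrt ?exprn_gt0 //.
have sq x : `|x| < r / 2 -> x ^+ 2 <= r ^+ 2 / 4.
  move=> xr; rewrite -(real_normK (num_real x)) (_ : r ^+ 2 / 4 = (r / 2) ^+ 2).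
    by rewrite ler_pXn2r ?nnegrE ?(ltW r20) // ltW.
  by field.
have := sq _ z1; have := sq _ z2; rewrite -(sqrrN (p.1 - _)) -(sqrrN (p.2 - _)) !opprB.
have : 0 < r ^+ 2 by rewrite exprn_gt0.
move: (r ^+ 2) => x; lra.
Qed.

Lemma set_dist_le A B z w : A z -> B w -> set_dist A B <= edist z w.
Proof.
move=> Az Bw; apply: ge_inf; last by exists z, w.
by exists 0 => _ [x [y [_ _ ->]]]; exact: edist_ge0.
Qed.

Lemma set_dist_lt A B (r : R) : A !=set0 -> B !=set0 -> set_dist A B < r ->
  exists z w, [/\ A z, B w & edist z w < r].
Proof.
move=> [z0 Az0] [w0 Bw0] dr.
have hi : has_inf [set r | exists z w, [/\ A z, B w & r = edist z w]].
  split; first by exists (edist z0 w0), z0, w0.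
  by exists 0 => _ [x [y [_ _ ->]]]; exact: edist_ge0.
have [|_ [z [w [Az Bw ->]]] zw] := @inf_adherent R _ (r - set_dist A B) _ hi.
  by rewrite subr_gt0.
by exists z, w; split=> //; apply: lt_le_trans zw _; rewrite -/(set_dist A B) addrC subrK.
Qed.

Lemma set_distC A B : set_dist A B = set_dist B A.
Proof.
rewrite /set_dist; congr inf; apply/seteqP; split=> _ [z [w [Az Bw ->]]];
  by exists w, z; split=> //; rewrite edistC.
Qed.

Lemma diam_ge B z w : B `<=` disk R -> B z -> B w -> edist z w <= diam B.
Proof.
move=> BD Bz Bw; apply: ub_le_sup; last by exists z, w.
exists 2 => _ [x [y [/BD /disk_edist x1 /BD /disk_edist y1 ->]]].
by have := edist_triangle 0 x y; rewrite (edistC 0 y); lra.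
Qed.

End Euclidean_geometry.

Section Holes.
Context {R : realType}.
Implicit Types (B : set (plane R)).

Lemma hole_nonempty B : is_hole B -> B !=set0.
Proof. by move=> [_ _ _ _ [G [_ [z Gz] _ _ ->]]]; exists z; exact: subset_closure. Qed.

Lemma hole_diam_gt0 B : is_hole B -> 0 < diam B.
Proof.
move=> [_ BD _ _ [G [oG [z Gz] _ _ BG]]].
have : nbhs z G by exact: open_nbhs_nbhs.
move=> /nbhs_ballP[r /= r0 zG].
have Gw : G (z.1 + r / 2, z.2).
  apply: zG; split; rewrite -ball_normE /=; last by rewrite subrr normr0.
  by rewrite opprD addNKr normrN gtr0_norm ?divr_gt0 // ltr_pdivrMr // ltr_pMr // ltr1n.
apply: lt_le_trans (diam_ge BD (z := z) (w := (z.1 + r / 2, z.2)) _ _); last 2 first.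
- by rewrite BG; exact: subset_closure.
- by rewrite BG; exact: subset_closure.
rewrite edistE /= subrr expr0n addr0 sqrtr_sqr normr_gt0 opprD addNKr oppr_eq0.
by rewrite gt_eqF // divr_gt0.
Qed.

Variables (I : countType) (B : I -> set (plane R)).
Hypothesis rB : regular_holes B.

Lemma hole_closed i : closed (B i).
Proof.
have [/(_ i)[cB _ _ _ _] _ _] := rB.
by apply: compact_closed; first exact: norm_hausdorff.
Qed.

Lemma disk_open : open (disk R).
Proof.
rewrite openE => z /disk_edist z1.
have r0 : 0 < 1 - edist z 0 by rewrite subr_gt0.
apply: filterS (edist_near z r0) => w wz; apply/disk_edist.
by have := edist_triangle z w 0; lra.
Qed.

(** An infinite union of closed holes need not be closed, but only finitely many of them meet a
    compact box around a point of the disk. *)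
Lemma domain_open : open (domain_of B).
Proof.
rewrite openE => z [Dz nz].
have : nbhs z (disk R) by apply: open_nbhs_nbhs; split; [exact: disk_open|].
move=> /nbhs_ballP[r /= r0 zD].
pose K : set (plane R) := `[z.1 - r / 2, z.1 + r / 2] `*` `[z.2 - r / 2, z.2 + r / 2].
have cK : compact K by apply: compact_setX; exact: segment_compact.
have r2 : r / 2 < r by rewrite ltr_pdivrMr // ltr_pMr // ltr1n.
have KD : K `<=` disk R.
  move=> w [] /=; rewrite !in_itv /= => /andP[w1 w2] /andP[w3 w4]; apply: zD.
  by split; rewrite -ball_normE /= ltr_norml; apply/andP; split; lra.
have [_ _ /(_ K cK KD) fK] := rB.
have cU : closed (\bigcup_(i in Defs.meets B K) B i).
  by apply: closed_bigcup => // i _; exact: hole_closed.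
have nU : nbhs z (~` (\bigcup_(i in Defs.meets B K) B i)).
  apply: open_nbhs_nbhs; split; first exact: closed_openC.
  by move=> [i _ Bz]; apply: nz; exists i.
have nK : nbhs z K.
  have r20 : 0 < r / 2 by rewrite divr_gt0.
  apply/nbhs_ballP; exists (r / 2) => //= w [].
  rewrite -!ball_normE /= !ltr_norml => /andP[w1 w2] /andP[w3 w4].
  by split; rewrite /= in_itv /=; apply/andP; split; lra.
have nD : nbhs z (disk R) by apply: open_nbhs_nbhs; split; [exact: disk_open|].
apply: filterS3 nU nK nD => w wU wK wD; split=> // -[i _ Biw]; apply: wU.
by exists i => //; exists w.
Qed.

Lemma domain_disk z : domain_of B z -> z.1 ^+ 2 + z.2 ^+ 2 < 1.
Proof. by move=> [/diskE]. Qed.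

End Holes.

Section Winding_number.
Context {R : realType}.

Lemma soft_winding_winding (A a : R -> R) (c : R -> plane R) (e : R) (p : plane R) :
  step_pair A a -> C1_loop c (derive1 c) -> 0 < e ->
  (forall t, e <= `|c t - p|) -> soft_winding A a c (derive1 c) e p = - winding c p.
Proof.
move=> Aa cdc e0 far; rewrite (soft_winding_far Aa cdc e0 far) /winding.
congr (- (_ / _)); rewrite /line_integral /int01; apply: eq_Rintegral => t _.
by rewrite /angle_form /= edist_sqr.
Qed.

End Winding_number.

(** * Logarithmic cutoffs and their energy *)

Section Cutoff.
Context {R : realType}.
Variables (A a : R -> R) (Aa : step_pair A a).

Lemma step_le1 x : 0 <= A x <= 1.
Proof.
have mono y z : y <= z -> A y <= A z.
  move=> yz; rewrite -subr_ge0.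
  have D (s : R) := is_derive_affine (c := 1) (d := y) (step_derive Aa (1 * s + y)).
  have [s s01] := MVT0 (z - y) D; rewrite !mul1r subrK add0r => ->.
  by rewrite mulr_ge0 ?(bump_ge0 Aa) // subr_ge0.
apply/andP; split.
  rewrite -(step_left Aa (x := Num.min x (-1))) ?ge_min ?lexx ?orbT //.
  by apply: mono; rewrite ge_min lexx.
rewrite -(step_right Aa (x := Num.max x 1)) ?le_max ?lexx ?orbT //.
by apply: mono; rewrite le_max lexx.
Qed.

Variables (M : R) (aM : forall x, a x <= M).
Variables (c : plane R) (d : R) (d0 : 0 < d).

Let Q (z : plane R) : R := (z.1 - c.1) ^+ 2 + (z.2 - c.2) ^+ 2.
(** The squares of the dyadic radii [2 ^+ k * d]. With squared distances the argument of [A] is a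
    polynomial, hence smooth at the centre as well. *)
Let t (k : nat) : R := 4 ^+ k * d ^+ 2.

Let t_gt0 k : 0 < t k. Proof. by rewrite mulr_gt0 ?exprn_gt0. Qed.

Let tS k : t k.+1 = 4 * t k. Proof. by rewrite /t exprS mulrA. Qed.

Let Q_ge0 z : 0 <= Q z. Proof. by rewrite addr_ge0 // sqr_ge0. Qed.

(* The step falls from 1 to 0 as [Q / t k] grows from 3/2 to 7/2. *)
Let step (k : nat) (z : plane R) : R := A (- (t k)^-1 * Q z + 5 / 2).

Let Q_alg : smooth_alg Q.
Proof.
rewrite (_ : Q = fun z => (z.1 + - c.1) * (z.1 + - c.1) + (z.2 + - c.2) * (z.2 + - c.2)).
  by do !constructor.
by apply/funext => z; rewrite /Q !expr2.
Qed.

Let Q_derive z v : is_derive z v Q (2 * (z.1 - c.1) * v.1 + 2 * (z.2 - c.2) * v.2).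
Proof.
have D1 : is_derive z v (fun z : plane R => z.1 - c.1) v.1.
  by have := is_derive_add (fst_derive z v) (is_derive_cst (- c.1) z v); rewrite addr0.
have D2 : is_derive z v (fun z : plane R => z.2 - c.2) v.2.
  by have := is_derive_add (snd_derive z v) (is_derive_cst (- c.2) z v); rewrite addr0.
have QE : Q = (fun z => (z.1 - c.1) * (z.1 - c.1) + (z.2 - c.2) * (z.2 - c.2)).
  by apply/funext => y; rewrite /Q !expr2.
rewrite QE; apply: (is_derive_eq (is_derive_add (is_derive_mul D1 D1) (is_derive_mul D2 D2))).
by ring.
Qed.

Let step_alg k : smooth_alg (step k).
Proof.
have := smooth1_affine (k := 1) (c := - (t k)^-1) (d := 5 / 2) (step_smooth Aa).
move=> /smooth_alg_comp/(_ Q_alg); congr smooth_alg.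
by apply/funext => z; rewrite mul1r.
Qed.

Let ga k z : R := a (- (t k)^-1 * Q z + 5 / 2) * (- (t k)^-1).

Let step_grad k z : grad (step k) z = (ga k z * (2 * (z.1 - c.1)), ga k z * (2 * (z.2 - c.2))).
Proof.
have D v : is_derive z v (step k)
    (ga k z * (2 * (z.1 - c.1) * v.1 + 2 * (z.2 - c.2) * v.2)).
  have DA := is_derive_affine (c := - (t k)^-1) (d := 5 / 2) (step_derive Aa
    (- (t k)^-1 * Q z + 5 / 2)).
  apply: (is_derive_eq (is_derive_compR DA (Q_derive z v))).
  by rewrite /ga; ring.
rewrite /grad (@derive_val _ _ _ _ _ _ _ (D (1, 0))).
rewrite (@derive_val _ _ _ _ _ _ _ (D (0, 1))) /=.
by congr pair; ring.
Qed.

Let ga_in k z : Q z <= 3 / 2 * t k -> ga k z = 0.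
Proof.
move=> H; rewrite /ga (bump_out Aa) ?mul0r //.
apply: le_trans (ler_norm _).
have : (t k)^-1 * Q z <= 3 / 2 by rewrite mulrC ler_pdivrMr.
rewrite mulNr; lra.
Qed.

Let ga_out k z : 7 / 2 * t k <= Q z -> ga k z = 0.
Proof.
move=> H; rewrite /ga (bump_out Aa) ?mul0r //.
rewrite -normrN; apply: le_trans (ler_norm _).
have : 7 / 2 <= (t k)^-1 * Q z by rewrite [leRHS]mulrC ler_pdivlMr.
rewrite mulNr; lra.
Qed.

Let step_sq k z : sq_form (grad (step k)) z = 4 * ga k z ^+ 2 * Q z.
Proof. by rewrite /sq_form step_grad /Q /=; ring. Qed.

Let box k : set (plane R) :=
  `[c.1 - 2 ^+ k.+1 * d, c.1 + 2 ^+ k.+1 * d] `*`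
  `[c.2 - 2 ^+ k.+1 * d, c.2 + 2 ^+ k.+1 * d].

Let box_measurable k : measurable (box k : set (mplane R)).
Proof. by apply: measurableX; exact: measurable_itv. Qed.

Let box_measure k : leb2 (box k) = (16 * t k)%:E.
Proof.
rewrite leb2X; [|exact: measurable_itv|exact: measurable_itv].
have r0 : 0 < 2 ^+ k.+1 * d by rewrite mulr_gt0 ?exprn_gt0.
rewrite !lebesgue_measure_itv /= !lte_fin !ifT; [|lra|lra].
rewrite -!EFinB -EFinM; congr EFin; rewrite /t (_ : 4 = 2 ^+ 2 :> R); last by ring.
by rewrite -exprM mulnC exprM exprS; ring.
Qed.

(** On the support of the gradient [Q] is at most [7 / 2 * t k] and [ga] at most [M / t k] in
    absolute value, so [4 * ga ^+ 2 * Q] is at most [14 * M ^+ 2 / t k]. The box, whose half-side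
    has square [4 * t k], contains this support and has area [16 * t k]. The product [224 * M ^+ 2]
    of the two bounds is free of the scale. *)
Let step_sq_le k z : sq_form (grad (step k)) z <= 14 * M ^+ 2 / t k * \1_(box k) z.
Proof.
rewrite step_sq; have [out|inn] := leP (7 / 2 * t k) (Q z).
  rewrite ga_out // expr0n mulr0 mul0r mulr_ge0 // ?indicE //.
  by rewrite mulr_ge0 ?invr_ge0 ?(ltW (t_gt0 k)) // mulr_ge0 // sqr_ge0.
have zbox : box k z.
  have r0 : 0 <= 2 ^+ k.+1 * d by rewrite mulr_ge0 ?exprn_ge0 // ltW.
  have r2 : (2 ^+ k.+1 * d) ^+ 2 = 4 * t k.
    rewrite exprMn -exprM mulnC exprM /t (_ : 2 ^+ 2 = 4 :> R); last by ring.
    by rewrite exprS mulrA.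
  have sq (x : R) : x ^+ 2 <= Q z -> `|x| <= 2 ^+ k.+1 * d.
    move=> xQ; rewrite -(ler_pXn2r (n := 2)) ?nnegrE // real_normK ?num_real // r2.
    by apply: le_trans xQ _; apply: le_trans (ltW inn) _; rewrite ler_pM2r //; lra.
  have : `|z.1 - c.1| <= 2 ^+ k.+1 * d by apply: sq; rewrite lerDl sqr_ge0.
  have : `|z.2 - c.2| <= 2 ^+ k.+1 * d by apply: sq; rewrite lerDr sqr_ge0.
  rewrite !ler_norml => /andP[h1 h2] /andP[h3 h4].
  by split; rewrite /= in_itv /=; apply/andP; split; lra.
rewrite indicE mem_set // mulr1 ler_pdivlMr // /ga.
have a2 : a (- (t k)^-1 * Q z + 5 / 2) ^+ 2 <= M ^+ 2.
  by rewrite ler_pXn2r // ?nnegrE ?(bump_ge0 Aa) // (le_trans (bump_ge0 Aa 0)).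
set x := a _ in a2 *.
rewrite (_ : _ * t k = 4 * x ^+ 2 * ((t k)^-1 * Q z)); last first.
  by field; rewrite gt_eqF.
have q1 : (t k)^-1 * Q z <= 7 / 2 by rewrite mulrC ler_pdivrMr // ltW.
have q0 : 0 <= (t k)^-1 * Q z by rewrite mulr_ge0 ?invr_ge0 // ltW.
have : x ^+ 2 * ((t k)^-1 * Q z) <= M ^+ 2 * (7 / 2) by apply: ler_pM => //; exact: sqr_ge0.
rewrite -mulrA; move: (x ^+ 2 * _) (M ^+ 2) => u v; lra.
Qed.

Let steps (n : nat) (z : plane R) : R := \sum_(k < n) step k.+1 z.

Let stepsS n : steps n.+1 = (fun z => steps n z + step n.+1 z).
Proof. by apply/funext => z; rewrite /steps big_ord_recr. Qed.

Let steps_alg n : smooth_alg (steps n).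
Proof.
elim: n => [|n IH]; last by rewrite stepsS; constructor.
rewrite (_ : steps 0 = fun=> 0); first by constructor.
by apply/funext => z; rewrite /steps big_ord0.
Qed.

Let steps_gradS n z : grad (steps n.+1) z = grad (steps n) z + grad (step n.+1) z.
Proof.
rewrite stepsS /grad; congr pair.
  have [_ D1] := smooth_algE ((1, 0) : plane R) (steps_alg n).
  have [_ D2] := smooth_algE ((1, 0) : plane R) (step_alg n.+1).
  exact: (@derive_val _ _ _ _ _ _ _ (is_deriveD (D1 z) (D2 z))).
have [_ D1] := smooth_algE ((0, 1) : plane R) (steps_alg n).
have [_ D2] := smooth_algE ((0, 1) : plane R) (step_alg n.+1).
exact: (@derive_val _ _ _ _ _ _ _ (is_deriveD (D1 z) (D2 z))).
Qed.

Let steps_grad0 z : grad (steps 0) z = 0.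
Proof.
have -> : steps 0 = cst 0 by apply/funext => y; rewrite /steps big_ord0.
by rewrite /grad !derive_cst.
Qed.

Let steps_grad_out n z : 7 / 2 * t n <= Q z -> grad (steps n) z = 0.
Proof.
elim: n => [_|n IH H]; first exact: steps_grad0.
rewrite steps_gradS IH; last first.
  by apply: le_trans H; rewrite tS; have := t_gt0 n; lra.
by rewrite step_grad ga_out // !mul0r addr0.
Qed.

(* The supports of the gradients of the successive steps are disjoint. *)
Let steps_sq n z : sq_form (grad (steps n)) z <= \sum_(k < n) sq_form (grad (step k.+1)) z.
Proof.
elim: n => [|n IH].
  by rewrite big_ord0 /sq_form steps_grad0 /= expr0n addr0.
rewrite big_ord_recr /=; have [out|inn] := leP (7 / 2 * t n) (Q z).
  have -> : sq_form (grad (steps n.+1)) z = sq_form (grad (step n.+1)) z.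
    by rewrite /sq_form steps_gradS steps_grad_out // add0r.
  by rewrite lerDr; apply: sumr_ge0 => k _; exact: sq_form_ge0.
have -> : sq_form (grad (steps n.+1)) z = sq_form (grad (steps n)) z.
  rewrite /sq_form steps_gradS step_grad ga_in ?mul0r ?addr0 //.
  by rewrite tS; have := t_gt0 n; lra.
by apply: le_trans IH _; rewrite lerDl sq_form_ge0.
Qed.

(* The energy is scale invariant, so that the average of [n] steps at disjoint
   dyadic scales costs [O(1 / n)] (logarithmic cutoff). *)
Definition cutoff (n : nat) (z : plane R) : R := n%:R^-1 * steps n z.

Lemma cutoff_alg n : smooth_alg (cutoff n).
Proof. by rewrite /cutoff; constructor; [constructor|exact: steps_alg]. Qed.

Lemma cutoff01 n z : (0 < n)%N -> 0 <= cutoff n z <= 1.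
Proof.
move=> n0; have nR : (0 : R) < n%:R by rewrite ltr0n.
apply/andP; split.
  rewrite mulr_ge0 ?invr_ge0 ?(ltW nR) // sumr_ge0 // => k _.
  by case/andP: (step_le1 (- (t k.+1)^-1 * Q z + 5 / 2)).
rewrite /cutoff mulrC ler_pdivrMr // mul1r.
have : steps n z <= \sum_(k < n) (1 : R).
  by apply: ler_sum => k _; case/andP: (step_le1 (- (t k.+1)^-1 * Q z + 5 / 2)).
by rewrite sumr_const card_ord.
Qed.

(** The steps in [steps] begin with index 1, not 0, so that all of them are still 1 at distance
    [2 * d]. This radius covers a neighbourhood of any set of diameter [d] that contains the
    centre. *)
Lemma cutoff_in n z : (0 < n)%N -> edist z c <= 2 * d -> cutoff n z = 1.
Proof.
move=> n0; have nR : (0 : R) < n%:R by rewrite ltr0n.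
rewrite edist_le; last by rewrite mulr_ge0 // ltW.
rewrite -/(Q z) => Qz.
rewrite /cutoff (_ : steps n z = n%:R) ?mulVf ?gt_eqF //.
transitivity (\sum_(k < n) (1 : R)); last by rewrite sumr_const card_ord.
apply: eq_bigr => k _; apply: (step_right Aa).
have : (t k.+1)^-1 * Q z <= 1.
  rewrite mulrC ler_pdivrMr // mul1r; apply: le_trans Qz _.
  rewrite tS exprMn (_ : 2 ^+ 2 = 4 :> R); last by ring.
  by rewrite ler_pM2l // /t ler_peMl ?sqr_ge0 // exprn_ege1 //; lra.
rewrite mulNr; lra.
Qed.

Lemma cutoff_out n z : 2 ^+ n.+1 * d <= edist z c -> cutoff n z = 0.
Proof.
move=> H; rewrite /cutoff (_ : steps n z = 0) ?mulr0 //.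
apply: big1 => k _; apply: (step_left Aa).
have r0 : 0 <= 2 ^+ n.+1 * d by rewrite mulr_ge0 ?exprn_ge0 // ltW.
have Qz : t n.+1 <= Q z.
  have : (2 ^+ n.+1 * d) ^+ 2 <= edist z c ^+ 2 by rewrite ler_pXn2r ?nnegrE ?edist_ge0.
  rewrite edist_sqr -/(Q z) exprMn -exprM mulnC exprM.
  by rewrite (_ : 2 ^+ 2 = 4 :> R) //; ring.
have tk : t k.+1 <= t n.
  by rewrite ler_pM2r ?exprn_gt0 // ler_weXn2l //; lra.
have : 4 <= (t k.+1)^-1 * Q z.
  rewrite mulrC ler_pdivlMr //; apply: le_trans Qz.
  by rewrite (tS n) ler_pM2l.
rewrite mulNr; lra.
Qed.

Lemma cutoff_energy n (Om : set (plane R)) : (0 < n)%N ->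
  measurable (Om : set (mplane R)) -> Om `<=` square ->
  Rintegral leb2 Om (sq_form (grad (cutoff n))) <= 224 * M ^+ 2 / n%:R.
Proof.
move=> n0 mOm Osq; have nR : (0 : R) < n%:R by rewrite ltr0n.
have gE z : sq_form (grad (cutoff n)) z = (n%:R ^+ 2)^-1 * sq_form (grad (steps n)) z.
  rewrite /sq_form /grad /=.
  have [_ D1] := smooth_algE ((1, 0) : plane R) (steps_alg n).
  have [_ D2] := smooth_algE ((0, 1) : plane R) (steps_alg n).
  have -> : 'D_(1, 0) (cutoff n) z = n%:R^-1 * 'D_(1, 0) (steps n) z.
    exact: (@derive_val _ _ _ _ _ _ _ (is_deriveZ n%:R^-1 (D1 z))).
  have -> : 'D_(0, 1) (cutoff n) z = n%:R^-1 * 'D_(0, 1) (steps n) z.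
    exact: (@derive_val _ _ _ _ _ _ _ (is_deriveZ n%:R^-1 (D2 z))).
  by rewrite -exprVn; ring.
have E : (\int[leb2]_(z in Om) (sq_form (grad (steps n)) z)%:E <= (n%:R * (224 * M ^+ 2))%:E)%E.
  have m1 : measurable_fun setT (fun z : mplane R => (sq_form (grad (steps n)) z)%:E).
    have [c1 c2] := grad_continuous (steps_alg n).
    apply/measurable_EFinP; apply: measurable_funD; apply: measurable_funX;
      exact: continuous_plane_measurable.
  pose b (k : nat) (z : mplane R) : \bar R := (14 * M ^+ 2 / t k.+1 * \1_(box k.+1) z)%:E.
  have b0 k z : (0 <= b k z)%E.
    rewrite lee_fin mulr_ge0 ?indicE //.
    by rewrite mulr_ge0 ?invr_ge0 ?(ltW (t_gt0 _)) // mulr_ge0 // sqr_ge0.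
  have mb k : measurable_fun setT (b k).
    by apply/measurable_EFinP; apply: measurable_funM => //; exact: (measurable_indic (box_measurable _)).
  apply: (@le_trans _ _ (\int[leb2]_z (\sum_(k < n) b k z))%E).
    apply: (@le_trans _ _ (\int[leb2]_z (sq_form (grad (steps n)) z)%:E)%E).
      apply: ge0_subset_integral => //.
      by move=> z _; rewrite lee_fin sq_form_ge0.
    apply: ge0_le_integral => //.
    - by move=> z _; rewrite lee_fin sq_form_ge0.
    - by apply: emeasurable_sum => k; exact: mb.
    move=> z _; rewrite sumEFin lee_fin; apply: le_trans (steps_sq n z) _.
    by apply: ler_sum => k _; exact: step_sq_le.
  rewrite ge0_integral_sum //.
  rewrite (_ : (\sum_(k < n) _)%E = (\sum_(k < n) (224 * M ^+ 2)%:E)%E); last first.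
    apply: eq_bigr => k _.
    rewrite /b; under eq_integral do rewrite EFinM.
    have c0 : 0 <= 14 * M ^+ 2 / t k.+1.
      by rewrite mulr_ge0 ?invr_ge0 ?(ltW (t_gt0 _)) // mulr_ge0 // sqr_ge0.
    have mi : measurable_fun setT (fun z : mplane R => (\1_(box k.+1) z : R)%:E).
      by apply/measurable_EFinP; exact: (measurable_indic (box_measurable _)).
    rewrite (@ge0_integralZl _ _ _ leb2 setT measurableT _ mi); [|by move=> z _; rewrite lee_fin indicE|by rewrite lee_fin].
    rewrite integral_indic //.
    transitivity ((14 * M ^+ 2 / t k.+1)%:E * (16 * t k.+1)%:E)%E.
      by congr (_ * _)%E; rewrite setIT; exact: box_measure.
    rewrite -EFinM; congr EFin.
    by field; rewrite gt_eqF.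
  by rewrite sumEFin lee_fin sumr_const card_ord -[leLHS]mulr_natl.
rewrite /Rintegral; under eq_integral do rewrite gE EFinM.
have iS : leb2.-integrable (Om : set (mplane R)) (EFin \o sq_form (grad (steps n))).
  by have [] := grad_L2 (steps_alg n) mOm Osq.
rewrite integralZl // fineM //; last exact: (integrable_fin_num _ iS).
rewrite /= (_ : 224 * M ^+ 2 / n%:R = (n%:R ^+ 2)^-1 * (n%:R * (224 * M ^+ 2))); last first.
  by field; rewrite gt_eqF.
rewrite ler_pM2l ?invr_gt0 ?exprn_gt0 //.
by rewrite -lee_fin fineK //; exact: (integrable_fin_num _ iS).
Qed.

End Cutoff.

(** * One function out of many cutoffs *)

Section Blend.
Context {R : realType}.
Variables (A a : R -> R) (Aa : step_pair A a) (M : R) (aM : forall x, a x <= M).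
Variables (I : eqType) (pt : I -> plane R) (d : I -> R) (F : pred I) (n : nat).
Hypotheses (d0 : forall i, 0 < d i) (n0 : (0 < n)%N).

Let cut i := cutoff A (pt i) (d i) n.

Let cut_alg i : smooth_alg (cut i). Proof. exact: (cutoff_alg Aa). Qed.

(* [blend s] is 1 on the holes of [F] and 0 on the others: it processes the
   list from its tail, each later cutoff overriding the previous function. *)
Fixpoint blend (s : seq I) : plane R -> R :=
  if s is i :: s' then
    if F i then (fun z => blend s' z + (1 - blend s' z) * cut i z)
    else (fun z => blend s' z * (1 - cut i z))
  else fun=> 0.

Let blend_cons i s z : blend (i :: s) z =
  if F i then blend s z + (1 - blend s z) * cut i z else blend s z * (1 - cut i z).
Proof. by rewrite /=; case: ifP. Qed.

Lemma blend_alg s : smooth_alg (blend s).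
Proof.
elim: s => [|i s IH] /=; first by constructor.
have m1 (f : plane R -> R) : smooth_alg f -> smooth_alg (fun z => 1 - f z).
  by move=> sf; apply: smooth_algB => //; constructor.
by case: ifP => _; [apply: smooth_algD|]; try apply: smooth_algM; auto.
Qed.

Lemma blend01 s z : 0 <= blend s z <= 1.
Proof.
elim: s => [|i s /andP[b0 b1]]; first by rewrite /= lexx ler01.
rewrite blend_cons.
have /andP[c0 c1] := cutoff01 Aa (pt i) (d i) z n0.
rewrite -/(cut i z) in c0 c1.
by case: ifP => _; apply/andP; split; nra.
Qed.

Lemma blend_out s z : (forall i, i \in s -> F i -> cut i z = 0) -> blend s z = 0.
Proof.
elim: s => [|i s IH] // H; rewrite blend_cons.
have {}IH : blend s z = 0 by apply: IH => j js; apply: H; rewrite inE js orbT.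
case: ifP => Fi; rewrite IH ?mul0r // (H i) ?mem_head //.
by rewrite mulr0 addr0.
Qed.

(** At [z] the cutoff of [i] resets the value, whatever the list [s2] has produced. Among the holes
    of [s1], treated afterwards, those of the other kind have cutoff 0 and those of the same kind
    pull towards the value already reached. *)
Lemma blend_in s1 s2 i z : cut i z = 1 ->
  (forall j, j \in s1 -> F j != F i -> cut j z = 0) ->
  blend (s1 ++ i :: s2) z = (F i)%:R.
Proof.
move=> ci; elim: s1 => [|j s1 IH] H; rewrite ?cat0s ?cat_cons blend_cons.
  by rewrite ci subrr mulr0 mulr1 addrC subrK; case: (F i).
have {}IH : blend (s1 ++ i :: s2) z = (F i)%:R.
  by apply: IH => k ks; apply: H; rewrite inE ks orbT.
rewrite IH; have [->|/(H j (mem_head _ _)) ->] := eqVneq (F j) (F i).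
  by case: (F i); rewrite ?subrr mul0r ?addr0.
by case: (F j); rewrite ?mulr0 ?addr0 // subr0 mulr1.
Qed.

(** Each stage interpolates between the previous function and a constant 0 or 1. In the product rule
    the coefficients of both derivatives are at most 1 in absolute value, as all the functions take
    values in the unit interval. *)
Lemma blend_grad s z (v : plane R) :
  `|'D_v (blend s) z| <= \sum_(i <- s) `|'D_v (cut i) z|.
Proof.
elim: s => [|i s IH]; first by rewrite big_nil /= derive_cst normr0.
have [_ Db] := smooth_algE v (blend_alg s); have [_ Dc] := smooth_algE v (cut_alg i).
have /andP[b0 b1] := blend01 s z.
have /andP[c0 c1] := cutoff01 Aa (pt i) (d i) z n0; rewrite -/(cut i z) in c0 c1.
have D1 (f : plane R -> R) df : is_derive z v f df -> is_derive z v (fun z => 1 - f z) (- df).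
  move=> Df; have := is_derive_add (is_derive_cst (1 : R) z v) (is_deriveN Df).
  by rewrite add0r.
rewrite big_cons (_ : blend (i :: s) = if F i
  then (fun z => blend s z + (1 - blend s z) * cut i z)
  else (fun z => blend s z * (1 - cut i z))) //.
case: ifP => _.
  have D := is_derive_add (Db z) (is_derive_mul (D1 _ _ (Db z)) (Dc z)).
  rewrite (@derive_val _ _ _ _ _ _ _ D).
  set x := 'D_v (blend s) z in IH *; set y := 'D_v (cut i) z.
  rewrite [X in `|X| <= _](_ : _ = (1 - blend s z) * y + (1 - cut i z) * x); last by ring.
  apply: le_trans (ler_normD _ _) _; apply: lerD.
    by rewrite normrM ler_piMl // ger0_norm; lra.
  by apply: le_trans IH; rewrite normrM ler_piMl // ger0_norm; lra.
have D := is_derive_mul (Db z) (D1 _ _ (Dc z)).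
rewrite (@derive_val _ _ _ _ _ _ _ D).
set x := 'D_v (blend s) z in IH *; set y := 'D_v (cut i) z.
rewrite [X in `|X| <= _](_ : _ = (- blend s z) * y + (1 - cut i z) * x); last by ring.
apply: le_trans (ler_normD _ _) _; apply: lerD.
  by rewrite normrM ler_piMl // normrN ger0_norm.
by apply: le_trans IH; rewrite normrM ler_piMl // ger0_norm; lra.
Qed.

Lemma sqr_sum_le (s : seq I) (f : I -> R) :
  (\sum_(i <- s) f i) ^+ 2 <= (size s)%:R * \sum_(i <- s) f i ^+ 2.
Proof.
elim: s => [|i s IH]; first by rewrite !big_nil expr0n mul0r.
rewrite !big_cons /= -natr1.
set X := \sum_(j <- s) f j in IH *; set Y := \sum_(j <- s) _ in IH *.
set m : R := (size s)%:R in IH *; have m0 : 0 <= m by [].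
have [m1|m1] := eqVneq m 0.
  have X0 : X = 0 by apply/eqP; rewrite -sqrf_eq0 eq_le sqr_ge0 andbT; move: IH; rewrite m1 mul0r.
  have : 0 <= Y by apply: sumr_ge0 => j _; exact: sqr_ge0.
  by rewrite X0 m1; nra.
have mp : 0 < m by rewrite lt_neqAle eq_sym m1.
have h : 0 <= (m * f i - X) ^+ 2 := sqr_ge0 _.
rewrite -(ler_pM2l mp).
have h2 : m * (X ^+ 2) <= m * (m * Y) by rewrite ler_pM2l.
nra.
Qed.

Variable Om : set (plane R).
Hypotheses (mOm : measurable (Om : set (mplane R))) (Osq : Om `<=` square).

(** One factor [size s] comes from squaring the sum of the gradients, the other from the number of
    cutoffs, each with the energy bound of [cutoff_energy]. *)
Lemma blend_energy s : Rintegral leb2 Om (sq_form (grad (blend s))) <=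
  (size s)%:R ^+ 2 * (224 * M ^+ 2 / n%:R).
Proof.
pose S (l : seq I) z := \sum_(i <- l) sq_form (grad (cut i)) z.
have iC i : leb2.-integrable (Om : set (mplane R)) (EFin \o sq_form (grad (cut i))).
  by have [] := grad_L2 (cut_alg i) mOm Osq.
have SE l : leb2.-integrable (Om : set (mplane R)) (EFin \o S l) /\
    Rintegral leb2 Om (S l) <= (size l)%:R * (224 * M ^+ 2 / n%:R).
  elim: l => [|i l [IH1 IH2]].
    have -> : S [::] = (fun=> 0) by apply/funext => z; rewrite /S big_nil.
    split; last by rewrite Rintegral_cst // !mul0r.
    by apply: continuous_square_integrable => // z; exact: cvg_cst.
  have -> : S (i :: l) = (fun z => sq_form (grad (cut i)) z + S l z).
    by apply/funext => z; rewrite /S big_cons.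
  split; first exact: integrable_addr.
  rewrite RintegralD //= -natr1 mulrDl mul1r addrC lerD //.
  exact: (cutoff_energy Aa aM (pt i) (d0 i)).
have [iS bS] := SE s.
have iB : leb2.-integrable (Om : set (mplane R)) (EFin \o sq_form (grad (blend s))).
  by have [] := grad_L2 (blend_alg s) mOm Osq.
apply: (@le_trans _ _ (Rintegral leb2 Om (fun z => (size s)%:R * S s z))).
  apply: (le_Rintegral mOm iB (integrable_scaler _ mOm iS)) => z _.
  rewrite /sq_form /S big_split /= mulrDr; apply: lerD.
    rewrite -(real_normK (num_real ('D_(1, 0) (blend s) z))).
    apply: (@le_trans _ _ ((\sum_(i <- s) `|'D_(1, 0) (cut i) z|) ^+ 2)).
      by rewrite ler_pXn2r ?nnegrE ?sumr_ge0 //; exact: blend_grad.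
    apply: le_trans (sqr_sum_le _ _) _; rewrite ler_wpM2l // ler_sum // => i _.
    by rewrite real_normK ?num_real.
  rewrite -(real_normK (num_real ('D_(0, 1) (blend s) z))).
  apply: (@le_trans _ _ ((\sum_(i <- s) `|'D_(0, 1) (cut i) z|) ^+ 2)).
    by rewrite ler_pXn2r ?nnegrE ?sumr_ge0 //; exact: blend_grad.
  apply: le_trans (sqr_sum_le _ _) _; rewrite ler_wpM2l // ler_sum // => i _.
  by rewrite real_normK ?num_real.
by rewrite RintegralZl // expr2 -mulrA ler_wpM2l.
Qed.

End Blend.

(** * The energy inequality for an isolated cluster of holes *)

Lemma half_sum_ge1 {R : realType} (x y z : R) :
  x <= 1 -> y <= z -> 1 <= 2^-1 * (x + y) -> 1 <= z.
Proof. lra. Qed.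

Section Isolated_cluster.
Context {R : realType}.

Lemma near_seq (T : topologicalType) (I : eqType) (s : seq I) (P : I -> T -> Prop) (x : T) :
  (forall i, i \in s -> \forall y \near x, P i y) ->
  \forall y \near x, forall i, i \in s -> P i y.
Proof.
elim: s => [|i s IH] H; first by apply: nearW.
have H1 := H i (mem_head _ _).
have H2 : \forall y \near x, forall i, i \in s -> P i y.
  by apply: IH => j js; apply: H; rewrite inE js orbT.
by apply: filterS2 H1 H2 => y y1 y2 j; rewrite inE => /orP[/eqP->|]; auto.
Qed.

Lemma near_edist_ge (p q : plane R) (r : R) : r < edist p q ->
  \forall z \near p, r <= edist z q.
Proof.
move=> H; have r0 : 0 < edist p q - r by rewrite subr_gt0.
apply: filterS (edist_near p r0) => z zp.
by have := edist_triangle z p q; rewrite (edistC p z); lra.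
Qed.

Lemma l2norm_delta (I : choiceType) (j0 : I) :
  (sqsum (fun j => (j == j0)%:R : R) < +oo)%E /\ l2norm (fun j => (j == j0)%:R : R) = 1.
Proof.
have E : sqsum (fun j => (j == j0)%:R : R) = 1%E.
  rewrite /sqsum (_ : (fun i => ((i == j0)%:R ^+ 2)%:E) =
    (fun i => if i \in [set j0] then 1%E else 0%E)).
    by rewrite -esum_mkcond esum_set1.
  apply/funext => i; have [->|ij] := eqVneq i j0.
    by rewrite expr1n mem_set.
  by rewrite expr0n /= memNset //= => /eqP; rewrite (negbTE ij).
by rewrite /l2norm E ltry /= sqrtr1.
Qed.

Variables (A a : R -> R) (Aa : step_pair A a) (M : R) (aM : forall x, a x <= M).
Variables (I : countType) (B : I -> set (plane R)) (gamma : I -> R -> plane R).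
Hypotheses (rB : regular_holes B) (pg : period_curves B gamma).

Let Om := domain_of B.
Let oOm : open Om. Proof. exact: domain_open. Qed.

Let mOm : measurable (Om : set (mplane R)). Proof. exact: open_plane_measurable. Qed.

Let Om1 z : Om z -> z.1 ^+ 2 + z.2 ^+ 2 < 1. Proof. exact: domain_disk. Qed.

Let Osq : Om `<=` square. Proof. exact: disk_square. Qed.

Let dgamma i := derive1 (gamma i).

Let loop i : C1_loop (gamma i) (dgamma i).
Proof. by apply: smooth_curve_loop; have [] := pg i. Qed.

Let gamma_in i t : Om (gamma i t). Proof. by have [_ + _ _] := pg i; apply. Qed.

Let margin : exists r : I -> R, forall i, 0 < r i /\
  forall t z, `|z - gamma i t| < r i -> Om z.
Proof.
have /choice[r Hr] : forall i, exists r : R,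
    0 < r /\ forall t z, `|z - gamma i t| < r -> Om z.
  by move=> i; have [r r0 Hr] := loop_margin oOm Om1 (loop i) (gamma_in i); exists r.
by exists r.
Qed.

(* A smoothed indicator, up to sign, of the component enclosed by [gamma i]. *)
Lemma period_potential : exists psi : I -> plane R -> R, [/\
  forall i, smooth_alg (psi i),
  forall i p, ~ Om p -> \forall z \near p, psi i z = psi i p,
  forall i p, ~ disk R p -> psi i p = 0,
  forall i k p, B k p -> psi i p = - (k == i)%:R &
  forall i w x, closed_L2_form Om w -> is_period Om (gamma i) w x ->
    Rintegral leb2 Om (wedge w (grad (psi i))) = - x].
Proof.
have [r Hr] := margin.
have e0 i : 0 < r i / 2 by rewrite divr_gt0 //; case: (Hr i).
have er i : 0 < r i / 2 < r i.
  by rewrite e0 /= ltr_pdivrMr // ltr_pMr ?ltr1n //; case: (Hr i).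
exists (fun i => soft_winding A a (gamma i) (dgamma i) (r i / 2)); split.
- by move=> i; exact: (soft_winding_alg Aa (loop i)).
- by move=> i p pO; apply: (soft_winding_near Aa (loop i) (Hr i).2 (er i)).
- move=> i p pD; apply: (soft_winding_out Aa Om1 (loop i) (Hr i).2 (er i)).
  by rewrite leNgt; apply/negP => /diskE.
- move=> i k p Bp; rewrite (soft_winding_winding Aa (loop i) (e0 i)).
    have [_ _ w1 w0] := pg i; have [ki|ki] := eqVneq k i.
      by rewrite w1 // -ki.
    by rewrite (w0 k).
  move=> t; rewrite distrC leNgt; apply/negP => H.
  have := (Hr i).2 t p (lt_trans H _); rewrite (_ : _ < _) //; last by case/andP: (er i).
  by move=> /(_ isT)[_]; apply; exists k.
- move=> i w x cw pw.
  exact: (pairing_period Aa oOm Om1 (loop i) (gamma_in i) (Hr i).2 cw (er i) erefl pw).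
Qed.

Variables (C : R) (C0 : 0 < C) (iC : interpolation_with B gamma C).
Variables (n : nat) (n0 : (0 < n)%N).
Variables (s : seq I) (F : pred I) (j0 : I) (pt : I -> plane R).
Let d i := diam (B i).

Hypotheses (us : uniq s) (Fj0 : F j0) (Fs : forall i, F i -> i \in s).
Hypothesis sorted_s : sorted (fun i j => d i <= d j) s.
Hypothesis Bpt : forall i, B i (pt i).
Hypothesis separated : forall i k z w, F i -> k \in s -> ~~ F k -> B i z -> B k w ->
  2 ^+ n.+3 * Num.min (d i) (d k) < edist z w.
Hypothesis inside : forall i z, F i -> edist z (pt i) <= 2 ^+ n.+1 * d i ->
  disk R z /\ forall k, B k z -> k \in s.

Let d0 i : 0 < d i.
Proof. by apply: hole_diam_gt0; have [+ _ _] := rB; apply. Qed.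

Let BD i : B i `<=` disk R.
Proof. by have [/(_ i)[] _ + _ _ _ _ _] := rB. Qed.

Let u := blend A pt d F n s.

(** The holes listed before [k] are treated after it and are not larger, so the minimum in
    [separated] is their own diameter, and [p] lies beyond the reach of those of the other kind.
    Holes listed after [k] may well have altered the function at [p]; the cutoff of [k] overrides
    them. *)
Let u_near_hole k p : k \in s -> B k p -> \forall z \near p, u z = (F k)%:R.
Proof.
move=> ks Bp.
have [s1 [s2 sE]] : exists s1 s2, s = s1 ++ k :: s2.
  exists (take (index k s) s), (drop (index k s).+1 s).
  by rewrite -{1}(cat_take_drop (index k s) s) (drop_nth k) ?index_mem // nth_index.
have s1k j : j \in s1 -> d j <= d k.
  move: sorted_s; rewrite sE sorted_pairwise; last by move=> x y z; exact: le_trans.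
  rewrite pairwise_cat => /and3P[/allrelP H _ _] js1.
  by apply: H => //; exact: mem_head.
have n1 : \forall z \near p, edist z (pt k) <= 2 * d k.
  apply: filterS (edist_near p (d0 k)) => z zp.
  have := edist_triangle p z (pt k); have := diam_ge (@BD k) Bp (Bpt k).
  by rewrite -/(d k); lra.
have n2 : \forall z \near p, forall j, j \in s1 -> F j != F k ->
    2 ^+ n.+1 * d j <= edist z (pt j).
  apply: (@near_seq (plane R) I s1
    (fun j z => F j != F k -> 2 ^+ n.+1 * d j <= edist z (pt j))) => j js1.
  have [FE|FE] := eqVneq (F j) (F k); first by apply: filterE => z.
  have H : 2 ^+ n.+1 * d j < edist p (pt j).
    have dj : Num.min (d j) (d k) = d j by apply/min_idPl; exact: s1k.
    have js : j \in s by rewrite sE mem_cat js1.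
    apply: (@le_lt_trans _ _ (2 ^+ n.+3 * Num.min (d j) (d k))).
      rewrite dj ler_pM2r //; apply: ler_weXn2l; first by rewrite ler1n.
      by rewrite -[n.+3]addn2 leq_addr.
    case Fk : (F k) FE => /=.
      by rewrite eqb_id => Fj; rewrite minC; apply: (separated Fk js).
    by rewrite eqbF_neg negbK => Fj; rewrite edistC; apply: (separated Fj ks) => //; rewrite Fk.
  by apply: filterS (near_edist_ge H).
apply: filterS2 n1 n2 => z z1 z2; rewrite /u sE; apply: blend_in.
  exact: (cutoff_in Aa (d0 k) n0 z1).
by move=> j js1 FE; apply: (cutoff_out Aa (d0 j)); exact: z2.
Qed.

Let u_near_out p : (~ disk R p \/ exists2 k, B k p & k \notin s) ->
  \forall z \near p, u z = 0.
Proof.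
move=> H.
have H2 : \forall z \near p, forall j, j \in s -> F j -> 2 ^+ n.+1 * d j <= edist z (pt j).
  apply: (@near_seq (plane R) I s
    (fun j z => F j -> 2 ^+ n.+1 * d j <= edist z (pt j))) => j js.
  have [Fj|Fj] := boolP (F j); last by apply: filterE.
  apply: filterS (near_edist_ge (p := p) (q := pt j) (r := 2 ^+ n.+1 * d j) _) => //.
  rewrite ltNge; apply/negP => /(inside Fj)[Dp sp].
  by case: H => [/(_ Dp)//|[k /sp ->]].
apply: filterS H2 => z Hz; apply: blend_out => i si Fi.
by apply: (cutoff_out Aa (d0 i)); exact: Hz.
Qed.

Lemma isolated_cluster :
  1 <= C ^+ 2 * ((size s)%:R ^+ 2 * (224 * M ^+ 2 / n%:R)).
Proof.
have [psi [psi_alg psi_near psi_out psi_hole psi_period]] := period_potential.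
pose l := [seq j <- s | F j].
have ul : uniq l by rewrite filter_uniq.
have u_alg : smooth_alg u by exact: (blend_alg Aa).
(* Near a hole of the cluster [u] is 1 and the potentials sum to -1; near any other point outside
   [Om] both are 0. Hence [phi l] is a test function. The list is a parameter for the sake of the
   induction that splits the pairing into [u] and the potentials. *)
pose phi (l : seq I) z := u z + \sum_(j <- l) psi j z.
have phi_cons j l' : phi (j :: l') = (fun z => phi l' z + psi j z).
  by apply/funext => z; rewrite /phi big_cons addrCA addrC.
have phi_nil : phi [::] = u by apply/funext => z; rewrite /phi big_nil addr0.
have phi_alg l' : smooth_alg (phi l').
  by elim: l' => [|j l' IH]; rewrite ?phi_nil ?phi_cons //; constructor.
have phi_near p : ~ Om p -> \forall z \near p, phi l z = 0.
  move=> pO.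
  have H : \forall z \near p, forall j, j \in l -> psi j z = psi j p.
    by apply: near_seq => j _; exact: psi_near.
  have sumE z : (forall j, j \in l -> psi j z = psi j p) ->
      \sum_(j <- l) psi j z = \sum_(j <- l) psi j p.
    by move=> Hz; rewrite big_seq [RHS]big_seq; apply: eq_bigr => j; exact: Hz.
  have [Dp|nDp] := pselect (disk R p); last first.
    apply: filterS2 H (u_near_out (or_introl nDp)) => z z1 z2.
    by rewrite /phi z2 sumE // add0r big1 // => j _; exact: psi_out.
  have [k _ Bk] : (\bigcup_i B i) p by apply: contrapT => H1; apply: pO; split.
  have valE : \sum_(j <- l) psi j p = - (k \in l)%:R.
    under eq_bigr => j _ do rewrite (psi_hole j k p Bk) eq_sym.
    rewrite sumrN -(count_uniq_mem k ul) -sum1_count natr_sum; congr (- _).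
    by rewrite [RHS]big_mkcond /=; apply: eq_bigr => j _; case: eqP.
  have [ks|ks] := boolP (k \in s).
    apply: filterS2 H (u_near_hole ks Bk) => z z1 z2.
    by rewrite /phi z2 sumE // valE mem_filter ks andbT subrr.
  have ex : ~ disk R p \/ exists2 k, B k p & k \notin s by right; exists k.
  apply: filterS2 H (u_near_out ex) => z z1 z2.
  by rewrite /phi z2 sumE // valE mem_filter (negbTE ks) andbF oppr0 addr0.
have phi_test : test_function Om (phi l).
  apply: (@test_functionP _ _ _ 1) => // z z0.
  have [Dz|nDz] := pselect (disk R z).
    have [h1 h2] : square z.
      apply: (@disk_square _ (disk R)) => // y; exact: (diskE y).1.
    by rewrite prod_normE ge_max !ler_norml; move: h1 h2; rewrite /= !in_itv /= => -> ->.
  have nOz : ~ Om z by move=> [].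
  by have := nbhs_singleton (phi_near z nOz) => /eqP; rewrite (negbTE z0).
have [fin l2] := l2norm_delta j0.
have [w [cw pw nw]] := iC fin.
have wL := closed_L2_formW cw.
have gL f : smooth_alg f -> L2_form Om (grad f) by move=> sf; exact: grad_L2.
have sumE l' : Rintegral leb2 Om (wedge w (grad (phi l'))) =
    Rintegral leb2 Om (wedge w (grad u)) - \sum_(j <- l') (j == j0)%:R.
  elim: l' => [|j l' IH]; first by rewrite phi_nil big_nil subr0.
  rewrite big_cons opprD addrCA -IH -(psi_period j w _ cw (pw j)) addrC phi_cons.
  have I1 := wedge_integrable mOm wL (gL _ (phi_alg l')).
  have I2 := wedge_integrable mOm wL (gL _ (psi_alg j)).
  rewrite -(RintegralD mOm I1 I2); apply: eq_Rintegral => z _.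
  have [_ D1] := smooth_algE ((1, 0) : plane R) (phi_alg l').
  have [_ D2] := smooth_algE ((1, 0) : plane R) (psi_alg j).
  have [_ E1] := smooth_algE ((0, 1) : plane R) (phi_alg l').
  have [_ E2] := smooth_algE ((0, 1) : plane R) (psi_alg j).
  rewrite /wedge /grad /= (@derive_val _ _ _ _ _ _ _ (is_derive_add (D1 z) (D2 z))).
  rewrite (@derive_val _ _ _ _ _ _ _ (is_derive_add (E1 z) (E2 z))).
  by ring.
have key : Rintegral leb2 Om (wedge w (grad u)) = 1.
  have := sumE l; rewrite (closed_wedge cw phi_test) => /esym /eqP.
  rewrite subr_eq0 => /eqP ->.
  have j0l : j0 \in l by rewrite mem_filter Fj0 Fs.
  rewrite -[RHS]/(true%:R) -[in RHS]j0l -(count_uniq_mem j0 ul) -sum1_count natr_sum.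
  by rewrite [RHS]big_mkcond /=; apply: eq_bigr => j _; case: eqP.
have E := blend_energy Aa aM pt F d0 n0 mOm Osq s.
rewrite -/u in E; set K := _ ^+ 2 * _ in E *.
have W : Rintegral leb2 Om (sq_form w) <= C ^+ 2.
  have W0 : 0 <= Rintegral leb2 Om (sq_form w).
    by apply: Rintegral_ge0 => z _; exact: sq_form_ge0.
  rewrite -[leLHS]sqr_sqrtr // ler_pXn2r ?nnegrE ?sqrtr_ge0 ?(ltW C0) //.
  by move: nw; rewrite l2 mulr1.
have C2 : 0 < C ^+ 2 by rewrite exprn_gt0.
(* With the weight [(C ^+ 2)^-1] the term of [w] is at most 1, so the gradient term must itself be
   at least 1 for half of the sum to reach the pairing, which is 1. *)
have Ci : 0 < (C ^+ 2)^-1 by rewrite invr_gt0.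
have := wedge_bound mOm wL (gL _ u_alg) Ci.
rewrite key normr1 invrK => H.
have h1 : (C ^+ 2)^-1 * Rintegral leb2 Om (sq_form w) <= 1.
  by rewrite mulrC ler_pdivrMr // mul1r.
have h2 : C ^+ 2 * Rintegral leb2 Om (sq_form (grad u)) <= C ^+ 2 * K by rewrite ler_pM2l.
exact: half_sum_ge1 h1 h2 H.
Qed.

End Isolated_cluster.

(** * Short paths from a hole to the complement of the disk *)

Section Path_to_boundary.
Context {R : realType}.

Lemma path_reverse (V : eqType) (e : rel V) x p : symmetric e -> path e x p ->
  exists2 q, path e (last x p) q & last (last x p) q = x.
Proof.
move=> es; elim: p x => [|y p IH] x /=; first by exists [::].
move=> /andP[xy /IH[q pq lq]]; exists (rcons q x); last by rewrite last_rcons.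
by rewrite rcons_path pq lq es.
Qed.

Lemma hole_graph_sym (I : countType) (B : I -> set (plane R)) S :
  symmetric (hole_graph B S).
Proof.
by move=> [i|] [j|] //=; rewrite eq_sym set_distC minC.
Qed.

Variables (A a : R -> R) (Aa : step_pair A a) (M : R) (aM : forall x, a x <= M).
Variables (I : countType) (B : I -> set (plane R)) (gamma : I -> R -> plane R).
Hypotheses (rB : regular_holes B) (pg : period_curves B gamma).
Variables (C : R) (C0 : 0 < C) (iC : interpolation_with B gamma C).
Variables (N : nat).
Hypothesis mult : forall c, disk R c -> (Defs.meets B (hdisk c) #<= `I_N)%card.
Variables (n : nat) (n0 : (0 < n)%N).
Hypothesis small : C ^+ 2 * (N%:R ^+ 2 * (224 * M ^+ 2 / n%:R)) < 1.

Let S1 : R := 2 ^+ n.+3.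
(** Two constants are at work. The cluster is built with [S1], the separation that the cutoffs need.
    With the larger [S], a hole that is not joined to the outside is so small compared with its
    distance to the circle that a chain of at most [N] holes linked with constant [S1] stays near
    its starting point. *)
Let S : R := 16 * (N.+1)%:R * (1 + 2 * S1).
Let d i := diam (B i).
Let outside := ~` disk R.

Let d0 i : 0 < d i.
Proof. by apply: hole_diam_gt0; have [+ _ _] := rB; apply. Qed.

Let BD i : B i `<=` disk R.
Proof. by have [/(_ i)[] _ + _ _ _ _ _] := rB. Qed.

Let B0 i : B i !=set0.
Proof. by apply: hole_nonempty; have [+ _ _] := rB; apply. Qed.

Let S1_ge1 : 1 <= S1. Proof. by rewrite exprn_ege1 // ler1n. Qed.

Let N1_ge1 : 1 <= (N.+1)%:R :> R. Proof. by rewrite ler1n. Qed.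

Let S1S : S1 <= S.
Proof.
have h : 1 + 2 * S1 <= (N.+1)%:R * (1 + 2 * S1).
  by rewrite ler_peMl //; have := S1_ge1; lra.
by rewrite /S -mulrA; move: h; move: (_ * (1 + 2 * S1)) S1_ge1 => x; lra.
Qed.

Let S_gt0 : 0 < S. Proof. by have := S1S; have := S1_ge1; lra. Qed.

Let e1 : rel I := fun i j => (i != j) &&
  (set_dist (B i) (B j) <= S1 * Num.min (d i) (d j)).

Let min0 i j : 0 < Num.min (d i) (d j). Proof. by rewrite lt_min !d0. Qed.

Let e1_graph i p : path e1 i p -> path (hole_graph B S) (Some i) (map Some p).
Proof.
elim: p i => //= j p IH i /andP[/andP[ij e] /IH ->]; rewrite ij andbT /=.
by apply: le_trans e _; rewrite ler_pM2r.
Qed.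

Section From_hole.
Variable j0 : I.
Hypothesis far : ~ exists p, [/\ path (hole_graph B S) (Some j0) p,
  last (Some j0) p = None & (size p <= N)%N].

Let nonadjacent p : path e1 j0 p -> (size p < N)%N ->
  S * d (last j0 p) < set_dist (B (last j0 p)) outside.
Proof.
move=> pp sp; rewrite ltNge; apply/negP => H; apply: far.
exists (rcons (map Some p) None); split.
- by rewrite rcons_path e1_graph //= last_map.
- by rewrite last_rcons.
- by rewrite size_rcons size_map.
Qed.

Variable pt : I -> plane R.
Hypothesis Bpt : forall i, B i (pt i).

Let c0 := pt j0.
Let rho := 1 - edist c0 0.
(** [D0] bounds the diameter of a hole of the chain with a point at distance at most [rho] from
    [c0]: such a hole is within [2 * rho] of the outside, yet farther from it than [S] times its
    diameter. [T] bounds the progress made by one link, a diameter plus a gap; the factor 2 on the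
    gap is the room needed because [set_dist] is an infimum. *)
Let D0 : R := 2 * rho / S.
Let T : R := (1 + 2 * S1) * D0.

Let Dc0 : disk R c0. Proof. exact: (@BD j0). Qed.

Let rho0 : 0 < rho. Proof. by rewrite subr_gt0; exact/disk_edist. Qed.

Let D00 : 0 < D0. Proof. by rewrite divr_gt0 // mulr_gt0. Qed.

Let TN : (N.+1)%:R * T = rho / 8.
Proof.
rewrite /T /D0 /S; field.
by rewrite !gt_eqF //; have := S1_ge1; lra.
Qed.

Let T0 : 0 < T. Proof. by rewrite mulr_gt0 //; have := S1_ge1; lra. Qed.

Let mT m : (m <= N.+1)%N -> m%:R * T <= rho / 8.
Proof. by move=> mN; rewrite -TN ler_pM2r // ler_nat. Qed.

Let last_diam p z : path e1 j0 p -> (size p < N)%N -> B (last j0 p) z ->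
  edist z c0 <= rho -> d (last j0 p) <= D0.
Proof.
move=> pp sp Bz zc; have [q qD cq] := boundary_point Dc0.
have H := nonadjacent pp sp.
have H2 : set_dist (B (last j0 p)) outside <= edist z q by exact: set_dist_le.
have H3 := edist_triangle c0 z q.
rewrite /D0 ler_pdivlMr // mulrC; move: cq; rewrite -/rho => cq.
by apply: le_trans (ltW H) _; apply: le_trans H2 _; apply: le_trans H3 _; lra.
Qed.

(** The diameter of a new hole can be bounded only if the hole is known to come near [c0]. The gap
    is controlled by the diameter of the previous hole alone, so it places one point [w] of the new
    hole within [rho] of [c0]; [last_diam] then bounds the diameter, and this locates the rest of
    the hole. *)
Lemma chain_near p : path e1 j0 p -> (size p < N)%N ->
  d (last j0 p) <= D0 /\ forall z, B (last j0 p) z -> edist z c0 <= (size p).+1%:R * T.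
Proof.
elim/last_ind: p => [_ sN|p k IH].
  have dj : d j0 <= D0.
    apply: (@last_diam [::] (pt j0) isT sN (Bpt j0)).
    by rewrite edistxx ltW.
  split=> //= z Bz; rewrite mul1r; apply: le_trans (diam_ge (@BD j0) Bz (Bpt j0)) _.
  apply: le_trans dj _; rewrite /T ler_peMl ?(ltW D00) //; have := S1_ge1; lra.
rewrite rcons_path size_rcons last_rcons => /andP[pp /andP[jk e]] sp.
have sp' : (size p < N)%N by exact: ltnW.
have [dj Hj] := IH pp sp'.
have : set_dist (B (last j0 p)) (B k) < 2 * (S1 * Num.min (d (last j0 p)) (d k)).
  apply: le_lt_trans e _; rewrite ltr_pMl ?ltr1n // mulr_gt0 //.
  by have := S1_ge1; lra.
move=> /(set_dist_lt (B0 _) (B0 _))[z [w [Bz Bw zw]]].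
have zc := Hj z Bz.
have minD : S1 * Num.min (d (last j0 p)) (d k) <= S1 * D0.
  by rewrite ler_wpM2l ?exprn_ge0 //; apply: le_trans dj; rewrite ge_min lexx.
have wc : edist w c0 <= 2 * (S1 * D0) + (size p).+1%:R * T.
  by have := edist_triangle z w c0; rewrite (edistC w z); move: zw zc minD; lra.
have TE : T = D0 + 2 * (S1 * D0) by rewrite /T; ring.
have wr : edist w c0 <= rho.
  apply: le_trans wc _.
  have h1 : (size p).+1%:R * T <= rho / 8 by apply: mT; rewrite ltnS ltnW.
  have h2 : T <= rho / 8 by have := @mT 1 isT; rewrite mul1r.
  by have := D00; have := rho0; move: TE h1 h2; lra.
have pk : path e1 j0 (rcons p k) by rewrite rcons_path pp /= /e1 jk e.
have dk : d k <= D0.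
  have := last_diam (p := rcons p k) (z := w) pk; rewrite size_rcons last_rcons.
  exact.
split=> // z' Bz'.
have := edist_triangle w z' c0; have := diam_ge (@BD k) Bz' Bw; rewrite -/(d k).
rewrite -(natr1 (size p).+1) mulrDl mul1r; move: TE wc dk; lra.
Qed.

Lemma chain_absurd : False.
Proof.
have fin : finite_set (Defs.meets B (hdisk c0)).
  by apply/finite_set_leP; exists N; exact: mult.
pose L : seq I := finmap.enum_fset (fset_set (Defs.meets B (hdisk c0))).
have LN : (size L <= N)%N by apply: geq_card_fset_set; exact: mult.
have memL i z : B i z -> hdisk c0 z -> i \in L.
  move=> Bz zh; have := in_fset_set fin i; rewrite -[LHS]/(i \in L) => ->.
  by rewrite inE; exists z.
have hc0 : hdisk c0 c0.
  by apply: hdisk_edist => //; rewrite edistxx -/rho; have := rho0; lra.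
have j0L : j0 \in L by apply: memL hc0; exact: Bpt.
(* Chains are confined to the holes of [L], those that meet [hdisk c0]. A simple chain then has
   fewer than [N] edges, as [chain_near] requires. Holes outside [L] are kept apart from the cluster
   by position: the cutoffs of the cluster do not leave [hdisk c0]. *)
pose F : pred I := fun i => `[< exists p, [/\ path e1 j0 p, all [in L] (j0 :: p)
  & last j0 p = i] >].
have Fpath i : F i -> exists p, [/\ path e1 j0 p, (size p < N)%N & last j0 p = i].
  move=> /asboolP[p [pp pL pi]].
  case/shortenP: pp pi => p' pp' up' sub pi; exists p'; split=> //.
  apply: leq_trans LN; rewrite -[(size p').+1]/(size (j0 :: p')).
  apply: uniq_leq_size => // x; rewrite inE => /orP[/eqP->//|/sub xp].
  by move: pL => /= /andP[_ /allP]; apply.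
have FD i : F i -> d i <= D0 /\ forall z, B i z -> edist z c0 <= rho / 8.
  move=> /Fpath[p [pp sp <-]]; have [h1 h2] := chain_near pp sp; split=> // z /h2 H.
  by apply: le_trans H _; apply: mT; exact: ltnW.
pose leD : rel I := fun i j => d i <= d j.
pose s := sort leD L.
have sL i : (i \in s) = (i \in L) by rewrite mem_sort.
have hd z : edist z c0 <= rho / 4 -> hdisk c0 z.
  by move=> zc; apply: hdisk_edist => //; rewrite -/rho; have := rho0; lra.
have := isolated_cluster (s := s) (F := F) (j0 := j0) (pt := pt) (n := n) Aa aM rB pg C0 iC n0.
have step1 : uniq s by rewrite sort_uniq finmap.fset_uniq.
have step2 : F j0 by apply/asboolP; exists [::]; split=> //=; rewrite j0L.
have step3 i : F i -> i \in s.
  rewrite sL => /FD[_ H]; apply: (memL _ (pt i)); first exact: Bpt.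
  by apply: hd; have := H _ (Bpt i); have := rho0; lra.
have step4 : sorted leD s by apply: sort_sorted => i j; exact: le_total.
have step5 i k z w : F i -> k \in s -> ~~ F k -> B i z -> B k w ->
    2 ^+ n.+3 * Num.min (d i) (d k) < edist z w.
  move=> Fi ks nFk Bz Bw; apply: (@lt_le_trans _ _ (set_dist (B i) (B k))).
    rewrite ltNge; apply/negP => H; move/negP: (nFk); apply.
    move/asboolP: (Fi) => [p [pp pL pi]]; apply/asboolP; exists (rcons p k); split.
    - rewrite rcons_path pp pi /e1 H andbT /=; apply/eqP => ik.
      by move/negP: (nFk); rewrite -ik.
    - by rewrite -rcons_cons all_rcons pL andbT -sL.
    - by rewrite last_rcons.
  exact: set_dist_le.
(* The point [pt i] is within [rho / 8] of [c0], and the reach [2 ^+ n.+1 * d i] of its cutoff is at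
   most [S1 * D0], hence at most [T] and [rho / 8]. The sum explains the radius [rho / 4] in
   [hd]. *)
have step6 i z : F i -> edist z (pt i) <= 2 ^+ n.+1 * d i ->
    disk R z /\ forall k, B k z -> k \in s.
  move=> Fi zp; have [di Hi] := FD i Fi.
  have hz : hdisk c0 z.
    apply: hd; have := edist_triangle (pt i) z c0; have := Hi _ (Bpt i).
    have b1 : 2 ^+ n.+1 * d i <= S1 * D0.
      apply: ler_pM => //; first exact: ltW.
      by apply: ler_weXn2l; [rewrite ler1n|rewrite -[n.+3]addn2 leq_addr].
    have b2 : T <= rho / 8 by have := @mT 1 isT; rewrite mul1r.
    have TE : T = D0 + 2 * (S1 * D0) by rewrite /T; ring.
    have b3 : 0 < S1 * D0 by rewrite mulr_gt0 //; have := S1_ge1; lra.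
    by have := D00; move: zp b1 b2 TE b3; lra.
  by split=> [|k Bk]; [case: hz|rewrite sL; exact: memL hz].
move=> /(_ step1 step2 step3 step4 Bpt step5 step6); apply/negP; rewrite -ltNge.
apply: le_lt_trans small; rewrite ler_pM2l ?exprn_gt0 //.
apply: ler_wpM2r.
  by rewrite mulr_ge0 ?invr_ge0 // mulr_ge0 // sqr_ge0.
by rewrite ler_pXn2r ?nnegrE // ler_nat size_sort.
Qed.

End From_hole.

Lemma path_to_boundary j : exists p, [/\ path (hole_graph B S) (Some j) p,
  last (Some j) p = None & (size p <= N)%N].
Proof.
apply: contrapT => far; have /choice[pt Bpt] := B0.
exact: (chain_absurd far Bpt).
Qed.

End Path_to_boundary.

Theorem theorem5p4 (R : realType) :
  exists (S0 : \bar R -> \bar R -> R) (M0 : \bar R -> \bar R -> nat),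
  forall (I : countType) (B : I -> set (plane R)) (gamma : I -> R -> plane R),
    regular_holes B ->
    period_curves B gamma ->
    (local_multiplicity B < +oo)%E ->
    interpolation_property B gamma ->
    let CI := interpolation_constant B gamma in
    let N := local_multiplicity B in
    exists (S : R) (M : nat),
      [/\ 0 < S,
          S <= S0 CI N,
          (M <= M0 CI N)%N,
          graph_connected (hole_graph B S) &
          forall j : I,
            (graph_dist R (hole_graph B S) (Some j) None <= M%:R%:E)%E].
Proof.
have [A [a [sA sa dA [a0 aout Al Ar]]]] := @exists_smooth_step R.
have Aa : step_pair A a by split.
have [M _ aM] := bump_bounded Aa.
(* [CI] and [N] are infima: adding one unit yields admissible constants from the adherence of the
   infimum alone, and keeps [C] positive when [CI] is 0. *)
pose Nn (N : \bar R) : nat := (Num.truncn (fine N)).+1.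
pose Cc (CI : \bar R) : R := fine CI + 1.
(* The number of dyadic scales is taken just large enough to contradict [isolated_cluster]. The
   bound [M] belongs to the fixed bump and not to the domain, so [S0] is a function of [CI] and [N]
   only. *)
pose nn CI N : nat :=
  (Num.truncn (Cc CI ^+ 2 * ((Nn N)%:R ^+ 2 * (224 * M ^+ 2)))).+1.
pose S0 CI N : R := 16 * (Nn N).+1%:R * (1 + 2 * 2 ^+ (nn CI N).+3).
exists S0, (fun _ N => Nn N) => I B gamma rB pg finN [C1 [C10 iC1]] CI N.
have CI0 : (0 <= CI)%E by apply: le_ereal_inf_tmp => _ [C [C0 _] <-]; rewrite lee_fin.
have CIfin : CI \is a fin_num.
  rewrite ge0_fin_numE //; apply: le_lt_trans (ltry C1).
  by apply: ereal_inf_lbound; exists C1.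
have N0 : (0 <= N)%E by apply: le_ereal_inf_tmp => _ [m _ <-]; rewrite lee_fin.
have Nfin : N \is a fin_num by rewrite ge0_fin_numE.
pose C := Cc CI.
have C0 : 0 < C by rewrite ltr_wpDl // fine_ge0.
have iC : interpolation_with B gamma C.
  have [_ [C' [C'0 iC'] <-] C'C] := lb_ereal_inf_adherent ltr01 CIfin.
  have {}C'C : (C'%:E < CI + 1%:E)%E := C'C.
  rewrite -(fineK CIfin) -EFinD lte_fin in C'C; move=> b /iC'[w [cw pw nw]].
  exists w; split=> //; apply: le_trans nw _.
  by rewrite ler_wpM2r ?sqrtr_ge0 // ltW.
have mult c : disk R c -> (Defs.meets B (hdisk c) #<= `I_(Nn N))%card.
  have [_ [m Hm <-] mN] := lb_ereal_inf_adherent ltr01 Nfin.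
  have {}mN : (m%:R%:E < N + 1%:E)%E := mN.
  rewrite -(fineK Nfin) -EFinD lte_fin in mN; move=> Dc.
  apply: card_le_trans (Hm c Dc) _; rewrite card_le_II /Nn.
  rewrite -ltnS -(ltr_nat R); apply: lt_trans mN _.
  by rewrite -natr1 ltrD2r; exact: truncnS_gt.
have big : C ^+ 2 * ((Nn N)%:R ^+ 2 * (224 * M ^+ 2)) < (nn CI N)%:R.
  exact: truncnS_gt.
have small : C ^+ 2 * ((Nn N)%:R ^+ 2 * (224 * M ^+ 2 / (nn CI N)%:R)) < 1.
  rewrite !mulrA ltr_pdivrMr ?ltr0n // mul1r.
  by move: big; rewrite !mulrA.
have main := path_to_boundary Aa aM rB pg C0 iC mult (ltn0Sn _) small.
exists (S0 CI N), (Nn N); split=> //.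
- by rewrite /S0 !mulr_gt0 // addr_gt0 // mulr_gt0 // exprn_gt0.
- have toN x : exists2 p, path (hole_graph B (S0 CI N)) x p & last x p = None.
    by case: x => [j|]; [have [p [pp pl _]] := main j; exists p|exists [::]].
  move=> x y; have [p pp pl] := toN x; have [q qq ql] := toN y.
  have [r rr rl] := path_reverse (@hole_graph_sym R I B (S0 CI N)) qq.
  exists (p ++ r); rewrite cat_path last_cat pp pl.
  by rewrite ql in rr rl.
- move=> j; have [p [pp pl sp]] := main j.
  apply: (@le_trans _ _ (size p)%:R%:E); last by rewrite lee_fin ler_nat.
  by apply: ereal_inf_lbound; exists p.
Qed.
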